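(* Let $q>0$, $q\neq1$. The 4D calculus $(\Omega^1_{4D},\mathrm d)$ over $\mathbb C_q[SU_2]$ continuously extends to $C^\infty_{\mathcal D}(SU_2^q)$, where $\mathcal D$ is defined by $\mathcal Dt^l_{mn}=\pm[2l+1]_q\,t^l_{mn}$.
   Context: $[n]_q=\frac{q^n-q^{-n}}{q-q^{-1}}$. $\mathbb C_q[SU_2]$ is the Hopf $*$-algebra with matrix of generators $\begin{pmatrix}a&b\\c&d\end{pmatrix}$ (matrix coproduct), relations $ba=qab$, $ca=qac$, $db=qbd$, $dc=qcd$, $bc=cb$, $da-ad=(q-q^{-1})bc$, $ad-q^{-1}bc=1$, and $*$-structure making the generator matrix unitary; it is the dense Hopf $*$-algebra of matrix elements of the compact quantum group $SU_2^q$ with Haar state $h$ and GNS space $L^2(SU_2^q)$. The irreducible unitary corepresentations are $t^l=(t^l_{mn})_{m,n=-l}^{l}$, $l\in\frac12\mathbb N_0$ (of dimension $2l+1$). A first order differential calculus over a unital algebra $A$ is an $A$-bimodule $\Omega^1$ with linear $\mathrm d:A\to\Omega^1$ satisfying the Leibniz rule $\mathrm d(fg)=(\mathrm df)g+f\,\mathrm dg$ and $\Omega^1=\mathrm{span}\{f\,\mathrm dg\}$. The bicovariant 4D calculus on $\mathbb C_q[SU_2]$ is the free left module with basis (of left-invariant forms) $e_a,e_b,e_c,e_d$; with $\lambda=1-q^{-2}$, $[x,y]=xy-yx$ and $[x,y]_r=xy-r\,yx$ (so $[x,y]_q=xy-qyx$, $[x,y]_{q^{-1}}=xy-q^{-1}yx$),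 the bimodule relations and exterior derivative are $$e_a\begin{pmatrix}a&b\\c&d\end{pmatrix}=\begin{pmatrix}qa&q^{-1}b\\ qc&q^{-1}d\end{pmatrix}e_a,$$ $$\Big[e_b,\begin{pmatrix}a&b\\c&d\end{pmatrix}\Big]=q\lambda\begin{pmatrix}0&a\\0&c\end{pmatrix}e_a,\qquad \Big[e_c,\begin{pmatrix}a&b\\c&d\end{pmatrix}\Big]=q\lambda\begin{pmatrix}b&0\\d&0\end{pmatrix}e_a,$$ $$\Big[e_d,\begin{pmatrix}a\\c\end{pmatrix}\Big]_{q^{-1}}=\lambda\begin{pmatrix}b\\d\end{pmatrix}e_b,\qquad \Big[e_d,\begin{pmatrix}b\\d\end{pmatrix}\Big]_q=\lambda\begin{pmatrix}a\\c\end{pmatrix}e_c+q\lambda^2\begin{pmatrix}b\\d\end{pmatrix}e_a,$$ $$\mathrm d\begin{pmatrix}a\\c\end{pmatrix}=\begin{pmatrix}a\\c\end{pmatrix}\big((q-1)e_a+(q^{-1}-1)e_d\big)+\lambda\begin{pmatrix}b\\d\end{pmatrix}e_b,$$ $$\mathrm d\begin{pmatrix}b\\d\end{pmatrix}=\begin{pmatrix}b\\d\end{pmatrix}\big((q^{-1}-1+q\lambda^2)e_a+(q-1)e_d\big)+\lambda\begin{pmatrix}a\\c\end{pmatrix}e_c.$$ $\mathcal D$ is extended to a closed operator on $L^2(SU_2^q)$ and $C^\infty_{\mathcal D}(SU_2^q)=\bigcap_{\alpha\ge0}\mathrm{Dom}(|\mathcal D|^\alpha)$ with Fréchet seminorms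 $\||\mathcal D|^\alpha\varphi\|_{L^2}$, regarded as an algebra containing $\mathbb C_q[SU_2]$. For a left-covariant calculus with basis $\{e_i\}$ of left-invariant forms spanning $\Lambda^1$, let $\partial^i,C_i{}^j$ be the operators on $\mathbb C_q[SU_2]$ with $\mathrm df=\sum_i(\partial^if)e_i$ and $e_if=\sum_jC_i{}^j(f)e_j$. ''Continuously extends to $C^\infty_{\mathcal D}$'' means: all $\partial^i,C_i{}^j$ extend to continuous operators $C^\infty_{\mathcal D}\to C^\infty_{\mathcal D}$, and $C^\infty_{\mathcal D}\otimes\Lambda^1$ with $\mathrm df=\sum_i(\partial^if)e_i$, $e_if=\sum_jC_i{}^j(f)e_j$ is a differential calculus on $C^\infty_{\mathcal D}$. *)

(* Defs.v *)
From HB Require Import structures.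
From mathcomp Require Import all_boot all_order all_algebra.
From mathcomp Require Import complex.
From mathcomp Require Import all_classical all_reals all_analysis.

Set Implicit Arguments.
Unset Strict Implicit.
Unset Printing Implicit Defensive.
Import Order.TTheory GRing.Theory Num.Theory numFieldNormedType.Exports.
Local Open Scope quotient_scope.
Local Open Scope classical_set_scope.
Local Open Scope complex_scope.
Local Open Scope ring_scope.

(* The algebra C_q[SU_2].  It is presented by generators and relations: formal *)
(* expressions in the entries of the generator matrix (a, b; c, d), two of     *)
(* them being identified when they agree in every unital complex algebra for   *)
(* every quadruple of elements satisfying the defining relations.              *)

Definition SU2_relations (R : realType) (q : R) (B : algType R[i])
    (u : 'M[B]_2) : Prop :=
  let a := u 0 0 in let b := u 0 1 in let c := u 1 0 in let d := u 1 1 in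
  [/\ [/\ b * a = q%:C *: (a * b), c * a = q%:C *: (a * c),
          d * b = q%:C *: (b * d) & d * c = q%:C *: (c * d)],
      b * c = c * b,
      d * a - a * d = (q - q^-1)%:C *: (b * c) &
      a * d - q^-1%:C *: (b * c) = 1].

Inductive SU2_term (R : realType) : Type :=
| TCst of R[i]
| TGen of 'I_2 & 'I_2
| TAdd of SU2_term R & SU2_term R
| TMul of SU2_term R & SU2_term R.

HB.instance Definition _ (R : realType) := gen_eqMixin (SU2_term R).
HB.instance Definition _ (R : realType) := gen_choiceMixin (SU2_term R).

Fixpoint SU2_eval (R : realType) (B : algType R[i]) (u : 'M[B]_2)
    (s : SU2_term R) : B :=
  match s with
  | TCst k => k%:A
  | TGen i j => u i j
  | TAdd s1 s2 => SU2_eval u s1 + SU2_eval u s2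
  | TMul s1 s2 => SU2_eval u s1 * SU2_eval u s2
  end.

Definition SU2_eq (R : realType) (q : R) (s1 s2 : SU2_term R) : bool :=
  `[< forall (B : algType R[i]) (u : 'M[B]_2),
        SU2_relations q u -> SU2_eval u s1 = SU2_eval u s2 >].

Lemma SU2_eq_is_equiv (R : realType) (q : R) :
  equiv_class_of (@SU2_eq R q).
Proof.
split=> [s|s1 s2|s2 s1 s3].
- exact/asboolP.
- by apply/asboolP/asboolP => e B u Hu; rewrite e.
- move=> /asboolP e1 /asboolP e2; apply/asboolP => B u Hu.
  by rewrite e1 // e2.
Qed.

Canonical SU2_equiv (R : realType) (q : R) :=
  EquivRelPack (SU2_eq_is_equiv q).

Definition CqSU2 (R : realType) (q : R) := {eq_quot SU2_equiv q}.

Section CqSU2_algebra.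
Variables (R : realType) (q : R).
Local Notation A := (CqSU2 q).

HB.instance Definition _ := Choice.on A.
HB.instance Definition _ := EqQuotient.on A.

(* The value of an element at a quadruple u satisfying the relations. *)
Definition Cq_eval (B : algType R[i]) (u : 'M[B]_2) (x : A) : B :=
  SU2_eval u (repr x).

Lemma Cq_evalE (B : algType R[i]) (u : 'M[B]_2) (s : SU2_term R) :
  SU2_relations q u -> Cq_eval u (\pi_A s) = SU2_eval u s.
Proof.
move=> Hu; have /eqmodP /asboolP : \pi_A (repr (\pi_A s)) = \pi_A s by rewrite reprK.
exact.
Qed.

Lemma Cq_ext (x y : A) :
  (forall (B : algType R[i]) (u : 'M[B]_2),
     SU2_relations q u -> Cq_eval u x = Cq_eval u y) -> x = y.
Proof.
by move=> e; rewrite -[x]reprK -[y]reprK; apply/eqmodP/asboolP.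
Qed.

Definition Cq_cst (k : R[i]) : A := \pi_A (TCst k).
Definition Cq_add (x y : A) : A := \pi_A (TAdd (repr x) (repr y)).
Definition Cq_mul (x y : A) : A := \pi_A (TMul (repr x) (repr y)).
Definition Cq_scale (k : R[i]) (x : A) : A := \pi_A (TMul (TCst k) (repr x)).

Section Eval.
Variables (B : algType R[i]) (u : 'M[B]_2) (Hu : SU2_relations q u).
Lemma Cq_eval_cst k : Cq_eval u (Cq_cst k) = k%:A.
Proof. exact: Cq_evalE. Qed.
Lemma Cq_eval_add x y : Cq_eval u (Cq_add x y) = Cq_eval u x + Cq_eval u y.
Proof. exact: Cq_evalE. Qed.
Lemma Cq_eval_mul x y : Cq_eval u (Cq_mul x y) = Cq_eval u x * Cq_eval u y.
Proof. exact: Cq_evalE. Qed.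
Lemma Cq_eval_scale k x : Cq_eval u (Cq_scale k x) = k *: Cq_eval u x.
Proof. by rewrite /Cq_scale Cq_evalE //= -scalerAl mul1r. Qed.
Definition Cq_evalS :=
  (Cq_eval_cst, Cq_eval_add, Cq_eval_mul, Cq_eval_scale).
End Eval.

Lemma Cq_addA : associative Cq_add.
Proof. by move=> x y z; apply: Cq_ext => B u Hu; rewrite !Cq_evalS // addrA. Qed.
Lemma Cq_addC : commutative Cq_add.
Proof. by move=> x y; apply: Cq_ext => B u Hu; rewrite !Cq_evalS // addrC. Qed.
Lemma Cq_add0 : left_id (Cq_cst 0) Cq_add.
Proof.
by move=> x; apply: Cq_ext => B u Hu; rewrite !Cq_evalS // scale0r add0r.
Qed.
Lemma Cq_addN : left_inverse (Cq_cst 0) (Cq_scale (-1)) Cq_add.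
Proof.
move=> x; apply: Cq_ext => B u Hu.
by rewrite !Cq_evalS // scaleN1r addNr scale0r.
Qed.

HB.instance Definition _ :=
  GRing.isZmodule.Build A Cq_addA Cq_addC Cq_add0 Cq_addN.

Lemma Cq_mulA : associative Cq_mul.
Proof. by move=> x y z; apply: Cq_ext => B u Hu; rewrite !Cq_evalS // mulrA. Qed.
Lemma Cq_mul1 : left_id (Cq_cst 1) Cq_mul.
Proof.
by move=> x; apply: Cq_ext => B u Hu; rewrite !Cq_evalS // scale1r mul1r.
Qed.
Lemma Cq_mulr1 : right_id (Cq_cst 1) Cq_mul.
Proof.
by move=> x; apply: Cq_ext => B u Hu; rewrite !Cq_evalS // scale1r mulr1.
Qed.
Lemma Cq_mulDl : left_distributive Cq_mul Cq_add.
Proof. by move=> x y z; apply: Cq_ext => B u Hu; rewrite !Cq_evalS // mulrDl. Qed.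
Lemma Cq_mulDr : right_distributive Cq_mul Cq_add.
Proof. by move=> x y z; apply: Cq_ext => B u Hu; rewrite !Cq_evalS // mulrDr. Qed.

(* The counit separates 1 from 0. *)
Lemma Cq_oner_neq0 : Cq_cst 1 != 0.
Proof.
have Hu : SU2_relations q (1%:M : 'M[R[i]^o]_2).
  rewrite /SU2_relations !mxE /= !(mul0r, mulr0, mul1r, scaler0, subr0, subrr).
  by [].
apply/eqP => /(congr1 (Cq_eval (1%:M : 'M[R[i]^o]_2))).
rewrite (Cq_eval_cst Hu) [X in _ = X](Cq_eval_cst Hu 0) scale1r scale0r.
by move/eqP; rewrite oner_eq0.
Qed.

HB.instance Definition _ := GRing.Zmodule_isNzRing.Build A
  Cq_mulA Cq_mul1 Cq_mulr1 Cq_mulDl Cq_mulDr Cq_oner_neq0.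

Lemma Cq_scalerA k l x : Cq_scale k (Cq_scale l x) = Cq_scale (k * l) x.
Proof. by apply: Cq_ext => B u Hu; rewrite !Cq_evalS // scalerA. Qed.
Lemma Cq_scale1 : left_id 1 Cq_scale.
Proof. by move=> x; apply: Cq_ext => B u Hu; rewrite !Cq_evalS // scale1r. Qed.
Lemma Cq_scalerDr : right_distributive Cq_scale Cq_add.
Proof. by move=> k x y; apply: Cq_ext => B u Hu; rewrite !Cq_evalS // scalerDr. Qed.
Lemma Cq_scalerDl x k l :
  Cq_scale (k + l) x = Cq_add (Cq_scale k x) (Cq_scale l x).
Proof. by apply: Cq_ext => B u Hu; rewrite !Cq_evalS // scalerDl. Qed.

HB.instance Definition _ := GRing.Zmodule_isLmodule.Build R[i] A
  Cq_scalerA Cq_scale1 Cq_scalerDr Cq_scalerDl.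

Lemma Cq_scalerAl k (x y : A) :
  Cq_scale k (Cq_mul x y) = Cq_mul (Cq_scale k x) y.
Proof. by apply: Cq_ext => B u Hu; rewrite !Cq_evalS // scalerAl. Qed.
HB.instance Definition _ := GRing.Lmodule_isLalgebra.Build R[i] A Cq_scalerAl.

Lemma Cq_scalerAr k (x y : A) :
  Cq_scale k (Cq_mul x y) = Cq_mul x (Cq_scale k y).
Proof. by apply: Cq_ext => B u Hu; rewrite !Cq_evalS // scalerAr. Qed.
HB.instance Definition _ := GRing.Lalgebra_isAlgebra.Build R[i] A Cq_scalerAr.

Definition Cq_gen : 'M[A]_2 := \matrix_(i, j) \pi_A (TGen R i j).

Lemma Cq_genP : SU2_relations q Cq_gen.
Proof.
have gE (B : algType R[i]) (u : 'M[B]_2) i j : SU2_relations q u ->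
    Cq_eval u (Cq_gen i j) = u i j by move=> Hu; rewrite mxE Cq_evalE.
split; first split; try (apply: Cq_ext => B u Hu);
  rewrite ?(Cq_eval_add Hu, Cq_eval_mul Hu, Cq_eval_scale Hu, Cq_eval_cst Hu, gE) //;
  case: (Hu) => -[r1 r2 r3 r4] r5 r6 r7 //.
- by rewrite scaleN1r r6.
- by rewrite !scaleN1r r7 scale1r.
Qed.

End CqSU2_algebra.

(* The algebraic tensor product A (x) A: finite sums of pairs, identified when *)
(* every bilinear map on A * A takes the same value on them.                   *)

Section TensorSquare.
Variables (K : fieldType) (A : algType K).

Definition bilinear_map (W : lmodType K) (b : A -> A -> W) : Prop :=
  (forall x, linear (b x)) /\ (forall y, linear (b^~ y)).

Definition pairs_eval (W : zmodType) (b : A -> A -> W) (s : seq (A * A)) : W :=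
  \sum_(p <- s) b p.1 p.2.

Definition tensor_eq (s1 s2 : seq (A * A)) : bool :=
  `[< forall (W : lmodType K) (b : A -> A -> W),
        bilinear_map b -> pairs_eval b s1 = pairs_eval b s2 >].

Lemma tensor_eq_is_equiv : equiv_class_of tensor_eq.
Proof.
split=> [s|s1 s2|s2 s1 s3].
- exact/asboolP.
- by apply/asboolP/asboolP => e W b Hb; rewrite e.
- move=> /asboolP e1 /asboolP e2; apply/asboolP => W b Hb.
  by rewrite e1 // e2.
Qed.

Canonical tensor_equiv := EquivRelPack tensor_eq_is_equiv.

Definition tensor := {eq_quot tensor_equiv}.

HB.instance Definition _ := Choice.on tensor.
HB.instance Definition _ := EqQuotient.on tensor.

(* The linear map on A (x) A induced by a bilinear map b. *)
Definition tensor_lift (W : zmodType) (b : A -> A -> W) (t : tensor) : W :=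
  pairs_eval b (repr t).

Lemma tensor_liftE (W : lmodType K) (b : A -> A -> W) (s : seq (A * A)) :
  bilinear_map b -> tensor_lift b (\pi_tensor s) = pairs_eval b s.
Proof.
move=> Hb.
have /eqmodP /asboolP : \pi_tensor (repr (\pi_tensor s)) = \pi_tensor s.
  by rewrite reprK.
exact.
Qed.

Lemma tensor_ext (t1 t2 : tensor) :
  (forall (W : lmodType K) (b : A -> A -> W),
     bilinear_map b -> tensor_lift b t1 = tensor_lift b t2) -> t1 = t2.
Proof.
by move=> e; rewrite -[t1]reprK -[t2]reprK; apply/eqmodP/asboolP.
Qed.

Definition tens (x y : A) : tensor := \pi_tensor [:: (x, y)].
Definition tens_zero : tensor := \pi_tensor [::].
Definition tens_add (t1 t2 : tensor) : tensor :=
  \pi_tensor (repr t1 ++ repr t2).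
Definition tens_scale (k : K) (t : tensor) : tensor :=
  \pi_tensor [seq (k *: p.1, p.2) | p <- repr t].
Definition tens_mul (t1 t2 : tensor) : tensor :=
  \pi_tensor [seq (p.1 * r.1, p.2 * r.2) | p <- repr t1, r <- repr t2].

Section Lift.
Variables (W : lmodType K) (b : A -> A -> W) (Hb : bilinear_map b).

Lemma bilinear_mulr x y : bilinear_map (fun x' y' => b (x * x') (y * y')).
Proof.
case: Hb => H1 H2; split=> [x' k u v|y' k u v] /=.
  by rewrite mulrDr -scalerAr H1.
by rewrite mulrDr -scalerAr [LHS]H2.
Qed.

Lemma bilinear_mull (t : tensor) :
  bilinear_map (fun x y => tensor_lift (fun x' y' => b (x * x') (y * y')) t).
Proof.
case: Hb => H1 H2; split=> [x k u v|y k u v] /=;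
  rewrite /tensor_lift /pairs_eval scaler_sumr -big_split /=;
  apply: eq_bigr => p _; rewrite mulrDl -scalerAl; [exact: H1|exact: H2].
Qed.

Lemma tensor_lift_tens x y : tensor_lift b (tens x y) = b x y.
Proof. by rewrite tensor_liftE // /pairs_eval big_seq1. Qed.
Lemma tensor_lift0 : tensor_lift b tens_zero = 0.
Proof. by rewrite tensor_liftE // /pairs_eval big_nil. Qed.
Lemma tensor_liftD t1 t2 :
  tensor_lift b (tens_add t1 t2) = tensor_lift b t1 + tensor_lift b t2.
Proof. by rewrite tensor_liftE // /pairs_eval big_cat. Qed.
Lemma tensor_liftZ k t : tensor_lift b (tens_scale k t) = k *: tensor_lift b t.
Proof.
rewrite tensor_liftE // /tensor_lift /pairs_eval big_map scaler_sumr.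
apply: eq_bigr => p _ /=; case: Hb => _ /(_ p.2 k p.1 0).
have -> : b 0 p.2 = 0.
  by case: Hb => _ /(_ p.2 (-1) 0 0); rewrite scaler0 addr0 scaleN1r addNr.
by rewrite !addr0.
Qed.
Lemma tensor_liftM t1 t2 :
  tensor_lift b (tens_mul t1 t2) =
  tensor_lift (fun x y => tensor_lift (fun x' y' => b (x * x') (y * y')) t2) t1.
Proof.
by rewrite tensor_liftE // /tensor_lift /pairs_eval big_allpairs_dep.
Qed.
End Lift.

Lemma tens_addA : associative tens_add.
Proof. by move=> x y z; apply: tensor_ext => W b Hb; rewrite !tensor_liftD // addrA. Qed.
Lemma tens_addC : commutative tens_add.
Proof. by move=> x y; apply: tensor_ext => W b Hb; rewrite !tensor_liftD // addrC. Qed.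
Lemma tens_add0 : left_id tens_zero tens_add.
Proof.
by move=> x; apply: tensor_ext => W b Hb; rewrite tensor_liftD // tensor_lift0 // add0r.
Qed.
Lemma tens_addN : left_inverse tens_zero (tens_scale (-1)) tens_add.
Proof.
move=> x; apply: tensor_ext => W b Hb.
by rewrite tensor_liftD // tensor_liftZ // tensor_lift0 // scaleN1r addNr.
Qed.

HB.instance Definition _ :=
  GRing.isZmodule.Build tensor tens_addA tens_addC tens_add0 tens_addN.

Lemma tens_mulA : associative tens_mul.
Proof.
move=> x y z; apply: tensor_ext => W b Hb.
rewrite !tensor_liftM //; last exact: bilinear_mull.
rewrite /tensor_lift /pairs_eval; apply: eq_bigr => p _.
have := tensor_liftM (bilinear_mulr Hb p.1 p.2) y z.
rewrite /tensor_lift /pairs_eval => ->; apply: eq_bigr => r _.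
by apply: eq_bigr => s _; rewrite !mulrA.
Qed.
Lemma tens_mul1 : left_id (tens 1 1) tens_mul.
Proof.
move=> x; apply: tensor_ext => W b Hb.
rewrite tensor_liftM // tensor_lift_tens; last exact: bilinear_mull.
by apply: eq_bigr => p _; rewrite !mul1r.
Qed.
Lemma tens_mulr1 : right_id (tens 1 1) tens_mul.
Proof.
move=> x; apply: tensor_ext => W b Hb.
rewrite tensor_liftM //; apply: eq_bigr => p _.
by rewrite tensor_lift_tens ?mulr1 //; exact: bilinear_mulr.
Qed.
Lemma tens_mulDl : left_distributive tens_mul tens_add.
Proof.
move=> x y z; apply: tensor_ext => W b Hb.
by rewrite !(tensor_liftM, tensor_liftD) //; exact: bilinear_mull.
Qed.
Lemma tens_mulDr : right_distributive tens_mul tens_add.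
Proof.
move=> x y z; apply: tensor_ext => W b Hb.
rewrite !(tensor_liftM, tensor_liftD) //.
rewrite /tensor_lift /pairs_eval -big_split; apply: eq_bigr => p _ /=.
by have := tensor_liftD (bilinear_mulr Hb p.1 p.2) y z.
Qed.

(* The multiplication of A separates 1 (x) 1 from 0. *)
Lemma tens_oner_neq0 : tens 1 1 != 0.
Proof.
have Hb : bilinear_map (fun x y : A => x * y).
  split=> [x k u v|y k u v] /=; first by rewrite mulrDr scalerAr.
  by rewrite mulrDl scalerAl.
apply/eqP => /(congr1 (tensor_lift (fun x y : A => x * y))).
rewrite tensor_lift_tens // [X in _ = X]tensor_lift0 // mul1r.
by move/eqP; rewrite oner_eq0.
Qed.

HB.instance Definition _ := GRing.Zmodule_isNzRing.Build tensor
  tens_mulA tens_mul1 tens_mulr1 tens_mulDl tens_mulDr tens_oner_neq0.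

Lemma tens_scalerA k l x : tens_scale k (tens_scale l x) = tens_scale (k * l) x.
Proof. by apply: tensor_ext => W b Hb; rewrite !tensor_liftZ // scalerA. Qed.
Lemma tens_scale1 : left_id 1 tens_scale.
Proof. by move=> x; apply: tensor_ext => W b Hb; rewrite tensor_liftZ // scale1r. Qed.
Lemma tens_scalerDr : right_distributive tens_scale tens_add.
Proof.
move=> k x y; apply: tensor_ext => W b Hb.
by rewrite !(tensor_liftZ, tensor_liftD) // scalerDr.
Qed.
Lemma tens_scalerDl x k l :
  tens_scale (k + l) x = tens_add (tens_scale k x) (tens_scale l x).
Proof.
apply: tensor_ext => W b Hb.
by rewrite !(tensor_liftZ, tensor_liftD) // scalerDl.
Qed.

HB.instance Definition _ := GRing.Zmodule_isLmodule.Build K tensor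
  tens_scalerA tens_scale1 tens_scalerDr tens_scalerDl.

Lemma tens_scalerAl k (x y : tensor) :
  tens_scale k (tens_mul x y) = tens_mul (tens_scale k x) y.
Proof.
apply: tensor_ext => W b Hb.
by rewrite !(tensor_liftZ, tensor_liftM) //; exact: bilinear_mull.
Qed.
HB.instance Definition _ := GRing.Lmodule_isLalgebra.Build K tensor tens_scalerAl.

Lemma tens_scalerAr k (x y : tensor) :
  tens_scale k (tens_mul x y) = tens_mul x (tens_scale k y).
Proof.
apply: tensor_ext => W b Hb.
rewrite !(tensor_liftZ, tensor_liftM) //.
rewrite /tensor_lift /pairs_eval scaler_sumr; apply: eq_bigr => p _ /=.
by have := tensor_liftZ (bilinear_mulr Hb p.1 p.2) k y; rewrite /tensor_lift.
Qed.
HB.instance Definition _ := GRing.Lalgebra_isAlgebra.Build K tensor tens_scalerAr.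

End TensorSquare.

Section CompactQuantumGroup.
Variables (R : realType) (A : algType R[i]).
Variables (star : A -> A) (Delta : {lrmorphism A -> tensor A}).

Definition adjmx n (t : 'M[A]_n) : 'M[A]_n := (map_mx star t)^T.

Definition is_unitary_mx n (t : 'M[A]_n) : Prop :=
  t *m adjmx t = 1%:M /\ adjmx t *m t = 1%:M.

Definition is_star : Prop :=
  [/\ forall k x y, star (k *: x + y) = k^* *: star x + star y,
      forall x y, star (x * y) = star y * star x &
      involutive star].

Definition is_corep n (t : 'M[A]_n) : Prop :=
  forall i j, Delta (t i j) = \sum_(k < n) tens (t i k) (t k j).

(* An element of C^n is a row vector v, on which t coacts by v |-> v t; the   *)
(* row space of U is a subcomodule iff (U t) has entries in A (x) U.          *)
Definition invariant_mx n (t : 'M[A]_n) (U : 'M[R[i]]_n) : Prop :=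
  exists X : 'M[A]_n, map_mx (in_alg A) U *m t = X *m map_mx (in_alg A) U.

Definition is_irreducible n (t : 'M[A]_n) : Prop :=
  (0 < n)%N /\
  forall U : 'M[R[i]]_n, invariant_mx t U -> U = 0 \/ row_full U.

Definition is_irrep n (t : 'M[A]_n) : Prop :=
  [/\ is_corep t, is_unitary_mx t & is_irreducible t].

Definition equivalent_corep n (t s : 'M[A]_n) : Prop :=
  exists2 P : 'M[R[i]]_n, P \in unitmx &
    map_mx (in_alg A) P *m t = s *m map_mx (in_alg A) P.

(* (h (x) id) Delta f = h(f) 1 = (id (x) h) Delta f *)
Definition is_Haar_state (h : {linear A -> R[i]^o}) : Prop :=
  [/\ h 1 = 1,
      forall f, 0 <= h (star f * f),
      forall f, tensor_lift (fun x y => h x *: y) (Delta f) = (h f)%:A &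
      forall f, tensor_lift (fun x y => h y *: x) (Delta f) = (h f)%:A].

End CompactQuantumGroup.

Section QuantumSU2.
Variables (R : realType) (q : R).
Local Notation A := (CqSU2 q).
Local Notation u := (Cq_gen q).

Definition is_SU2_structure (star : A -> A)
    (Delta : {lrmorphism A -> tensor A}) : Prop :=
  [/\ is_star star, is_unitary_mx star u & is_corep Delta u].

(* t k is t^l for l = k/2, and its entry (i, j) is t^l_{mn} with m = i - l,   *)
(* n = j - l.  The last condition says that m and n are weights, i.e. that    *)
(* the diagonal torus acts diagonally as it does on the generator matrix      *)
(* t^{1/2} = (a, b; c, d); it fixes each t^l up to phases.                    *)
Definition is_SU2_irreps (star : A -> A) (Delta : {lrmorphism A -> tensor A})
    (t : forall k : nat, 'M[A]_k.+1) : Prop :=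
  [/\ forall k, is_irrep star Delta (t k),
      forall k (s : 'M[A]_k.+1),
        is_irrep star Delta s -> equivalent_corep s (t k) &
      forall (chi : {lrmorphism A -> R[i]^o}),
        chi (u 0 1) = 0 -> chi (u 1 0) = 0 ->
        forall k (i j : 'I_k.+1),
          chi (t k i j) =
          (chi (u 0 0) ^+ (k - i) * chi (u 1 1) ^+ i) *+ (i == j)].

Definition qint (n : nat) : R := (q ^+ n - q ^- n) / (q - q^-1).

End QuantumSU2.

(* The Hilbert space completion of A for the inner product <f, g> = h(f^* g). *)
Definition is_GNS_space (R : realType) (A : algType R[i]) (star : A -> A)
    (h : A -> R[i]) (H : completeNormedModType R[i]) (ip : H -> H -> R[i])
    (Lam : {linear A -> H}) : Prop :=
  [/\ forall x, linear (ip x : H -> R[i]^o),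
      forall x y, ip y x = (ip x y)^*,
      forall x, ip x x = `|x| ^+ 2,
      forall f g, ip (Lam f) (Lam g) = h (star f * g) &
      closure (range Lam) = setT].

(* Unbounded operators on H are represented by their graphs in H * H. *)

Section Operators.
Variables (R : realType) (H : completeNormedModType R[i]).

Definition lin_span (V : lmodType R[i]) (S : set V) : set V :=
  [set v | exists n (k : 'I_n -> R[i]) (s : 'I_n -> V),
     (forall i, S (s i)) /\ v = \sum_i k i *: s i].

(* |T|^alpha for a normal operator T whose eigenvectors span a dense subspace: *)
(* T v = mu v implies |T|^alpha v = |mu|^alpha v, and |T|^alpha is the closure *)
(* of the operator so defined on the span of the eigenvectors.                 *)
Definition abs_power (T : set (H * H)) (alpha : R) : set (H * H) :=
  closure (lin_span [set vw : H * H | exists mu : R[i],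
    T (vw.1, mu *: vw.1) /\
    vw.2 = ((complex.Re `|mu|) `^ alpha)%:C *: vw.1]).

Definition smooth_domain (T : set (H * H)) : set H :=
  [set x | forall alpha, 0 <= alpha -> exists y, abs_power T alpha (x, y)].

(* || |T|^alpha x || *)
Definition smooth_norm (T : set (H * H)) (alpha : R) (x : H) : R :=
  complex.Re `|xget 0 [set y | abs_power T alpha (x, y)]|.

End Operators.

(* The operator t^l_{mn} |-> +- [2l+1]_q t^l_{mn} with arbitrary signs sgn,    *)
(* extended to a closed operator on H.                                        *)
Definition Dirac (R : realType) (q : R) (H : completeNormedModType R[i])
    (Lam : CqSU2 q -> H) (t : forall k : nat, 'M[CqSU2 q]_k.+1)
    (sgn : forall k : nat, 'I_k.+1 -> 'I_k.+1 -> bool) : set (H * H) :=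
  closure (lin_span [set vw : H * H | exists k (i j : 'I_k.+1),
    vw = (Lam (t k i j),
          ((-1) ^+ sgn k i j * qint q k.+1)%:C *: Lam (t k i j))]).

(* The neighbourhood filters of the locally convex topology defined by the     *)
(* seminorms p alpha, alpha >= 0.                                              *)
Definition seminorm_nbhs (R : realType) (V : zmodType) (p : R -> V -> R)
    (x : V) : set_system V :=
  [set U | exists (s : seq R) (e : R), 0 < e /\
     [set y | forall alpha, alpha \in s -> 0 <= alpha ->
                p alpha (y - x) < e] `<=` U].

Definition seminorm_continuous (R : realType) (V : zmodType) (p : R -> V -> R)
    (T : V -> V) : Prop :=
  forall x, T @ seminorm_nbhs p x `=>` seminorm_nbhs p (T x).

(* First order differential calculi; the right action of A on the left module *)
(* M is given by ract.                                                        *)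
Record is_fodc (K : fieldType) (A : algType K) (M : lmodType A)
    (ract : M -> A -> M) (d : A -> M) : Prop := IsFodc {
  fodc_ractDl : forall w1 w2 f, ract (w1 + w2) f = ract w1 f + ract w2 f;
  fodc_ractDr : forall w f g, ract w (f + g) = ract w f + ract w g;
  fodc_ract1 : forall w, ract w 1 = w;
  fodc_ractM : forall w f g, ract w (f * g) = ract (ract w f) g;
  fodc_bimod : forall f w g, ract (f *: w) g = f *: ract w g;
  fodc_scalar : forall (k : K) w, ract w k%:A = k%:A *: w;
  fodc_linear : forall (k : K) f g, d (k *: f + g) = k%:A *: d f + d g;
  fodc_leibniz : forall f g, d (f * g) = ract (d f) g + f *: d g;
  fodc_span : forall w, exists n (f g : 'I_n -> A), w = \sum_i f i *: d (g i)
}.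

(* The basis (e_a, e_b, e_c, e_d) of the free left module of rank 4, and the   *)
(* relations of the 4D calculus.  The relations are the same for both rows    *)
(* (x, y) = (a, b) and (x, y) = (c, d) of the generator matrix.               *)
Record is_4D_calculus (R : realType) (q : R)
    (ract : 'rV[CqSU2 q]_4 -> CqSU2 q -> 'rV[CqSU2 q]_4)
    (d : CqSU2 q -> 'rV[CqSU2 q]_4) : Prop := Is4DCalculus {
  calc4D_fodc : is_fodc ract d;
  calc4D_rel : forall r : 'I_2,
    let x := Cq_gen q r 0 in let y := Cq_gen q r 1 in
    let e i : 'rV[CqSU2 q]_4 := delta_mx 0 i in
    let ea := e 0 in let eb := e 1 in let ec := e 2 in let ed := e 3 in
    let k (s : R) : CqSU2 q := (s%:C)%:A in
    let lambda : R := 1 - q ^- 2 in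
    let comm (s : R) w f := ract w f - (k s * f) *: w in
    [/\ ract ea x = (k q * x) *: ea /\ ract ea y = (k q^-1 * y) *: ea,
        comm 1 eb x = 0 /\ comm 1 eb y = (k (q * lambda) * x) *: ea,
        comm 1 ec x = (k (q * lambda) * y) *: ea /\ comm 1 ec y = 0,
        comm q^-1 ed x = (k lambda * y) *: eb /\
        comm q ed y = (k lambda * x) *: ec + (k (q * lambda ^+ 2) * y) *: ea &
        d x = x *: (k (q - 1) *: ea + k (q^-1 - 1) *: ed)
              + (k lambda * y) *: eb /\
        d y = y *: (k (q^-1 - 1 + q * lambda ^+ 2) *: ea + k (q - 1) *: ed)
              + (k lambda * x) *: ec]
}.

(* The coefficient operators of a calculus on the free left module with basis  *)
(* e_i: d f = \sum_i (partial^i f) e_i and e_i f = \sum_j C_i^j(f) e_j.        *)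
Definition dcoef (A : nzRingType) n (d : A -> 'rV[A]_n) (i : 'I_n) (f : A) : A :=
  d f 0 i.
Definition ccoef (A : nzRingType) n (ract : 'rV[A]_n -> A -> 'rV[A]_n)
    (i j : 'I_n) (f : A) : A :=
  ract (delta_mx 0 i) f 0 j.

Section SmoothExtension.
Variables (R : realType) (A : algType R[i]) (H : completeNormedModType R[i]).
Variables (Lam : A -> H) (D : set (H * H)).
Variables (B : algType R[i]) (kappa : {linear B -> H})
  (iota : {lrmorphism A -> B}).

Definition Cinf_seminorm (alpha : R) (x : B) : R :=
  smooth_norm D alpha (kappa x).

(* B is C^infty_D, embedded in H by kappa, with an algebra structure that is   *)
(* jointly continuous and contains A (embedded by iota) as a subalgebra.       *)
Definition is_smooth_algebra : Prop :=
  [/\ injective kappa /\ range kappa = smooth_domain D,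
      injective iota,
      forall f, kappa (iota f) = Lam f &
      forall x y : B,
        (fun z : B * B => z.1 * z.2) @
          filter_prod (seminorm_nbhs Cinf_seminorm x)
                      (seminorm_nbhs Cinf_seminorm y)
        `=>` seminorm_nbhs Cinf_seminorm (x * y)].

Definition continuously_extends n (ract : 'rV[A]_n -> A -> 'rV[A]_n)
    (d : A -> 'rV[A]_n) : Prop :=
  exists (dB : 'I_n -> {linear B -> B}) (CB : 'I_n -> 'I_n -> {linear B -> B}),
  [/\ forall i f, dB i (iota f) = iota (dcoef d i f),
      forall i j f, CB i j (iota f) = iota (ccoef ract i j f),
      forall i, seminorm_continuous Cinf_seminorm (dB i),
      forall i j, seminorm_continuous Cinf_seminorm (CB i j) &
      is_fodc (M := 'rV[B]_n)
        (fun w g => \row_j \sum_i w 0 i * CB i j g)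
        (fun f => \row_i dB i f)].

End SmoothExtension.

(* Main.v *)
(** The exterior derivative and the right multiplications of the calculus
    assemble into a unital homomorphism f |-> ((f, d f), (0, C f)) from A to
    matrices over A.  Write an element of A as a combination of words in the
    generators; the infimum of the weighted l1 norms sum |x_w| r^|w| of such
    expressions is submultiplicative, and a homomorphism into matrices is
    bounded for these norms at the price of enlarging r.  Hence it suffices to
    compare them with the norms || |D|^alpha f ||, and the explicit relations
    of the 4D calculus play no role.

    In one direction, a word of length n acts as a contraction on L^2 and lies
    in the span of the t^k with k <= n (complete reducibility, together with
    the weights of the diagonal torus), where |D| grows at most exponentially
    in n.  In the other direction, the orthogonality relations, whose constants
    come from the square of the antipode, bound the coefficients of f on the
    t^k_ij exponentially in k, and t^(k+1) = V^* (u (x) t^k) V for an isometry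
    V respecting the weights, which bounds the word norm of t^k_ij by (4r)^k;
    since |D| is at least max(q, 1/q)^k on the span of t^k, a power of |D|
    absorbs all these exponentials. *)

Require Import Defs.
From HB Require Import structures.
From mathcomp Require Import all_boot all_order all_algebra.
From mathcomp Require Import complex ring lra zify.
From mathcomp Require Import all_classical all_reals all_analysis.
Import Order.TTheory GRing.Theory Num.Theory numFieldNormedType.Exports.
Local Open Scope classical_set_scope.
Local Open Scope complex_scope.
Local Open Scope ring_scope.

Set Implicit Arguments.
Unset Strict Implicit.
Unset Printing Implicit Defensive.
Local Open Scope quotient_scope.

(** * Presentation of the algebra *)

(** Two obstacles shape the proof. First, the word norm of t^k_ij must be bounded exponentially in
    k, because a fixed power of |D| absorbs nothing faster. The expansion of t^(k+1)_ij in products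
    of an entry of u and an entry of t^k has of the order of k^2 terms, and iterating that count
    would give factorials; the weights leave at most four nonzero terms. The intertwiner V is never
    computed: it arises by averaging with the Haar state, and Schur's lemma normalizes it.

    Second, a smooth element is only a vector of L^2, so its product with another one has to be
    constructed. The product and all the operators of the calculus are obtained from one kind of
    estimate on A, which bounds a seminorm of T(f) g by the product of a seminorm of f and one of g;
    completeness of the smooth domain then gives the extension, and identities pass to limits
    because A is dense.

    The data provide only the coproduct and the involution. The counit and the antipode, on which
    the constants in the orthogonality relations depend, are built from the presentation. *)

Section ConverseAlgebra.
Variables (K : fieldType) (A : algType K).

(** The antipode reverses products. With this algebra structure on the converse ring it becomes a
    homomorphism, to which the universal property of the presentation applies. *)
Let cscale (k : K) (x : A^c) : A^c := k *: (x : A).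

Let cscalerA k l x : cscale k (cscale l x) = cscale (k * l) x.
Proof. exact: scalerA. Qed.
Let cscale1r : left_id 1 cscale.
Proof. exact: scale1r. Qed.
Let cscalerDr : right_distributive cscale +%R.
Proof. exact: scalerDr. Qed.
Let cscalerDl x : {morph cscale^~ x : k l / k + l}.
Proof. by move=> k l; apply: scalerDl. Qed.

HB.instance Definition _ := GRing.Zmodule_isLmodule.Build K A^c
  cscalerA cscale1r cscalerDr cscalerDl.

Let cscalerAl k (x y : A^c) : k *: (x * y) = (k *: x) * y.
Proof. exact: (scalerAr k (y : A) (x : A)). Qed.
HB.instance Definition _ := GRing.Lmodule_isLalgebra.Build K A^c cscalerAl.

Let cscalerAr k (x y : A^c) : k *: (x * y) = x * (k *: y).
Proof. exact: (scalerAl k (y : A) (x : A)). Qed.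
HB.instance Definition _ := GRing.Lalgebra_isAlgebra.Build K A^c cscalerAr.
End ConverseAlgebra.

Section Presentation.
Variables (R : realType) (q : R).
Local Notation A := (CqSU2 q).
Local Notation C := R[i].
Local Notation u := (Cq_gen q).

Lemma Cq_ind (P : A -> Prop) :
  (forall k : C, P k%:A) -> (forall i j, P (u i j)) ->
  (forall x y, P x -> P y -> P (x + y)) ->
  (forall x y, P x -> P y -> P (x * y)) -> forall x, P x.
Proof.
move=> Pk Pu PD PM x; rewrite -[x]reprK.
elim: (repr x) => [k|i j|s1 IH1 s2 IH2|s1 IH1 s2 IH2].
- suff -> : \pi_A (TCst k) = k%:A :> A by [].
  apply: Cq_ext => B v Hv.
  rewrite (Cq_eval_scale Hv) (Cq_eval_cst Hv 1) Cq_evalE //=.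
  by rewrite scale1r.
- by have := Pu i j; rewrite mxE.
- suff -> : \pi_A (TAdd s1 s2) = \pi_A s1 + \pi_A s2 :> A by apply: PD.
  by apply: Cq_ext => B v Hv; rewrite (Cq_eval_add Hv) !Cq_evalE.
- suff -> : \pi_A (TMul s1 s2) = \pi_A s1 * \pi_A s2 :> A by apply: PM.
  by apply: Cq_ext => B v Hv; rewrite (Cq_eval_mul Hv) !Cq_evalE.
Qed.

Section Hom.
Variables (B : algType C) (v : 'M[B]_2).
(** Universal property of the presentation. The proof of the relations is an argument so that
    linearity and multiplicativity can be inferred from the term. *)
Definition Cq_hom (Hv : SU2_relations q v) : A -> B := Cq_eval v.
Variable Hv : SU2_relations q v.
Let hom_linear : linear (Cq_hom Hv).
Proof.
by move=> k x y; rewrite /Cq_hom (Cq_eval_add Hv) (Cq_eval_scale Hv).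
Qed.
HB.instance Definition _ := GRing.isLinear.Build C A B *:%R (Cq_hom Hv) hom_linear.
Let hom_monoid : monoid_morphism (Cq_hom Hv).
Proof.
split; first by rewrite /Cq_hom (Cq_eval_cst Hv) scale1r.
by move=> x y; rewrite /Cq_hom (Cq_eval_mul Hv).
Qed.
HB.instance Definition _ := GRing.isMonoidMorphism.Build A B (Cq_hom Hv) hom_monoid.
Lemma Cq_homE i j : Cq_hom Hv (u i j) = v i j.
Proof. by rewrite /Cq_hom mxE Cq_evalE. Qed.
End Hom.

End Presentation.

(** * Corepresentations and Schur's lemma *)

Section TensorTheory.
Variables (K : fieldType) (A : algType K).

Lemma tens_bilinear : bilinear_map (@tens K A).
Proof.
split=> [x k y z|y k x z]; apply: tensor_ext => W b Hb;
  rewrite (tensor_liftD Hb) (tensor_liftZ Hb) !(tensor_lift_tens Hb);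
  by case: Hb => H1 H2; first [exact: H1|exact: H2].
Qed.

Lemma tensM (x y x' y' : A) : tens x y * tens x' y' = tens (x * x') (y * y').
Proof.
apply: tensor_ext => W b Hb; rewrite (tensor_liftM Hb) (tensor_lift_tens Hb).
rewrite (tensor_lift_tens (bilinear_mull Hb _)).
by rewrite (tensor_lift_tens (bilinear_mulr Hb _ _)).
Qed.

(** The leg embeddings turn the corepresentation identity into a product of two matrices over A (x)
    A, see [corepP]; inverses and scalar changes of basis then apply to it. *)
Definition tensl (x : A) : tensor A := tens x 1.
Definition tensr (x : A) : tensor A := tens 1 x.

Let tensl_linear : linear tensl. Proof. by case: tens_bilinear => _ H; apply: H. Qed.
HB.instance Definition _ := GRing.isLinear.Build K A (tensor A) *:%R tensl tensl_linear.
Let tensl_monoid : monoid_morphism tensl.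
Proof. by split=> // x y; rewrite /tensl tensM mulr1. Qed.
HB.instance Definition _ := GRing.isMonoidMorphism.Build A (tensor A) tensl tensl_monoid.

Let tensr_linear : linear tensr. Proof. by case: tens_bilinear => H _; apply: H. Qed.
HB.instance Definition _ := GRing.isLinear.Build K A (tensor A) *:%R tensr tensr_linear.
Let tensr_monoid : monoid_morphism tensr.
Proof. by split=> // x y; rewrite /tensr tensM mul1r. Qed.
HB.instance Definition _ := GRing.isMonoidMorphism.Build A (tensor A) tensr tensr_monoid.

Lemma tenslr x y : tensl x * tensr y = tens x y.
Proof. by rewrite tensM mulr1 mul1r. Qed.
Lemma tensrl x y : tensr y * tensl x = tens x y.
Proof. by rewrite tensM mulr1 mul1r. Qed.

Lemma tens_sumM (I J : finType) (a b : I -> A) (c d : J -> A) :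
  (\sum_i tens (a i) (b i)) * (\sum_j tens (c j) (d j)) =
  \sum_i \sum_j tens (a i * c j) (b i * d j).
Proof.
rewrite mulr_suml; apply: eq_bigr => i _; rewrite mulr_sumr.
by apply: eq_bigr => j _; rewrite tensM.
Qed.

Section Lift.
Variables (W : lmodType K) (b : A -> A -> W) (Hb : bilinear_map b).
Lemma tensor_lift_sum I (r : seq I) (P : pred I) F :
  tensor_lift b (\sum_(i <- r | P i) F i) = \sum_(i <- r | P i) tensor_lift b (F i).
Proof.
exact: (big_morph _ (tensor_liftD Hb) (tensor_lift0 Hb)).
Qed.
End Lift.
End TensorTheory.

Lemma bilinear_map_of (K : fieldType) (A : algType K) (B : algType K)
    (f g : A -> B) : linear f -> linear g -> bilinear_map (fun x y => f x * g y).
Proof.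
move=> fl gl; split=> [x k y z|y k x z] /=; rewrite ?fl ?gl.
  by rewrite mulrDr scalerAr.
by rewrite mulrDl scalerAl.
Qed.

Lemma comulM (R : realType) (A : algType R[i])
    (Delta : {lrmorphism A -> tensor A}) x y :
  Delta (x * y) = Delta x * Delta y.
Proof. exact: rmorphM. Qed.

Section Coreps.
Variables (R : realType) (A : algType R[i]).
Local Notation C := R[i].
Variables (star : A -> A) (Delta : {lrmorphism A -> tensor A}).
Hypothesis Hstar : is_star star.

Local Notation adj := (adjmx star).
Local Notation "M %:A_" := (map_mx (in_alg A) M) (at level 2, format "M %:A_").

Lemma map_algM m n p (P : 'M[C]_(m, n)) (Q : 'M[C]_(n, p)) :
  (P *m Q)%:A_ = P%:A_ *m Q%:A_.
Proof. exact: map_mxM. Qed.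
Lemma map_algB m n (P Q : 'M[C]_(m, n)) : (P - Q)%:A_ = P%:A_ - Q%:A_.
Proof. exact: map_mxB. Qed.
Lemma map_alg1 n : (1%:M : 'M[C]_n)%:A_ = 1%:M.
Proof. exact: map_mx1. Qed.
Lemma map_alg0 m n : (0 : 'M[C]_(m, n))%:A_ = 0.
Proof. exact: map_mx0. Qed.

Lemma starZD k x y : star (k *: x + y) = k^* *: star x + star y.
Proof. by case: Hstar => H _ _; apply: H. Qed.
Lemma starM x y : star (x * y) = star y * star x.
Proof. by case: Hstar => _ H _; apply: H. Qed.
Lemma starK : involutive star. Proof. by case: Hstar. Qed.
Lemma starD x y : star (x + y) = star x + star y.
Proof. by rewrite -[x]scale1r starZD rmorph1 !scale1r. Qed.
Lemma star0 : star 0 = 0.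
Proof. by apply: (addrI (star 0)); rewrite -starD !addr0. Qed.
Lemma starZ k x : star (k *: x) = k^* *: star x.
Proof. by rewrite -[k *: x]addr0 starZD star0 addr0. Qed.
Lemma star1 : star 1 = 1.
Proof. by apply: (can_inj starK); rewrite -[star 1]mulr1 starM !starK mulr1. Qed.
Lemma star_sum I (r : seq I) (P : pred I) F :
  star (\sum_(i <- r | P i) F i) = \sum_(i <- r | P i) star (F i).
Proof. exact: (big_morph _ starD star0). Qed.

Definition sadj m n (t : 'M[A]_(m, n)) : 'M[A]_(n, m) := (map_mx star t)^T.

Lemma sadj_entry m n (t : 'M[A]_(m, n)) i j : sadj t i j = star (t j i).
Proof. by rewrite !mxE. Qed.
Lemma sadjE n (t : 'M[A]_n) : adj t = sadj t. Proof. by []. Qed.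
Lemma sadjM m n p (s : 'M[A]_(m, n)) (t : 'M[A]_(n, p)) :
  sadj (s *m t) = sadj t *m sadj s.
Proof.
apply/matrixP=> i j; rewrite !mxE star_sum; apply: eq_bigr => k _.
by rewrite !mxE starM.
Qed.
Lemma sadjK m n (t : 'M[A]_(m, n)) : sadj (sadj t) = t.
Proof. by apply/matrixP=> i j; rewrite !mxE starK. Qed.
Lemma sadj_scal m n (P : 'M[C]_(m, n)) : sadj P%:A_ = (map_mx Num.conj P)^T%:A_.
Proof. by apply/matrixP=> i j; rewrite !mxE /= starZ star1. Qed.

Lemma corepP n (t : 'M[A]_n) :
  is_corep Delta t <-> map_mx Delta t = map_mx (@tensl _ A) t *m map_mx (@tensr _ A) t.
Proof.
split=> [Ht|Ht i j].
  apply/matrixP=> i j; rewrite !mxE Ht; apply: eq_bigr => k _.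
  by rewrite !mxE tenslr.
have /matrixP/(_ i j) := Ht; rewrite !mxE => ->; apply: eq_bigr => k _.
by rewrite !mxE tenslr.
Qed.


(** Uniqueness of inverses: [map_mx Delta (adj t)] is a left inverse and [X] a right inverse of
    [map_mx Delta t]. This is how [Delta] and [star] are seen to be compatible on the entries of
    t. *)
Lemma corep_star n (t : 'M[A]_n) : is_corep Delta t -> is_unitary_mx star t ->
  forall i j, Delta (star (t i j)) = \sum_k tens (star (t i k)) (star (t k j)).
Proof.
move=> /corepP Ht [t1 t2] i j.
pose X := map_mx (@tensr _ A) (adj t) *m map_mx (@tensl _ A) (adj t).
have HX : map_mx Delta t *m X = 1%:M.
  rewrite Ht /X -mulmxA (mulmxA (map_mx (@tensr _ A) t)).
  rewrite -(map_mxM (@tensr _ A)). rewrite t1 map_mx1 mul1mx.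
  by rewrite -(map_mxM (@tensl _ A)) t1 map_mx1.
have : map_mx Delta (adj t) = X.
  rewrite -[RHS]mul1mx -(map_mx1 Delta) -t2 (map_mxM Delta) -mulmxA HX.
  by rewrite mulmx1.
move=> /matrixP/(_ j i); rewrite !mxE => ->; apply: eq_bigr => k _.
by rewrite !mxE tensrl.
Qed.

Section Haar.
Variable (h : {linear A -> C^o}).
Hypothesis Hh : is_Haar_state star Delta h.

(** The average of the matrix unit E_ik: h applied entrywise to adj(t) E_ik s. *)
Definition haar_mx m n (t : 'M[A]_m) (s : 'M[A]_n) i k : 'M[C]_(m, n) :=
  \matrix_(p, r) (h (star (t i p) * s k r) : C).

(** Invariance of h on the entries of adj(t) E_ik s gives adj(t) Y s = Y, and unitarity of t moves
    its adjoint to the other side. *)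
Lemma haar_intertwiner m n (t : 'M[A]_m) (s : 'M[A]_n) i k :
  is_corep Delta t -> is_unitary_mx star t -> is_corep Delta s ->
  (haar_mx t s i k)%:A_ *m s = t *m (haar_mx t s i k)%:A_.
Proof.
move=> Ct Ut Cs; set Y := haar_mx t s i k.
suff E : adj t *m (Y%:A_ *m s) = Y%:A_.
  by rewrite -[in RHS]E mulmxA; case: Ut => -> _; rewrite mul1mx.
apply/matrixP=> j l; rewrite mxE [RHS]mxE [Y j l]mxE /=.
case: Hh => _ _ /(_ (star (t i j) * s k l)) <- _.
rewrite (comulM Delta) Cs (corep_star Ct Ut).
have Hb : bilinear_map (fun x y : A => (h x : C) *: y).
  split=> [x c y z|y c x z] /=; first by rewrite scalerDr !scalerA mulrC.
  by rewrite linearP /= scalerDl scalerA.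
rewrite tens_sumM (tensor_lift_sum Hb); apply: eq_bigr => p _.
rewrite (tensor_lift_sum Hb) [(_ *m s) p l]mxE mulr_sumr; apply: eq_bigr => r _.
by rewrite (tensor_lift_tens Hb) !mxE mulr_algl scalerAr.
Qed.
End Haar.

Lemma irreducible_invariant n (t : 'M[A]_n) (U : 'M[C]_n) (X : 'M[A]_n) :
  is_irreducible t -> U%:A_ *m t = X *m U%:A_ -> U = 0 \/ row_full U.
Proof. by move=> [_ irr] E; apply: irr; exists X. Qed.

(** The row space of Y is invariant under s. As [is_irreducible] speaks of square matrices, this
    space is represented by [<<Y>>]. *)
Lemma schur_image m n (t : 'M[A]_m) (s : 'M[A]_n) (Y : 'M[C]_(m, n)) :
  is_irreducible s -> Y%:A_ *m s = t *m Y%:A_ -> Y = 0 \/ row_full Y.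
Proof.
move=> irr E.
have /submxP[P PE] : (<<Y>> <= Y)%MS by rewrite genmxE.
have /submxP[Q QE] : (Y <= <<Y>>)%MS by rewrite genmxE.
case: (@irreducible_invariant _ s <<Y>>%MS (P%:A_ *m t *m Q%:A_)) => //.
- rewrite {1}PE map_algM -mulmxA E.
  by rewrite {1}QE map_algM !mulmxA.
- by move/(congr1 mxrank); rewrite genmxE mxrank0 => /eqP; rewrite mxrank_eq0 => /eqP; left.
- by rewrite /row_full genmxE; right.
Qed.

(** The kernel of Y is invariant under t. Over the noncommutative A there are no ranks, so
    membership in the kernel is witnessed by a scalar factor: 1 - Y Y^- = D (kermx Y) with the
    pseudoinverse Y^-. *)
Lemma schur_kernel m n (t : 'M[A]_m) (s : 'M[A]_n) (Y : 'M[C]_(m, n)) :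
  is_irreducible t -> Y%:A_ *m s = t *m Y%:A_ -> Y = 0 \/ row_free Y.
Proof.
move=> irr E.
have /submxP[D DE] : (1%:M - Y *m pinvmx Y <= kermx Y)%MS.
  by apply/sub_kermxP; rewrite mulmxBl mul1mx mulmxKpV ?subrr.
have E1 : (kermx Y)%:A_ *m t *m (Y *m pinvmx Y)%:A_ = 0.
  rewrite map_algM mulmxA -(mulmxA _ t) -E !mulmxA.
  by rewrite -map_algM mulmx_ker map_alg0 !mul0mx.
case: (@irreducible_invariant _ t (kermx Y) ((kermx Y)%:A_ *m t *m D%:A_)) => //.
- rewrite -[RHS]mulmxA -map_algM -DE.
  by rewrite map_algB map_alg1 mulmxBr E1 subr0 mulmx1.
- by move/eqP; rewrite kermx_eq0; right.
- rewrite -sub1mx => H; left.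
  by rewrite -[Y]mul1mx; apply/sub_kermxP.
Qed.

Lemma schur_eq0 m n (t : 'M[A]_m) (s : 'M[A]_n) (Y : 'M[C]_(m, n)) :
  is_irreducible t -> is_irreducible s ->
  Y%:A_ *m s = t *m Y%:A_ -> m != n -> Y = 0.
Proof.
move=> it is_ E mn; case: (schur_image is_ E) => //; rewrite /row_full => /eqP rn.
case: (schur_kernel it E) => //; rewrite /row_free => /eqP rm.
by case/eqP: mn; rewrite -rm rn.
Qed.

Lemma schur_scalar n (t : 'M[A]_n) (Y : 'M[C]_n) :
  is_irreducible t -> Y%:A_ *m t = t *m Y%:A_ -> exists c, Y = c%:M.
Proof.
move=> it E; have n0 : (0 < n)%N by case: it.
have [c cE] := eigenvalue_closed Y n0; exists c.
have E' : (Y - c%:M)%:A_ *m t = t *m (Y - c%:M)%:A_.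
  rewrite map_algB mulmxBl mulmxBr E; congr (_ - _).
  apply/matrixP=> i j; rewrite !mxE (bigD1 i) //= [RHS](bigD1 j) //= !mxE !eqxx.
  rewrite mulr_algl mulr_algr; congr (_ + _).
  rewrite !big1 // => k /negPf nk; rewrite !mxE ?nk 1?[i == k]eq_sym ?nk mulr0n.
    by rewrite /= scale0r mulr0.
  by rewrite /= scale0r mul0r.
case: (schur_kernel it E') => [/eqP|]; first by rewrite subr_eq0 => /eqP.
by rewrite -kermx_eq0 => /eqP k0; move: cE; rewrite /eigenvalue /eigenspace k0 eqxx.
Qed.
End Coreps.

(** * Characters and antipode *)

Lemma conv_mul (K : fieldType) (A B : algType K) (f g : A -> B) :
  linear f -> linear g ->
  {morph f : x y / x * y} -> {morph g : x y / x * y} ->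
  (forall x y, f x * g y = g y * f x) ->
  forall t1 t2 : tensor A,
  tensor_lift (fun x y => f x * g y) (t1 * t2) =
  tensor_lift (fun x y => f x * g y) t1 * tensor_lift (fun x y => f x * g y) t2.
Proof.
move=> fl gl fM gM fg t1 t2; rewrite (tensor_liftM (bilinear_map_of fl gl)).
rewrite [in RHS]/tensor_lift /pairs_eval mulr_suml; apply: eq_bigr => p _.
rewrite mulr_sumr; apply: eq_bigr => r _.
by rewrite fM gM -!mulrA; congr (_ * _); rewrite !mulrA fg.
Qed.

(** In S(x1 y1) x2 y2 = S(y1) (S(x1) x2) y2 the inner factor sums to a scalar and can be pulled out;
    this carries the antipode axiom from generators to products. *)
Lemma antipode_mul (K : fieldType) (A : algType K) (S : A -> A) :
  linear S -> (forall x y, S (x * y) = S y * S x) ->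
  forall (t1 t2 : tensor A) (k1 k2 : K),
  tensor_lift (fun x y => S x * y) t1 = k1%:A ->
  tensor_lift (fun x y => S x * y) t2 = k2%:A ->
  tensor_lift (fun x y => S x * y) (t1 * t2) = (k1 * k2)%:A.
Proof.
move=> Sl SM t1 t2 k1 k2 E1 E2.
have Hb : bilinear_map (fun x y : A => S x * y) by apply: bilinear_map_of.
rewrite (tensor_liftM Hb) /tensor_lift /pairs_eval exchange_big /=.
transitivity (\sum_(r <- repr t2) k1 *: (S r.1 * r.2)).
  apply: eq_bigr => r _; rewrite scalerAl -[in RHS]mulr_algr -E1.
  rewrite /tensor_lift /pairs_eval mulr_sumr mulr_suml; apply: eq_bigr => p _.
  by rewrite SM !mulrA.
by rewrite -scaler_sumr -scalerA; congr (_ *: _).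
Qed.

Section Antipode.
Variables (R : realType) (q : R) (q_gt0 : 0 < q).
Local Notation A := (CqSU2 q).
Local Notation C := R[i].
Local Notation u := (Cq_gen q).
Variables (star : A -> A) (Delta : {lrmorphism A -> tensor A}).
Hypothesis SU2 : is_SU2_structure star Delta.

Let Hstar : is_star star. Proof. by case: SU2. Qed.
Let Hu : is_unitary_mx star u. Proof. by case: SU2. Qed.
Let Du i j : Delta (u i j) = \sum_k tens (u i k) (u k j).
Proof. by case: SU2 => _ _; apply. Qed.

Let DeltaD x y : Delta (x + y) = Delta x + Delta y.
Proof. exact: raddfD. Qed.
Let Deltak k : Delta k%:A = k *: tens 1 1.
Proof. by rewrite linearZ /= rmorph1. Qed.

Lemma torus_relations (z : C) : z != 0 ->
  SU2_relations q ((\matrix_(i, j) ((if i == 0 then z else z^-1) *+ (i == j)))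
    : 'M[C^o]_2).
Proof.
move=> z0; rewrite /SU2_relations !mxE /= !(mulr0n, mulr1n, mul0r, mulr0, scaler0, subr0).
split; last by rewrite mulfV.
- by [].
- by [].
- by rewrite mulrC subrr.
Qed.

(** The points of the complexified diagonal torus. Values off the unit circle are essential below: q
    and 1/q describe the square of the antipode, 2 separates weights, and large real values measure
    growth. *)
Definition torus (z : C) (z0 : z != 0) : {lrmorphism A -> C^o} := Cq_hom (torus_relations z0).

Lemma torusE z (z0 : z != 0) i j :
  torus z0 (u i j) = (if i == 0 then z else z^-1) *+ (i == j).
Proof. by rewrite [LHS]Cq_homE mxE. Qed.

Definition counit := torus (oner_neq0 C).
Lemma counitE i j : counit (u i j) = (i == j)%:R.
Proof. by rewrite /counit torusE invr1; case: ifP. Qed.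

Lemma conj_real (x : R) : (x%:C)^* = x%:C :> C.
Proof. by apply/CrealP; rewrite complex_real. Qed.

(** In the converse algebra the product of [star x] and [star y] is [star (x * y)], so these are the
    images under [star] of the relations of u with b and c exchanged; their coefficients are
    real. *)
Lemma antipode_relations : SU2_relations q (sadj star u : 'M[A^c]_2).
Proof.
have [[r1 r2 r3 r4] r5 r6 r7] := Cq_genP q.
have E (x y : A) : (star x : A^c) * (star y : A^c) = star (x * y).
  by rewrite (starM Hstar).
have Z (x : R) (y : A) : x%:C *: (star y : A^c) = star (x%:C *: y).
  by rewrite (starZ Hstar) conj_real.
have B (x y : A) : (star x : A^c) - (star y : A^c) = star (x - y).
  by rewrite -scaleN1r (starD Hstar) (starZ Hstar) rmorphN rmorph1 scaleN1r.
split; first split; rewrite !sadj_entry !E ?Z ?B.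
- by rewrite r2.
- by rewrite r1.
- by rewrite r4.
- by rewrite r3.
- by rewrite r5.
- by rewrite r6 r5.
- by rewrite -r5 r7 (star1 Hstar).
Qed.

Definition antipode : A -> A := Cq_hom antipode_relations.

Lemma antipode_linear : linear antipode.
Proof. by move=> k x y; apply: (linearP (Cq_hom antipode_relations)). Qed.
Lemma antipodeM x y : antipode (x * y) = antipode y * antipode x.
Proof. exact: (rmorphM (Cq_hom antipode_relations)). Qed.
Lemma antipode1 : antipode 1 = 1.
Proof. exact: (rmorph1 (Cq_hom antipode_relations)). Qed.
Lemma antipode_gen i j : antipode (u i j) = star (u j i).
Proof. by rewrite /antipode Cq_homE sadj_entry. Qed.
Lemma antipodeD x y : antipode (x + y) = antipode x + antipode y.
Proof. by rewrite -[x]scale1r antipode_linear !scale1r. Qed.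
Lemma antipode0 : antipode 0 = 0.
Proof. by apply: (addrI (antipode 0)); rewrite -antipodeD !addr0. Qed.
Lemma antipodeZ k x : antipode (k *: x) = k *: antipode x.
Proof. by rewrite -[k *: x]addr0 antipode_linear antipode0 addr0. Qed.
Lemma antipode_sum I (r : seq I) (P : pred I) F :
  antipode (\sum_(i <- r | P i) F i) = \sum_(i <- r | P i) antipode (F i).
Proof. exact: (big_morph _ antipodeD antipode0). Qed.

Let id_linear : linear (id : A -> A). Proof. by []. Qed.

Lemma antipodeP x :
  tensor_lift (fun x y => antipode x * y) (Delta x) = (counit x : C)%:A.
Proof.
have Hb : bilinear_map (fun x y : A => antipode x * y).
  by apply: bilinear_map_of => //; exact: antipode_linear.
elim/Cq_ind: x => [k|i j|x y IHx IHy|x y IHx IHy].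
- rewrite Deltak (tensor_liftZ Hb) (tensor_lift_tens Hb) antipode1 mulr1.
  by rewrite linearZ /= rmorph1 /= [k *: _]mulr1.
- rewrite Du (tensor_lift_sum Hb) counitE.
  have [_ /matrixP/(_ i j)] := Hu; rewrite mxE [RHS]mxE => E.
  rewrite scaler_nat -E; apply: eq_bigr => k _.
  by rewrite (tensor_lift_tens Hb) antipode_gen [adjmx _ _ _ _]sadj_entry.
- by rewrite DeltaD (tensor_liftD Hb) IHx IHy raddfD scalerDl.
- rewrite comulM rmorphM; apply: antipode_mul => //; first exact: antipode_linear.
  exact: antipodeM.
Qed.

Section OneSided.
Variables (chi : {lrmorphism A -> C^o}).
(** Left and right translation by the point [chi]. They are unital algebra homomorphisms, as the
    values of [chi] commute with everything, so they can be compared with other homomorphisms on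
    generators. *)
Definition ltrans (x : A) : A :=
  tensor_lift (fun x y => (chi x : C)%:A * y) (Delta x).
Definition rtrans (x : A) : A :=
  tensor_lift (fun x y => x * (chi y : C)%:A) (Delta x).

Let chi_linear : linear (fun x => (chi x : C)%:A : A).
Proof. by move=> k x y; rewrite linearP /= scalerDl scalerA. Qed.
Let chi_mul : {morph (fun x => (chi x : C)%:A : A) : x y / x * y}.
Proof. by move=> x y; rewrite rmorphM -scalerAl mul1r scalerA. Qed.

Let lb : bilinear_map (fun x y : A => (chi x : C)%:A * y).
Proof. exact: bilinear_map_of. Qed.
Let rb : bilinear_map (fun x y : A => x * (chi y : C)%:A).
Proof. exact: bilinear_map_of. Qed.

Lemma ltrans_corep n (t : 'M[A]_n) i j : is_corep Delta t ->
  ltrans (t i j) = \sum_k (chi (t i k) : C) *: t k j.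
Proof.
move=> Ct; rewrite /ltrans Ct (tensor_lift_sum lb); apply: eq_bigr => k _.
by rewrite (tensor_lift_tens lb) mulr_algl.
Qed.
Lemma rtrans_corep n (t : 'M[A]_n) i j : is_corep Delta t ->
  rtrans (t i j) = \sum_k (chi (t k j) : C) *: t i k.
Proof.
move=> Ct; rewrite /rtrans Ct (tensor_lift_sum rb); apply: eq_bigr => k _.
by rewrite (tensor_lift_tens rb) mulr_algr.
Qed.
Lemma ltransD x y : ltrans (x + y) = ltrans x + ltrans y.
Proof. by rewrite /ltrans DeltaD (tensor_liftD lb). Qed.
Lemma rtransD x y : rtrans (x + y) = rtrans x + rtrans y.
Proof. by rewrite /rtrans DeltaD (tensor_liftD rb). Qed.
Lemma ltransk k : ltrans k%:A = k%:A.
Proof.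
rewrite /ltrans Deltak (tensor_liftZ lb) (tensor_lift_tens lb) rmorph1.
by rewrite scale1r mulr1.
Qed.
Lemma rtransk k : rtrans k%:A = k%:A.
Proof.
rewrite /rtrans Deltak (tensor_liftZ rb) (tensor_lift_tens rb) rmorph1.
by rewrite scale1r mulr1.
Qed.
Lemma ltransM x y : ltrans (x * y) = ltrans x * ltrans y.
Proof.
rewrite /ltrans comulM conv_mul // => x' y'.
by rewrite mulr_algl mulr_algr.
Qed.
Lemma rtransM x y : rtrans (x * y) = rtrans x * rtrans y.
Proof.
rewrite /rtrans comulM conv_mul // => x' y'.
by rewrite mulr_algl mulr_algr.
Qed.
Lemma ltransZ k x : ltrans (k *: x) = k *: ltrans x.
Proof. by rewrite -mulr_algl ltransM ltransk mulr_algl. Qed.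
End OneSided.

Lemma ltrans_counit x : ltrans counit x = x.
Proof.
elim/Cq_ind: x => [k|i j|x y IHx IHy|x y IHx IHy].
- exact: ltransk.
- rewrite (ltrans_corep _ _ _ Du) (bigD1 i) //= counitE eqxx scale1r big1 ?addr0 //.
  by move=> k /negPf ki; rewrite counitE eq_sym ki scale0r.
- by rewrite ltransD IHx IHy.
- by rewrite ltransM IHx IHy.
Qed.

(** The identity (counit (x) id) Delta = id reads E t = t for the scalar matrix E of values, and t
    is invertible. *)
Lemma counit_corep n (t : 'M[A]_n) i j : is_corep Delta t ->
  is_unitary_mx star t -> counit (t i j) = (i == j)%:R.
Proof.
move=> Ct [U1 U2].
pose E : 'M[A]_n := \matrix_(i, j) (counit (t i j) : C)%:A.
have Et : E *m t = t.
  apply/matrixP=> a b; rewrite mxE -[RHS]ltrans_counit (ltrans_corep _ _ _ Ct).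
  by apply: eq_bigr => k _; rewrite mxE mulr_algl.
have : E = 1%:M by rewrite -[E]mulmx1 -U1 mulmxA Et.
move=> /matrixP/(_ i j); rewrite !mxE => /(congr1 counit).
rewrite linearZ /= rmorph1 [_ *: _]mulr1 => ->.
by case: (i == j); rewrite ?rmorph1 ?rmorph0.
Qed.

(** By the antipode axiom S(t) is a left inverse of t, whose inverse is its adjoint. *)
Lemma antipode_corep n (t : 'M[A]_n) i j : is_corep Delta t ->
  is_unitary_mx star t -> antipode (t i j) = star (t j i).
Proof.
move=> Ct Ut; have [U1 U2] := Ut.
pose S : 'M[A]_n := map_mx antipode t.
have Hb : bilinear_map (fun x y : A => antipode x * y).
  by apply: bilinear_map_of => //; exact: antipode_linear.
have St : S *m t = 1%:M.
  apply/matrixP=> a b; rewrite !mxE.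
  have := antipodeP (t a b); rewrite Ct (tensor_lift_sum Hb).
  rewrite (counit_corep _ _ Ct Ut) scaler_nat => <-; apply: eq_bigr => k _.
  by rewrite (tensor_lift_tens Hb) !mxE.
have : S = adjmx star t by rewrite -[S]mulmx1 -U1 mulmxA St mul1mx.
by move=> /matrixP/(_ i j); rewrite !mxE.
Qed.

End Antipode.

(** * Orthogonality relations *)

Lemma ord2P (P : 'I_2 -> Prop) : P 0 -> P 1 -> forall i, P i.
Proof.
move=> P0 P1 [[|[|//]] H]; first by rewrite (_ : Ordinal H = 0) //; apply: val_inj.
by rewrite (_ : Ordinal H = 1) //; apply: val_inj.
Qed.

Section RealComplex.
Variable R : realType.
Lemma real_complexX (x : R) n : (x ^+ n)%:C = x%:C ^+ n :> R[i].
Proof. exact: rmorphXn. Qed.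
Lemma real_complexM (x y : R) : (x * y)%:C = x%:C * y%:C :> R[i].
Proof. exact: rmorphM. Qed.
Lemma real_complexV (x : R) : (x^-1)%:C = (x%:C)^-1 :> R[i].
Proof. exact: fmorphV. Qed.
Lemma real_complexD (x y : R) : (x + y)%:C = x%:C + y%:C :> R[i].
Proof. exact: rmorphD. Qed.
Lemma real_complex_sum I (r : seq I) (P : pred I) (F : I -> R) :
  (\sum_(i <- r | P i) F i)%:C = \sum_(i <- r | P i) (F i)%:C :> R[i].
Proof. exact: rmorph_sum. Qed.
Lemma real_complex_eq0 (x : R) : (x%:C == 0 :> R[i]) = (x == 0).
Proof. exact: fmorph_eq0. Qed.
End RealComplex.

Section Orthogonality.
Variables (R : realType) (q : R) (q_gt0 : 0 < q).
Local Notation A := (CqSU2 q).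
Local Notation C := R[i].
Local Notation u := (Cq_gen q).
Variables (star : A -> A) (Delta : {lrmorphism A -> tensor A}).
Hypothesis SU2 : is_SU2_structure star Delta.
Local Notation S := (antipode SU2).

Let Hstar : is_star star. Proof. by case: SU2. Qed.
Let z : C := q%:C.
Let z0 : z != 0. Proof. by rewrite /z fmorph_eq0 gt_eqF. Qed.
Let zi0 : z^-1 != 0. Proof. by rewrite invr_eq0. Qed.
Let qiE : q^-1%:C = z^-1. Proof. exact: fmorphV. Qed.

(** Unitarity of u forces the involution on the generators: the defining relations exhibit an
    explicit inverse V of u, which must be the adjoint. *)
Lemma star_gen : [/\ star (u 0 0) = u 1 1, star (u 1 0) = - (z *: u 0 1),
  star (u 0 1) = - (z^-1 *: u 1 0) & star (u 1 1) = u 0 0].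
Proof.
have [[r1 r2 r3 r4] r5 r6 r7] := Cq_genP q; rewrite -/z qiE in r1 r2 r3 r4 r6 r7.
have r6' : u 1 1 * u 0 0 = 1 + z *: (u 0 1 * u 1 0).
  move/eqP: r6; rewrite subr_eq => /eqP ->; move/eqP: r7.
  rewrite subr_eq => /eqP ->; rewrite rmorphB /= -/z qiE scalerBl.
  by rewrite addrCA subrK.
pose V : 'M[A]_2 := \matrix_(i, j)
  (if i == 0 then if j == 0 then u 1 1 else - (z *: u 0 1)
   else if j == 0 then - (z^-1 *: u 1 0) else u 0 0).
have UV : u *m V = 1%:M.
  apply/matrixP => i j; rewrite mxE !big_ord_recl big_ord0 addr0.
  rewrite (_ : lift ord0 ord0 = 1); last exact: val_inj.
  rewrite -[ord0]/(0 : 'I_2) ![V _ _]mxE [RHS]mxE.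
  elim/ord2P: i; elim/ord2P: j => /=; rewrite ?mulrN -?scalerAr.
  - by rewrite r7.
  - by rewrite r1 addNr.
  - by rewrite r4 scalerA mulVf // scale1r subrr.
  - by rewrite r6' -r5 addrC addrK.
have : adjmx star u = V.
  rewrite -[adjmx _ _]mulmx1 -UV mulmxA.
  by case: SU2 => _ [_ ->] _; rewrite mul1mx.
move=> /matrixP E; split.
- by have := E 0 0; rewrite !mxE => ->.
- by have := E 0 1; rewrite !mxE => ->.
- by have := E 1 0; rewrite !mxE => ->.
- by have := E 1 1; rewrite !mxE => ->.
Qed.

(** Both sides are algebra homomorphisms, so the generators decide: S^2 fixes a and d, multiplies b
    by q^2 and c by q^-2. The translations show its effect on every t^k through the weights. *)
Lemma antipode_sqr x : S (S x) = ltrans Delta (torus q z0) (rtrans Delta (torus q zi0) x).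
Proof.
have Cu : is_corep Delta u by case: SU2.
have [s1 s2 s3 s4] := star_gen.
elim/Cq_ind: x => [k|i j|x y IHx IHy|x y IHx IHy].
- by rewrite rtransk ltransk !antipodeZ !antipode1.
- rewrite (rtrans_corep _ _ _ Cu) !big_ord_recl !big_ord0 !addr0.
  rewrite (_ : lift ord0 ord0 = 1); last exact: val_inj.
  rewrite -[ord0]/(0 : 'I_2) ltransD !ltransZ !(ltrans_corep _ _ _ Cu).
  rewrite !big_ord_recl !big_ord0 !addr0.
  rewrite (_ : lift ord0 ord0 = 1); last exact: val_inj.
  rewrite -[ord0]/(0 : 'I_2) !torusE antipode_gen.
  elim/ord2P: i; elim/ord2P: j => /=;
    rewrite !(mulr0n, mulr1n, scale0r, scaler0, addr0, add0r, invrK, scalerA).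
  + by rewrite s1 antipode_gen s4 mulVf // scale1r.
  + by rewrite s2 -scaleNr antipodeZ antipode_gen s2 -scaleNr scalerA mulrNN.
  + by rewrite s3 -scaleNr antipodeZ antipode_gen s3 -scaleNr scalerA mulrNN.
  + by rewrite s4 antipode_gen s1 mulfV // scale1r.
- by rewrite !antipodeD IHx IHy rtransD ltransD.
- by rewrite !antipodeM IHx IHy rtransM ltransM.
Qed.

Variable (h : {linear A -> C^o}).
Hypothesis h_Haar : is_Haar_state star Delta h.
Variable (t : forall k : nat, 'M[A]_k.+1).
Hypothesis t_irreps : is_SU2_irreps star Delta t.

Lemma t_corep k : is_corep Delta (t k). Proof. by case: t_irreps => /(_ k)[]. Qed.
Lemma t_unitary k : is_unitary_mx star (t k). Proof. by case: t_irreps => /(_ k)[]. Qed.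
Lemma t_irreducible k : is_irreducible (t k). Proof. by case: t_irreps => /(_ k)[]. Qed.

Lemma torus_t (w : C) (w0 : w != 0) k (i j : 'I_k.+1) :
  torus q w0 (t k i j) = (w ^+ (k - i) / w ^+ i) *+ (i == j) :> C.
Proof.
case: t_irreps => _ _ /(_ (torus q w0)) ->; rewrite !torusE //=.
by rewrite !mulr1n exprVn.
Qed.

Lemma antipode_sqr_t k (i j : 'I_k.+1) :
  S (S (t k i j)) = (z ^+ (2 * j) / z ^+ (2 * i)) *: t k i j.
Proof.
rewrite antipode_sqr (rtrans_corep _ _ _ (@t_corep k)) (bigD1 j) //= big1 => [|l /negPf lj].
  rewrite addr0 ltransZ (ltrans_corep _ _ _ (@t_corep k)) (bigD1 i) //= big1 => [|l /negPf li].
    rewrite addr0 !torus_t !eqxx !mulr1n scalerA; congr (_ *: _).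
    have jk : (j <= k)%N by rewrite -ltnS.
    have ik : (i <= k)%N by rewrite -ltnS.
    rewrite !exprVn invrK !mul2n -!addnn !exprD !exprB ?unitfE //.
    by field; rewrite !expf_neq0.
  by rewrite torus_t eq_sym li mulr0n scale0r.
by rewrite torus_t lj mulr0n scale0r.
Qed.

(* Obtained by applying the antipode to the unitarity of t^k. *)
Lemma sum_star_t k (i j : 'I_k.+1) :
  \sum_(p < k.+1) z ^+ (2 * p) *: (star (t k j p) * t k i p) = (z ^+ (2 * i) *+ (i == j))%:A.
Proof.
have [_ /matrixP/(_ i j)] := @t_unitary k; rewrite mxE [RHS]mxE.
move=> /(congr1 S); rewrite antipode_sum => E.
have -> : (z ^+ (2 * i) *+ (i == j))%:A = z ^+ (2 * i) *: S (i == j)%:R.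
  by case: (i == j); rewrite ?antipode1 // mulr0n antipode0 scale0r scaler0.
rewrite -E scaler_sumr; apply: eq_bigr => p _.
rewrite [adjmx _ _ _ _]sadj_entry antipodeM (antipode_corep SU2) //; [|exact: t_corep|exact: t_unitary].
rewrite -(antipode_corep SU2 i p (@t_corep k) (@t_unitary k)) antipode_sqr_t -scalerAr scalerA.
by rewrite mulrC mulfVK // expf_neq0.
Qed.

(** The squared L^2 norm of t^k_ij, see [haar_orth]. The denominator is q^k [k+1]_q. *)
Definition haar_norm (k i : nat) : R := q ^+ (2 * i) / \sum_(p < k.+1) q ^+ (2 * p).

Lemma haar_norm_gt0 k i : 0 < haar_norm k i.
Proof.
apply: divr_gt0; first exact: exprn_gt0.
rewrite big_ord_recl ltr_wpDr ?exprn_gt0 //.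
by apply: sumr_ge0 => p _; rewrite exprn_ge0 // ltW.
Qed.

(** Schur's lemma makes the averaged intertwiner a scalar c; applying h to [sum_star_t] determines
    c, since the left side becomes c times the sum of the q^(2p). *)
Lemma haar_orth k (i j i' j' : 'I_k.+1) :
  h (star (t k i j) * t k i' j') = (haar_norm k i)%:C *+ (i == i') *+ (j == j') :> C.
Proof.
have E := haar_intertwiner h_Haar i i' (@t_corep k) (@t_unitary k) (@t_corep k).
have [c cE] := schur_scalar (@t_irreducible k) E.
have hE p r : h (star (t k i p) * t k i' r) = c *+ (p == r) :> C.
  by have /matrixP/(_ p r) := cE; rewrite !mxE.
rewrite hE; congr (_ *+ _).
have := congr1 h (sum_star_t i' i); rewrite linear_sum /= linearZ /=.
have [-> _ _ _] := h_Haar; rewrite [_ *: 1]mulr1.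
under eq_bigr do rewrite linearZ /= hE eqxx mulr1n.
rewrite -mulr_suml => cs.
have sE : \sum_(p < k.+1) z ^+ (2 * p) = (\sum_(p < k.+1) q ^+ (2 * p))%:C.
  by rewrite real_complex_sum; apply: eq_bigr => p _; rewrite real_complexX.
have s0 : \sum_(p < k.+1) z ^+ (2 * p) != 0.
  rewrite sE real_complex_eq0 gt_eqF // big_ord_recl ltr_wpDr ?exprn_gt0 //.
  by apply: sumr_ge0 => p _; rewrite exprn_ge0 // ltW.
apply: (mulfI s0); rewrite cs /haar_norm eq_sym.
case: eqP => [->|_]; last by rewrite !mulr0n mulr0.
by rewrite !mulr1n real_complexM real_complexV -sE real_complexX mulrC mulfVK.
Qed.

Lemma haar_orth_neq k l (i j : 'I_k.+1) (i' j' : 'I_l.+1) : k != l ->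
  h (star (t k i j) * t l i' j') = 0 :> C.
Proof.
move=> kl.
have E := haar_intertwiner h_Haar i i' (@t_corep k) (@t_unitary k) (@t_corep l).
have := schur_eq0 (@t_irreducible k) (@t_irreducible l) E.
by rewrite eqSS => /(_ kl)/matrixP/(_ j j'); rewrite !mxE.
Qed.

End Orthogonality.

(** * Complete reducibility *)

Definition ctr (K : numClosedFieldType) m n (P : 'M[K]_(m, n)) : 'M[K]_(n, m) :=
  (map_mx Num.conj P)^T.

Lemma ctrE (K : numClosedFieldType) m n (P : 'M[K]_(m, n)) :
  ctr P = map_mx Num.conj P^T.
Proof. by apply/matrixP=> i j; rewrite !mxE. Qed.

Lemma ctrM (K : numClosedFieldType) m n p (P : 'M[K]_(m, n)) (Q : 'M[K]_(n, p)) :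
  ctr (P *m Q) = ctr Q *m ctr P.
Proof. by rewrite /ctr map_mxM trmx_mul. Qed.

Lemma ctrK (K : numClosedFieldType) m n (P : 'M[K]_(m, n)) : ctr (ctr P) = P.
Proof. by apply/matrixP=> i j; rewrite !mxE conjCK. Qed.

Lemma ctr0 (K : numClosedFieldType) m n : ctr (0 : 'M[K]_(m, n)) = 0.
Proof. by apply/matrixP=> i j; rewrite !mxE conjC0. Qed.

(** Gram-Schmidt bases of the row space of U and of its orthogonal complement, the latter being the
    kernel of [ctr U]. *)
Lemma unitary_split (K : numClosedFieldType) n (U : 'M[K]_n) :
  exists r1 r2 (Q1 : 'M[K]_(r1, n)) (Q2 : 'M[K]_(r2, n)),
  [/\ [/\ r1 = \rank U & (r1 + r2)%N = n],
      [/\ Q1 *m ctr Q1 = 1%:M, Q2 *m ctr Q2 = 1%:M & Q1 *m ctr Q2 = 0],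
      ctr Q1 *m Q1 + ctr Q2 *m Q2 = 1%:M &
      (U <= Q1)%MS /\ (Q1 <= U)%MS].
Proof.
set V := kermx (ctr U).
have rV : \rank V = (n - \rank U)%N by rewrite mxrank_ker /ctr mxrank_tr mxrank_map.
have H m (W : 'M[K]_(m, n)) :
    schmidt (row_base W) *m ctr (schmidt (row_base W)) = 1%:M /\
    (schmidt (row_base W) :=: W)%MS.
  split; last exact: eqmx_trans (eqmx_schmidt_free (row_base_free _)) (eq_row_base _).
  by rewrite ctrE; apply/unitarymxP; rewrite schmidt_unitarymx ?rank_leq_col.
have [Q1u Q1U] := H _ U; have [Q2u Q2V] := H _ V.
set Q1 := schmidt (row_base U) in Q1u Q1U; set Q2 := schmidt (row_base V) in Q2u Q2V.
exists (\rank U), (\rank V), Q1, Q2.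
have rn : (\rank U + \rank V = n)%N by rewrite rV subnKC ?rank_leq_col.
have Q12 : Q1 *m ctr Q2 = 0.
  have /submxP[L ->] : (Q1 <= U)%MS by rewrite Q1U.
  have /submxP[L' ->] : (Q2 <= V)%MS by rewrite Q2V.
  rewrite ctrM mulmxA -(mulmxA L) (_ : U *m ctr V = 0) ?mulmx0 ?mul0mx //.
  by rewrite -[U]ctrK -ctrM mulmx_ker ctr0.
split=> //; last by rewrite !Q1U.
have Q21 : Q2 *m ctr Q1 = 0 by rewrite -[Q2]ctrK -ctrM Q12 ctr0.
have QQ : col_mx Q1 Q2 *m row_mx (ctr Q1) (ctr Q2) = 1%:M.
  by rewrite mul_col_row Q1u Q2u Q12 Q21 -scalar_mx_block.
rewrite -mul_row_col.
have : row_full (col_mx Q1 Q2).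
  rewrite /row_full eqn_leq rank_leq_col /= -{1}rn.
  by have := mxrankM_maxl (col_mx Q1 Q2) (row_mx (ctr Q1) (ctr Q2)); rewrite QQ mxrank1.
rewrite -sub1mx => /submxP[L LE].
by rewrite -[LHS]mul1mx {1}LE -mulmxA (mulmxA (col_mx _ _)) QQ mul1mx -LE.
Qed.

Lemma ctr_alg (R : realType) (A : algType R[i]) (star : A -> A) m n
    (P : 'M[R[i]]_(m, n)) : is_star star ->
  sadj star (map_mx (in_alg A) P) = map_mx (in_alg A) (ctr P).
Proof. by move=> H; exact: (sadj_scal H P). Qed.

Section CompressDef.
Variables (R : realType) (A : algType R[i]).
Local Notation C := R[i].
Local Notation "M %:A_" := (map_mx (in_alg A) M) (at level 2, format "M %:A_").

(** The block of s between the row spaces of Q and Q'. When the rows of Q and Q' together form an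
    orthonormal basis, the row space of Q is invariant exactly when this block vanishes. *)
Definition compress m m' n (Q : 'M[C]_(m, n)) (s : 'M[A]_n) (Q' : 'M[C]_(m', n)) :
  'M[A]_(m, m') := Q%:A_ *m s *m (ctr Q')%:A_.

Lemma compress_entry m m' n (Q : 'M[C]_(m, n)) (s : 'M[A]_n) (Q' : 'M[C]_(m', n)) i j :
  compress Q s Q' i j = \sum_a \sum_b (Q i a * (Q' j b)^*) *: s a b.
Proof.
rewrite mxE exchange_big /=; apply: eq_bigr => b _; rewrite mxE mulr_suml.
by apply: eq_bigr => a _; rewrite !mxE mulr_algl mulr_algr scalerA mulrC.
Qed.

Lemma compress_mul m m' n r1 r2 (Q : 'M[C]_(m, n)) (Q' : 'M[C]_(m', n))
    (Q1 : 'M[C]_(r1, n)) (Q2 : 'M[C]_(r2, n)) (X Y : 'M[A]_n) :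
  ctr Q1 *m Q1 + ctr Q2 *m Q2 = 1%:M ->
  compress Q (X *m Y) Q' =
  compress Q X Q1 *m compress Q1 Y Q' + compress Q X Q2 *m compress Q2 Y Q'.
Proof.
move=> Qid; rewrite /compress.
have D (P : 'M[C]_n) : Q%:A_ *m X *m P%:A_ *m (Y *m (ctr Q')%:A_) =
   Q%:A_ *m X *m (P%:A_ *m Y *m (ctr Q')%:A_) by rewrite !mulmxA.
have -> : Q%:A_ *m (X *m Y) *m (ctr Q')%:A_ =
    Q%:A_ *m X *m (1%:M)%:A_ *m (Y *m (ctr Q')%:A_).
  by rewrite map_alg1 mulmx1 !mulmxA.
have -> : (1%:M)%:A_ = (ctr Q1)%:A_ *m Q1%:A_ + (ctr Q2)%:A_ *m Q2%:A_ :> 'M[A]_n.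
  rewrite -[X in X + _]map_algM -[X in _ + X]map_algM -Qid.
  by apply/matrixP=> i j; rewrite !mxE /= scalerDl.
by rewrite mulmxDr mulmxDl !mulmxA.
Qed.

Lemma map_compress (B : algType C) (f : {lrmorphism A -> B}) m m' n
    (Q : 'M[C]_(m, n)) (Q' : 'M[C]_(m', n)) (s : 'M[A]_n) i j :
  f (compress Q s Q' i j) = \sum_a \sum_b (Q i a * (Q' j b)^*) *: f (s a b).
Proof.
rewrite compress_entry linear_sum; apply: eq_bigr => a _.
by rewrite linear_sum; apply: eq_bigr => b _; rewrite linearZ.
Qed.
End CompressDef.

Section Compression.
Variables (R : realType) (A : algType R[i]).
Local Notation C := R[i].
Variables (star : A -> A) (Delta : {lrmorphism A -> tensor A}).
Hypothesis Hstar : is_star star.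
Local Notation "M %:A_" := (map_mx (in_alg A) M) (at level 2, format "M %:A_").

Variables (n r1 r2 : nat) (Q1 : 'M[C]_(r1, n)) (Q2 : 'M[C]_(r2, n)).
Hypothesis Q11 : Q1 *m ctr Q1 = 1%:M.
Hypothesis Qid : ctr Q1 *m Q1 + ctr Q2 *m Q2 = 1%:M.
Variable s : 'M[A]_n.
Hypothesis s12 : compress Q1 s Q2 = 0.

Lemma compress_unitary : is_unitary_mx star s -> compress Q2 s Q1 = 0 ->
  is_unitary_mx star (compress Q1 s Q1).
Proof.
move=> [U1 U2] s21.
have adjE : adjmx star (compress Q1 s Q1) = Q1%:A_ *m adjmx star s *m (ctr Q1)%:A_.
  by rewrite !sadjE /compress !(sadjM Hstar) !(ctr_alg _ Hstar) ctrK mulmxA.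
have Qid' : (ctr Q1)%:A_ *m Q1%:A_ = 1%:M - (ctr Q2)%:A_ *m Q2%:A_ :> 'M[A]_n.
  by rewrite -!map_algM -map_alg1 -map_algB -Qid addrK.
have z1 : Q2%:A_ *m adjmx star s *m (ctr Q1)%:A_ = 0.
  have E : sadj star (Q2%:A_ *m adjmx star s *m (ctr Q1)%:A_) = 0.
    by rewrite !(sadjM Hstar) (sadjK Hstar) !(ctr_alg _ Hstar) ctrK mulmxA.
  rewrite -[LHS](sadjK Hstar) E; apply/matrixP=> i j.
  by rewrite !mxE (star0 Hstar).
split; rewrite adjE /compress.
- rewrite !mulmxA -(mulmxA _ (ctr Q1)%:A_) Qid' mulmxBr mulmx1 !mulmxBl.
  rewrite -(mulmxA _ s) U1 mulmx1 -[Q1%:A_ *m (ctr Q1)%:A_]map_algM Q11 map_alg1.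
  rewrite !mulmxA -/(compress Q1 s Q2) s12 !mul0mx subr0 //.
- rewrite !mulmxA -(mulmxA _ (ctr Q1)%:A_) Qid' mulmxBr mulmx1 !mulmxBl.
  rewrite -(mulmxA _ (adjmx _ _)) U2 mulmx1 -[Q1%:A_ *m (ctr Q1)%:A_]map_algM Q11 map_alg1.
  rewrite -!mulmxA (mulmxA Q2%:A_) -/(compress Q2 s Q1) s21 !mulmx0 subr0 //.
Qed.

Lemma compress_corep : is_corep Delta s -> is_corep Delta (compress Q1 s Q1).
Proof.
move=> /corepP Cs; apply/corepP.
have E (f : {lrmorphism A -> tensor A}) m m' (Q : 'M[C]_(m, n)) (Q' : 'M[C]_(m', n)) :
    map_mx f (compress Q s Q') = compress Q (map_mx f s) Q'.
  apply/matrixP=> i j; rewrite mxE map_compress compress_entry.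
  by apply: eq_bigr => a _; apply: eq_bigr => b _; rewrite mxE.
rewrite E Cs (compress_mul _ _ _ _ Qid).
rewrite -(E (@tensl _ A)) -(E (@tensr _ A)) -(E (@tensl _ A)) s12.
rewrite (_ : map_mx (@tensl _ A) 0 = 0) ?mul0mx ?addr0 //.
by apply/matrixP=> i j; rewrite !mxE; exact: (raddf0 (@tensl _ A)).
Qed.

(** The row space of Q1 is invariant, so v Q1 is an eigenvector of s. Hence the blocks inherit the
    eigenvalue bound assumed in [corep_filt]. *)
Lemma compress_eigen (chi : {lrmorphism A -> C^o}) (v : 'rV[C]_r1) (mu : C) :
  v != 0 -> v *m (map_mx chi (compress Q1 s Q1) : 'M[C]_r1) = mu *: v ->
  exists2 w : 'rV[C]_n, w != 0 & w *m (map_mx chi s : 'M[C]_n) = mu *: w.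
Proof.
move=> v0 E; pose X : 'M[C]_n := map_mx chi s.
have chiE m m' (Q : 'M[C]_(m, n)) (Q' : 'M[C]_(m', n)) :
    map_mx chi (compress Q s Q') = Q *m X *m ctr Q' :> 'M[C]_(m, m').
  apply/matrixP=> i j; rewrite mxE map_compress mxE exchange_big /=.
  apply: eq_bigr => b _; rewrite mxE mulr_suml; apply: eq_bigr => a _.
  by rewrite !mxE [_ *: _]/(_ * _) mulrAC.
exists (v *m Q1).
  apply: contraNneq v0 => H.
  by rewrite -[v]mulmx1 -Q11 mulmxA H mul0mx.
have z : v *m Q1 *m X *m ctr Q2 = 0.
  have := chiE _ _ Q1 Q2; rewrite s12 => H.
  rewrite -!mulmxA (mulmxA Q1) -H (_ : map_mx chi 0 = 0) ?mulmx0 //.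
  by apply/matrixP=> i j; rewrite !mxE; exact: (raddf0 chi).
rewrite chiE !mulmxA in E.
rewrite -/X -[LHS]mulmx1 -Qid mulmxDr !mulmxA z mul0mx addr0 E.
by rewrite scalemxAl.
Qed.

End Compression.

Section TensorCorep.
Variables (R : realType) (A : algType R[i]).
Local Notation C := R[i].
Variables (star : A -> A) (Delta : {lrmorphism A -> tensor A}).
Hypothesis Hstar : is_star star.
Variables (m n : nat).

Local Notation I := ('I_m * 'I_n)%type.
(** Matrices are indexed by ordinals, so pairs of indices are enumerated. *)
Definition pair_of (a : 'I_#|{: I}|) : I := enum_val a.

Definition corep_mul (s : 'M[A]_m) (s' : 'M[A]_n) : 'M[A]_#|{: I}| :=
  \matrix_(a, b) (s (pair_of a).1 (pair_of b).1 * s' (pair_of a).2 (pair_of b).2).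

Lemma sum_pair (V : nmodType) (F : I -> V) :
  \sum_(a < #|{: I}|) F (pair_of a) = \sum_p F p.
Proof.
by rewrite [RHS](reindex (@enum_val _ {: I})) //; exact/onW_bij/enum_val_bij.
Qed.

Lemma sum_pair_of (V : nmodType) (F : I -> V) :
  \sum_(a < #|{: I}|) F (pair_of a) = \sum_i \sum_j F (i, j).
Proof.
by rewrite sum_pair pair_bigA /=; apply: eq_bigr => -[].
Qed.

Lemma pair_ofK p : exists a, pair_of a = p.
Proof. by exists (enum_rank p); rewrite /pair_of enum_rankK. Qed.

Lemma pair_of_eq a b : (pair_of a == pair_of b) = (a == b).
Proof. by rewrite (inj_eq enum_val_inj). Qed.

Lemma corep_mul_corep s s' : is_corep Delta s -> is_corep Delta s' ->
  is_corep Delta (corep_mul s s').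
Proof.
move=> Cs Cs' a b; rewrite mxE comulM Cs Cs' tens_sumM.
rewrite -(sum_pair_of (fun p => tens (s (pair_of a).1 p.1 * s' (pair_of a).2 p.2)
   (s p.1 (pair_of b).1 * s' p.2 (pair_of b).2))).
by apply: eq_bigr => c _; rewrite !mxE.
Qed.

Lemma corep_mul_unitary s s' : is_unitary_mx star s -> is_unitary_mx star s' ->
  is_unitary_mx star (corep_mul s s').
Proof.
move=> [U1 U2] [U1' U2'].
have E (k : nat) (X Y : 'M[A]_k) i j : X *m Y = 1%:M ->
    \sum_l X i l * Y l j = (i == j)%:R.
  by move=> /matrixP/(_ i j); rewrite !mxE.
have E1 i j : \sum_l s i l * star (s j l) = (i == j)%:R.
  by rewrite -(E _ _ _ i j U1); apply: eq_bigr => l _; rewrite !mxE.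
have E2 i j : \sum_l star (s l i) * s l j = (i == j)%:R.
  by rewrite -(E _ _ _ i j U2); apply: eq_bigr => l _; rewrite !mxE.
have E1' i j : \sum_l s' i l * star (s' j l) = (i == j)%:R.
  by rewrite -(E _ _ _ i j U1'); apply: eq_bigr => l _; rewrite !mxE.
have E2' i j : \sum_l star (s' l i) * s' l j = (i == j)%:R.
  by rewrite -(E _ _ _ i j U2'); apply: eq_bigr => l _; rewrite !mxE.
have P a b : (a == b) = ((pair_of a).1 == (pair_of b).1) && ((pair_of a).2 == (pair_of b).2).
  by rewrite -pair_of_eq.
split; apply/matrixP=> a b; rewrite [LHS]mxE [RHS]mxE P.
- transitivity (\sum_c s (pair_of a).1 (pair_of c).1 * s' (pair_of a).2 (pair_of c).2 *
     (star (s' (pair_of b).2 (pair_of c).2) * star (s (pair_of b).1 (pair_of c).1))).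
    by apply: eq_bigr => c _; rewrite !mxE (starM Hstar).
  rewrite (sum_pair_of (fun p => s (pair_of a).1 p.1 * s' (pair_of a).2 p.2 *
     (star (s' (pair_of b).2 p.2) * star (s (pair_of b).1 p.1)))) /=.
  transitivity (\sum_i s (pair_of a).1 i * ((pair_of a).2 == (pair_of b).2)%:R *
     star (s (pair_of b).1 i)).
    apply: eq_bigr => i _; rewrite -E1' mulr_sumr mulr_suml.
    by apply: eq_bigr => j _; rewrite !mulrA.
  case: (_ == (pair_of b).2); last by rewrite andbF big1 // => i _; rewrite mulr0 mul0r.
  by rewrite andbT -E1; apply: eq_bigr => i _; rewrite mulr1.
- transitivity (\sum_c (star (s' (pair_of c).2 (pair_of a).2) * star (s (pair_of c).1 (pair_of a).1))
     * (s (pair_of c).1 (pair_of b).1 * s' (pair_of c).2 (pair_of b).2)).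
    by apply: eq_bigr => c _; rewrite !mxE (starM Hstar).
  rewrite (sum_pair_of (fun p => star (s' p.2 (pair_of a).2) * star (s p.1 (pair_of a).1)
     * (s p.1 (pair_of b).1 * s' p.2 (pair_of b).2))) /= exchange_big /=.
  transitivity (\sum_j star (s' j (pair_of a).2) * ((pair_of a).1 == (pair_of b).1)%:R *
     s' j (pair_of b).2).
    apply: eq_bigr => i _; rewrite -E2 mulr_sumr mulr_suml.
    by apply: eq_bigr => j _; rewrite !mulrA.
  case: (_ == (pair_of b).1); last by rewrite big1 // => i _; rewrite mulr0 mul0r.
  by rewrite -E2'; apply: eq_bigr => i _; rewrite mulr1.
Qed.
End TensorCorep.

(** * The filtration of the algebra by spin *)

Section Filtration.
Variables (R : realType) (q : R) (q_gt0 : 0 < q).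
Local Notation A := (CqSU2 q).
Local Notation C := R[i].
Local Notation u := (Cq_gen q).
Variables (star : A -> A) (Delta : {lrmorphism A -> tensor A}).
Hypothesis SU2 : is_SU2_structure star Delta.
Let Hstar : is_star star. Proof. by case: SU2. Qed.
Variable (h : {linear A -> C^o}).
Hypothesis h_Haar : is_Haar_state star Delta h.
Variable (t : forall k : nat, 'M[A]_k.+1).
Hypothesis t_irreps : is_SU2_irreps star Delta t.
Local Notation "M %:A_" := (map_mx (in_alg A) M) (at level 2, format "M %:A_").

Definition tcoef k (i j : 'I_k.+1) (f : A) : C :=
  h (star (t k i j) * f) / (haar_norm q k i)%:C.

Lemma tcoef_linear k i j : linear (@tcoef k i j : A -> C^o).
Proof.
move=> c x y; rewrite /tcoef mulrDr -scalerAr linearP /= mulrDl.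
by rewrite [c *: (h _ : C^o)]/(c * _) -mulrA.
Qed.
HB.instance Definition _ k i j := GRing.isLinear.Build C A C^o *:%R (@tcoef k i j)
  (@tcoef_linear k i j).

Lemma tcoefZD k (i j : 'I_k.+1) c x y :
  tcoef i j (c *: x + y) = c * tcoef i j x + tcoef i j y.
Proof. exact: tcoef_linear. Qed.

Lemma tcoef_t k (i j i' j' : 'I_k.+1) :
  tcoef i j (t k i' j') = ((i == i') && (j == j'))%:R.
Proof.
rewrite /tcoef (haar_orth q_gt0 SU2 h_Haar t_irreps).
case: (i == i'); case: (j == j'); rewrite ?mulr0n ?mul0r // !mulr1n divff //.
by rewrite real_complex_eq0 gt_eqF // haar_norm_gt0.
Qed.

Lemma tcoef_t_neq k l (i j : 'I_k.+1) (i' j' : 'I_l.+1) : k != l ->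
  tcoef i j (t l i' j') = 0.
Proof. by move=> kl; rewrite /tcoef (haar_orth_neq h_Haar t_irreps) // mul0r. Qed.

Definition tproj N (f : A) : A :=
  \sum_(k < N.+1) \sum_i \sum_j tcoef i j f *: t k i j.

Lemma tproj_linear N : linear (tproj N).
Proof.
move=> c x y; rewrite /tproj scaler_sumr -big_split; apply: eq_bigr => k _ /=.
rewrite scaler_sumr -big_split; apply: eq_bigr => i _ /=.
rewrite scaler_sumr -big_split; apply: eq_bigr => j _ /=.
by rewrite tcoefZD scalerDl scalerA.
Qed.
HB.instance Definition _ N := GRing.isLinear.Build C A A *:%R (tproj N) (tproj_linear N).

(** Membership in the span of the t^k with k <= N, as a fixed point of the orthogonal projection:
    closure under linear operations is then linearity of [tproj], and the expansion of f comes with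
    the definition. *)
Definition filt N f := tproj N f = f.

Lemma filt_t N k (i j : 'I_k.+1) : (k <= N)%N -> filt N (t k i j).
Proof.
rewrite -ltnS => kN; rewrite /filt /tproj (bigD1 (Ordinal kN)) //=.
rewrite (bigD1 i) //= (bigD1 j) //= tcoef_t !eqxx scale1r !big1 ?addr0 //.
- move=> l lk; rewrite big1 // => a _; rewrite big1 // => b _.
  by rewrite tcoef_t_neq ?scale0r.
- by move=> a /negPf ai; rewrite big1 // => b _; rewrite tcoef_t ai scale0r.
- by move=> b /negPf bj; rewrite tcoef_t bj andbF scale0r.
Qed.

Lemma filtD N f g : filt N f -> filt N g -> filt N (f + g).
Proof. by rewrite /filt linearD /= => -> ->. Qed.
Lemma filtZ N c f : filt N f -> filt N (c *: f).
Proof. by rewrite /filt linearZ /= => ->. Qed.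
Lemma filt_sum N I (r : seq I) (P : pred I) F :
  (forall i, P i -> filt N (F i)) -> filt N (\sum_(i <- r | P i) F i).
Proof.
move=> H; rewrite /filt linear_sum; apply: eq_bigr => i Pi; exact: H.
Qed.
Lemma filt_le N M f : (N <= M)%N -> filt N f -> filt M f.
Proof.
move=> NM <-; apply: filt_sum => k _; apply: filt_sum => i _; apply: filt_sum => j _.
by apply: filtZ; apply: filt_t; apply: leq_trans NM; rewrite -ltnS.
Qed.

Let two0 : (2 : C) != 0. Proof. by rewrite pnatr_eq0. Qed.
Local Notation chi2 := (torus q two0).

(** The torus point 2 detects the spin: s is equivalent to t^n, which has the weight 2^n, so the
    bound on eigenvalues forces n <= N. *)
Lemma irrep_filt N n (s : 'M[A]_n.+1) : is_irrep star Delta s ->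
  (forall (v : 'rV[C]_n.+1) mu, v != 0 -> v *m (map_mx chi2 s : 'M[C]_n.+1) = mu *: v ->
     `|mu| <= 2 ^+ N) ->
  forall i j, filt N (s i j).
Proof.
move=> irr ev.
have [P Pu PE] : equivalent_corep s (t n) by case: t_irreps => _ /(_ n s irr).
have nN : (n <= N)%N.
  have chiE : P *m map_mx chi2 s = map_mx chi2 (t n) *m P :> 'M[C]_n.+1.
    apply/matrixP=> i j; have /matrixP/(_ i j) := PE.
    rewrite !mxE => /(congr1 chi2); rewrite !linear_sum.
    under eq_bigr do rewrite mxE mulr_algl linearZ.
    under [in X in _ = X -> _]eq_bigr do rewrite mxE mulr_algr linearZ.
    move=> H; rewrite [LHS](_ : _ = \sum_k P i k * chi2 (s k j)); last first.
      by apply: eq_bigr => k _; rewrite mxE.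
    rewrite [LHS]H; apply: eq_bigr => k _; rewrite mxE; exact: mulrC.
  (* By [chiE], row 0 of P is an eigenvector of s at the torus point 2 for the highest weight
     2^n. *)
  have v0 : row ord0 P != 0.
    apply/eqP => r0; have /row_free_inj inj : row_free P by rewrite row_free_unit.
    have /inj/matrixP/(_ 0 0)/eqP : (delta_mx 0 0 : 'rV[C]_n.+1) *m P = 0 *m P.
      by rewrite mul0mx -rowE.
    by rewrite !mxE !eqxx oner_eq0.
  have := ev (row ord0 P) (2 ^+ n) v0.
  rewrite -row_mul chiE => H.
  have /H : row ord0 (map_mx chi2 (t n) *m P : 'M[C]_n.+1) = 2 ^+ n *: row ord0 P.
    apply/rowP => j; rewrite mxE mxE (bigD1 ord0) //= big1 => [|k k0].
      rewrite addr0 !mxE (torus_t t_irreps) eqxx mulr1n subn0.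
      by rewrite [_ ^+ (ord0 : 'I__)]expr0 divr1.
    by rewrite mxE (torus_t t_irreps) eq_sym (negPf k0) mulr0n mul0r.
  rewrite normrX ger0_norm // ler_eXn2l // ltr1n //.
move=> i j.
have -> : s = (invmx P)%:A_ *m t n *m P%:A_.
  by rewrite -mulmxA -PE mulmxA -map_algM mulVmx // map_alg1 mul1mx.
rewrite mxE; apply: filt_sum => k _; rewrite mxE mulr_suml; apply: filt_sum => l _.
by rewrite !mxE mulr_algl mulr_algr; do 2!apply: filtZ; apply: filt_t.
Qed.

End Filtration.

Section Reducibility.
Variables (R : realType) (q : R) (q_gt0 : 0 < q).
Local Notation A := (CqSU2 q).
Local Notation C := R[i].
Local Notation u := (Cq_gen q).
Variables (star : A -> A) (Delta : {lrmorphism A -> tensor A}).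
Hypothesis SU2 : is_SU2_structure star Delta.
Let Hstar : is_star star. Proof. by case: SU2. Qed.
Variable (h : {linear A -> C^o}).
Hypothesis h_Haar : is_Haar_state star Delta h.
Variable (t : forall k : nat, 'M[A]_k.+1).
Hypothesis t_irreps : is_SU2_irreps star Delta t.
Local Notation "M %:A_" := (map_mx (in_alg A) M) (at level 2, format "M %:A_").
Local Notation filt := (@filt R q star h t).

Let two0 : (2 : C) != 0. Proof. by rewrite pnatr_eq0. Qed.
Local Notation chi2 := (torus q two0).

Let conj_mulC (x y : C) : (x * y^* )^* = y * x^*.
Proof. by rewrite rmorphM /= conjCK mulrC. Qed.

(** Strong induction on the size. A proper invariant subspace and its orthogonal complement give two
    smaller unitary corepresentations. Their eigenvalues at the torus point 2 are eigenvalues of s,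
    so the hypothesis on mu survives down to the irreducible case, where it bounds the spin. *)
Lemma corep_filt N n (s : 'M[A]_n) : is_corep Delta s -> is_unitary_mx star s ->
  (forall (v : 'rV[C]_n) mu, v != 0 -> v *m (map_mx chi2 s : 'M[C]_n) = mu *: v ->
     `|mu| <= 2 ^+ N) ->
  forall i j, filt N (s i j).
Proof.
elim/ltn_ind: n s => -[|n] IH s Cs Us ev; first by case.
have [irr|] := pselect (is_irreducible s).
  exact: (irrep_filt q_gt0 SU2 h_Haar t_irreps).
rewrite /is_irreducible => /not_andP[//|/existsNP[U /not_implyP[[X XE] /not_orP[U0 Uf]]]].
have [r1 [r2 [Q1 [Q2 [[r1E r12] [Q11 Q22 Q12] Qid [UQ QU]]]]]] := unitary_split U.
have r1n : (r1 < n.+1)%N.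
  by rewrite r1E ltn_neqAle rank_leq_row andbT; apply/negP.
have r2n : (r2 < n.+1)%N.
  rewrite -r12 -[X in (X < _)%N]add0n ltn_add2r r1E lt0n mxrank_eq0; exact/eqP.
have Q21 : Q2 *m ctr Q1 = 0 by rewrite -[Q2]ctrK -ctrM Q12 ctr0.
have Qid' : ctr Q2 *m Q2 + ctr Q1 *m Q1 = 1%:M by rewrite addrC.
have s12 : compress Q1 s Q2 = 0.
  have [/submxP[L UE] /submxP[L' Q1E]] := conj UQ QU.
  rewrite /compress Q1E map_algM -(mulmxA _ _ s) XE UE map_algM !mulmxA.
  by rewrite -(mulmxA _ Q1%:A_) -map_algM Q12 map_alg0 mulmx0.
(* The antipode maps the entries of s to those of its adjoint. *)
have s21 : compress Q2 s Q1 = 0.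
  apply/matrixP=> i j; apply: (can_inj (starK Hstar)); rewrite [RHS](_ : _ = 0); last first.
    by rewrite mxE (star0 Hstar).
  rewrite -[RHS](antipode0 SU2); have /matrixP/(_ j i) := s12; rewrite [RHS]mxE => <-.
  rewrite !compress_entry (star_sum Hstar) exchange_big antipode_sum; apply: eq_bigr => a _.
  rewrite (star_sum Hstar) antipode_sum; apply: eq_bigr => b _.
  rewrite (starZ Hstar) antipodeZ (antipode_corep SU2) //.
  by congr (_ *: _); exact: conj_mulC.
have f1 := IH _ r1n _ (compress_corep Qid s12 Cs) (compress_unitary Hstar Q11 Qid s12 Us s21).
have f2 := IH _ r2n _ (compress_corep Qid' s21 Cs) (compress_unitary Hstar Q22 Qid' s21 Us s12).
have {}f1 i j : filt N (compress Q1 s Q1 i j).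
  apply: f1 => v mu v0 /(compress_eigen Q11 Qid s12 v0)[w w0]; exact: ev.
have {}f2 i j : filt N (compress Q2 s Q2 i j).
  apply: f2 => v mu v0 /(compress_eigen Q22 Qid' s21 v0)[w w0]; exact: ev.
pose Z : 'M[A]_n.+1 := (ctr Q1)%:A_ *m compress Q1 s Q1 *m Q1%:A_ +
  (ctr Q2)%:A_ *m compress Q2 s Q2 *m Q2%:A_.
have QidA : (ctr Q1)%:A_ *m Q1%:A_ + (ctr Q2)%:A_ *m Q2%:A_ = 1%:M :> 'M[A]_n.+1.
  rewrite -[X in X + _]map_algM -[X in _ + X]map_algM -map_alg1 -Qid.
  by apply/matrixP=> i j; rewrite !mxE /= scalerDl.
have sE : s = Z.
  have D1 : Q1%:A_ *m s = compress Q1 s Q1 *m Q1%:A_.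
    rewrite -[LHS]mulmx1 -QidA mulmxDr !mulmxA -/(compress Q1 s Q1).
    by rewrite -/(compress Q1 s Q2) s12 mul0mx addr0.
  have D2 : Q2%:A_ *m s = compress Q2 s Q2 *m Q2%:A_.
    rewrite -[LHS]mulmx1 -QidA mulmxDr !mulmxA -/(compress Q2 s Q1).
    by rewrite -/(compress Q2 s Q2) s21 mul0mx add0r.
  by rewrite /Z -[X in X + _]mulmxA -[X in _ + X]mulmxA -D1 -D2 !mulmxA -mulmxDl QidA mul1mx.
have fE r (P : 'M[C]_(n.+1, r)) (P' : 'M[C]_(r, n.+1)) (T : 'M[A]_r) i j :
    (forall i j, filt N (T i j)) -> filt N ((P%:A_ *m T *m P'%:A_) i j).
  move=> fT; rewrite mxE; apply: filt_sum => a _; rewrite mxE mulr_suml.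
  by apply: filt_sum => b _; rewrite !mxE mulr_algl mulr_algr; do 2!apply: filtZ.
by move=> i j; rewrite sE mxE; apply: filtD; apply: fE.
Qed.
End Reducibility.

(** * Words in the generators and the tensor products of u with t^n *)

Section Words.
Variables (R : realType) (q : R) (q_gt0 : 0 < q).
Local Notation A := (CqSU2 q).
Local Notation C := R[i].
Local Notation u := (Cq_gen q).
Variables (star : A -> A) (Delta : {lrmorphism A -> tensor A}).
Hypothesis SU2 : is_SU2_structure star Delta.
Let Hstar : is_star star. Proof. by case: SU2. Qed.
Let Cu : is_corep Delta u. Proof. by case: SU2. Qed.
Let Uu : is_unitary_mx star u. Proof. by case: SU2. Qed.
Variable (h : {linear A -> C^o}).
Hypothesis h_Haar : is_Haar_state star Delta h.
Variable (t : forall k : nat, 'M[A]_k.+1).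
Hypothesis t_irreps : is_SU2_irreps star Delta t.
Local Notation "M %:A_" := (map_mx (in_alg A) M) (at level 2, format "M %:A_").
Local Notation filtS := (@filt R q star h t).
Local Notation coefS := (@tcoef R q star h t).
Let Ct k : is_corep Delta (t k). Proof. exact: (t_corep t_irreps). Qed.
Let Ut k : is_unitary_mx star (t k). Proof. exact: (t_unitary t_irreps). Qed.

Let two0 : (2 : C) != 0. Proof. by rewrite pnatr_eq0. Qed.
Local Notation chi2 := (torus q two0).

Lemma filt0_1 : filtS 0 1.
Proof.
have H := @corep_filt R q q_gt0 star Delta SU2 h h_Haar t t_irreps 0 1 (1%:M : 'M[A]_1).
have := H _ _ _ 0 0; rewrite mxE; apply.
- move=> i j; rewrite big_ord1 !mxE !ord1 !eqxx /=; exact: (rmorph1 Delta).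
- have E : adjmx star (1%:M : 'M[A]_1) = 1%:M.
    by apply/matrixP=> i j; rewrite !mxE !ord1 eqxx mulr1n (star1 Hstar).
  by split; rewrite E mulmx1.
- move=> v mu v0.
  have -> : map_mx chi2 (1%:M : 'M[A]_1) = (1%:M : 'M[C]_1) by exact: map_mx1.
  rewrite mulmx1 => /eqP; rewrite -[X in X == _]scale1r -subr_eq0 -scalerBl.
  by rewrite scaler_eq0 (negPf v0) orbF subr_eq0 => /eqP <-; rewrite normr1 expr0.
Qed.

Definition pstep n : 'M[A]_#|{: 'I_2 * 'I_n.+1}| := corep_mul u (t n).

Lemma torusM (w : C) (w0 : w != 0) x y :
  torus q w0 (x * y) = (torus q w0 x : C) * torus q w0 y :> C.
Proof. exact: rmorphM. Qed.

Lemma torusZ (w : C) (w0 : w != 0) k x :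
  torus q w0 (k *: x) = k * (torus q w0 x : C) :> C.
Proof. exact: linearZ. Qed.

Lemma torus_sum (w : C) (w0 : w != 0) I (r : seq I) (P : pred I) F :
  torus q w0 (\sum_(i <- r | P i) F i) = \sum_(i <- r | P i) (torus q w0 (F i) : C) :> C.
Proof. exact: linear_sum. Qed.

Lemma torus_pstep (w : C) (w0 : w != 0) n a b :
  torus q w0 (pstep n a b) =
  (w ^+ (n.+1 - ((pair_of a).1 + (pair_of a).2)) / w ^+ ((pair_of a).1 + (pair_of a).2)) *+ (a == b) :> C.
Proof.
rewrite mxE torusM torusE (torus_t t_irreps) -pair_of_eq -pair_eqE /pair_eq.
move: (pair_of a) (pair_of b) => [x y] [x' y'] /=.
have yn : (y <= n)%N by rewrite -ltnS.
case: (y == y'); last by rewrite andbF !mulr0n mulr0.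
rewrite andbT mulr1n; elim/ord2P: x; elim/ord2P: x' => /=;
  rewrite ?mulr0n ?mul0r ?mulr1n ?add0n ?add1n //.
  by rewrite subSn // exprS mulrA.
by rewrite subSS exprS invfM mulrCA mulrA.
Qed.

Lemma filt_pstep n a b : filtS n.+1 (pstep n a b).
Proof.
apply: (corep_filt q_gt0 SU2 h_Haar t_irreps).
- exact: corep_mul_corep.
- exact: (corep_mul_unitary Hstar).
(* The torus acts diagonally on the product basis, so mu is the weight at any nonzero component of
   v. *)
move=> v mu v0 vE; have [c vc] : exists c, v 0 c != 0.
  apply/existsP; apply: contraNT v0; rewrite negb_exists => /forallP H.
  by apply/eqP/rowP => c; rewrite [RHS]mxE; apply/eqP; rewrite -[_ == _]negbK H.
have := congr1 (fun M : 'rV_ _ => M 0 c) vE; rewrite mxE (bigD1 c) //= big1 => [|d dc]; last first.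
  by rewrite mxE torus_pstep (negPf dc) mulr0n mulr0.
rewrite addr0 [map_mx _ _ c c]mxE [(mu *: v) 0 c]mxE torus_pstep eqxx mulr1n mulrC.
move=> /(mulIf vc) <-.
rewrite normrM normfV !normrX !ger0_norm // ler_pdivrMr ?exprn_gt0 //.
by rewrite -exprD ler_weXn2l ?ler1n // (leq_trans (leq_subr _ _)) // leq_addr.
Qed.

Lemma filt_gen_mul n i j x : filtS n x -> filtS n.+1 (u i j * x).
Proof.
move=> <-; rewrite mulr_sumr; apply: filt_sum => k _.
rewrite mulr_sumr; apply: filt_sum => a _; rewrite mulr_sumr; apply: filt_sum => b _.
rewrite -scalerAr; apply: filtZ; have kn : (k.+1 <= n.+1)%N by [].
apply: (filt_le q_gt0 SU2 h_Haar t_irreps kn).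
have [p pE] := pair_ofK (i, a); have [p' pE'] := pair_ofK (j, b).
by have := filt_pstep p p'; rewrite mxE pE pE'.
Qed.

Definition weval (w : seq ('I_2 * 'I_2)) : A := \prod_(p <- w) u p.1 p.2.

Lemma filt_weval w : filtS (size w) (weval w).
Proof.
elim: w => [|p w IH]; first by rewrite /weval big_nil; exact: filt0_1.
by rewrite /weval big_cons; exact: filt_gen_mul.
Qed.

(** The trivial corepresentation is equivalent to t^0, and conjugation by a 1 by 1 matrix changes
    nothing. *)
Lemma t0E : t 0 0 0 = 1.
Proof.
have E : adjmx star (1%:M : 'M[A]_1) = 1%:M.
  by apply/matrixP=> i j; rewrite !mxE !ord1 eqxx mulr1n (star1 Hstar).
have irr : is_irrep star Delta (1%:M : 'M[A]_1).
  split.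
  - move=> i j; rewrite big_ord1 !mxE !ord1 !eqxx /=; exact: (rmorph1 Delta).
  - by split; rewrite E mulmx1.
  - split=> // U _; case: (eqVneq (U 0 0) 0) => [U0|U0].
      by left; apply/matrixP=> i j; rewrite !ord1 mxE.
    right; rewrite -sub1mx; apply/submxP; exists ((U 0 0)^-1)%:M.
    by apply/matrixP=> i j; rewrite !ord1 [RHS]mxE big_ord1 !mxE !eqxx !mulr1n mulVf.
have [P Pu] : equivalent_corep (1%:M : 'M[A]_1) (t 0) by case: t_irreps => _ /(_ 0 _ irr).
rewrite mulmx1 => /matrixP/(_ 0 0); rewrite [RHS]mxE big_ord1 !mxE mulr_algr => H.
 have P0 : P 0 0 != 0.
  by move: Pu; rewrite unitmxE unitfE (mx11_scalar P) det_scalar1 mxE eqxx mulr1n.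
apply: (scalerI P0); rewrite -H; reflexivity.
Qed.

Hypothesis h_conj : forall f g, h (star f * g) = (h (star g * f))^* :> C.

Lemma filt_torus_bound n f : filtS n f -> exists M : C, forall (w : C) (w0 : w != 0),
  1 <= w -> `|torus q w0 f : C| <= M * w ^+ n.
Proof.
move=> fE; exists (\sum_(k < n.+1) \sum_(i < k.+1) \sum_(j < k.+1) `|coefS i j f|) => w w0 w1.
have wp : 0 < w by exact: lt_le_trans w1.
have {1}-> : f = \sum_(k < n.+1) \sum_(i < k.+1) \sum_(j < k.+1) coefS i j f *: t k i j by [].
rewrite mulr_suml torus_sum; apply: le_trans (ler_norm_sum _ _ _) _.
apply: ler_sum => k _; rewrite mulr_suml torus_sum; apply: le_trans (ler_norm_sum _ _ _) _.
apply: ler_sum => i _; rewrite mulr_suml torus_sum; apply: le_trans (ler_norm_sum _ _ _) _.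
apply: ler_sum => j _; rewrite torusZ normrM; apply: ler_wpM2l => //.
rewrite (torus_t t_irreps); case: eqP => _; last by rewrite mulr0n normr0 exprn_ge0 // ltW.
rewrite mulr1n normrM normfV !normrX ger0_norm ?(ltW wp) // ler_pdivrMr ?exprn_gt0 //.
rewrite -exprD ler_weXn2l // (leq_trans (leq_subr _ _)) //.
by rewrite (leq_trans _ (leq_addr _ _)) // -ltnS.
Qed.

(* Otherwise u (x) t^n is orthogonal to t^(n+1), so that its corner entry lies  *)
(* in the span of the t^k with k <= n; but the torus characters grow faster on  *)
(* that entry than on this span.                                                *)
Lemma exists_intertwiner n : exists2 Y : 'M[C]_(#|{: 'I_2 * 'I_n.+1}|, n.+2),
  Y != 0 & Y%:A_ *m t n.+1 = pstep n *m Y%:A_.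
Proof.
apply: contrapT => H.
have Y0 a b : haar_mx star h (pstep n) (t n.+1) a b = 0.
  apply/eqP; apply: contrapT => /negP Y0; apply: H.
  exists (haar_mx star h (pstep n) (t n.+1) a b) => //.
  apply: (haar_intertwiner h_Haar) => //; first exact: corep_mul_corep.
  exact: (corep_mul_unitary Hstar).
have [p pE] := pair_ofK (0 : 'I_2, 0 : 'I_n.+1).
pose f := pstep n p p.
have fn : filtS n f.
  have E : filtS n.+1 f by exact: filt_pstep.
  rewrite /filt -[RHS]E /tproj [RHS]big_ord_recr /= [X in _ = _ + X]big1 ?addr0 //.
  move=> i _; rewrite big1 // => j _; rewrite /tcoef h_conj.
  have /matrixP/(_ p j) := Y0 p i; rewrite [LHS]mxE [RHS]mxE => ->.
  by rewrite conjC0 mul0r scale0r.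
have [M HM] := filt_torus_bound fn.
have M0 : 0 <= M.
  have := HM 1 (oner_neq0 _) (lexx _); rewrite expr1n mulr1; exact: le_trans.
have w0 : M + 1 != 0 by rewrite gt_eqF // ltr_wpDl.
have w1 : 1 <= M + 1 by rewrite lerDr.
have := HM _ w0 w1; rewrite /f torus_pstep eqxx mulr1n pE /= expr0 divr1 subn0.
rewrite ger0_norm ?exprn_ge0 ?addr_ge0 // exprS ler_pM2r ?exprn_gt0 ?ltr_wpDl //.
by rewrite gerDl ler10.
Qed.

(** Schur's lemma gives [ctr Y *m Y] = c, so that Y divided by the root of c is an isometry and
    t^(n+1) = c^-1 [ctr Y] (u (x) t^n) Y. Every |Y p r|^2 is at most c, the sum of its column,
    whence the bound 1 on the coefficients; the support condition is conservation of weight. *)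
Lemma t_expansion n (i j : 'I_n.+2) :
  exists c : 'I_2 * 'I_n.+1 -> 'I_2 * 'I_n.+1 -> C,
  [/\ t n.+1 i j = \sum_p \sum_r c p r *: (u p.1 r.1 * t n p.2 r.2),
      forall p r, `|c p r| <= 1 &
      forall p r, c p r != 0 -> (p.1 + p.2 = i)%N /\ (r.1 + r.2 = j)%N].
Proof.
have [Y Y0 YE] := exists_intertwiner n.
have [Us1 Us2] : is_unitary_mx star (pstep n) by exact: (corep_mul_unitary Hstar).
have [Ut1 Ut2] := Ut n.+1.
have YE' : (ctr Y)%:A_ *m pstep n = t n.+1 *m (ctr Y)%:A_.
  have : adjmx star (pstep n) *m Y%:A_ = Y%:A_ *m adjmx star (t n.+1).
    rewrite -[LHS]mulmx1 -Ut1 mulmxA -(mulmxA _ Y%:A_) YE (mulmxA _ (pstep n)).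
    by rewrite Us2 mul1mx.
  move=> /(congr1 (@sadj _ _ star _ _)); rewrite !(sadjM Hstar) !sadjE !(sadjK Hstar).
  by rewrite (sadj_scal Hstar).
have [c cE] : exists c, ctr Y *m Y = c%:M.
  apply: (schur_scalar (t_irreducible t_irreps n.+1)).
  by rewrite map_algM -mulmxA YE mulmxA YE' mulmxA.
have cs r : c = \sum_p `|Y p r| ^+ 2.
  have /matrixP/(_ r r) := cE; rewrite !mxE eqxx mulr1n => <-.
  by apply: eq_bigr => p _; rewrite !mxE normCK mulrC.
have cY p r : `|Y p r| ^+ 2 <= c.
  rewrite (cs r) (bigD1 p) //= lerDl; apply: sumr_ge0 => a _; exact: exprn_ge0.
have c0 : 0 < c.
  have [p [r Yn]] : exists p r, Y p r != 0.
    apply: contrapT => H; move/eqP: Y0; apply; apply/matrixP=> p r; rewrite mxE.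
    by apply/eqP; apply: contrapT => /negP Yn; apply: H; exists p, r.
  by apply: lt_le_trans (cY p r); rewrite exprn_gt0 // normr_gt0.
(* At the torus point 2, the entry (p, r) of the intertwining relation equates Y p r times the
   weight of r with Y p r times the weight of p; powers of 2 separate the weights. *)
have supp p r : Y p r != 0 -> ((pair_of p).1 + (pair_of p).2 = r)%N.
  move=> Yn; have /matrixP/(_ p r) := YE; rewrite mxE [RHS]mxE => /(congr1 chi2).
  rewrite [LHS]torus_sum [RHS]torus_sum.
  rewrite [LHS](bigD1 r) //= [X in _ + X]big1 => [|s sr]; last first.
    by rewrite mxE mulr_algl torusZ (torus_t t_irreps) (negPf sr) mulr0n mulr0.
  rewrite [RHS](bigD1 p) //= [X in _ = _ + X]big1 => [|s sp]; last first.
    by rewrite [(_%:A_) _ _]mxE mulr_algr torusZ torus_pstep eq_sym (negPf sp) mulr0n mulr0.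
  rewrite !addr0 [(_%:A_) _ _]mxE mulr_algl mulr_algr !torusZ.
  rewrite (torus_t t_irreps) torus_pstep !eqxx !mulr1n => /(mulfI Yn).
  move: (pair_of p) => [x y] /=; set k := (x + y)%N => /eqP.
  have kn : (k <= n.+1)%N by have := ltn_ord x; have := ltn_ord y; rewrite /k; lia.
  have rn : (r <= n.+1)%N by rewrite -ltnS.
  rewrite eqr_div ?expf_neq0 // -!exprD -!natrX eqr_nat eqn_exp2l // => /eqP.
  lia.
have tE : t n.+1 i j = \sum_a \sum_b (c^-1 * ((Y a i)^* * Y b j)) *: pstep n a b.
  have : (c%:M)%:A_ *m t n.+1 = (ctr Y)%:A_ *m pstep n *m Y%:A_.
    by rewrite -cE map_algM -!mulmxA YE.
  move=> /matrixP/(_ i j); rewrite mxE (bigD1 i) //= big1 => [|s si]; last first.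
    by rewrite !mxE eq_sym (negPf si) mulr0n /= scale0r mul0r.
  rewrite addr0 !mxE eqxx mulr1n mulr_algl => /(congr1 ( *:%R c^-1)).
  rewrite scalerA mulVf ?gt_eqF // scale1r => ->.
  rewrite exchange_big scaler_sumr; apply: eq_bigr => b _ /=.
  rewrite [((_ *m pstep n) _ _)]mxE mulr_suml scaler_sumr; apply: eq_bigr => a _.
  by rewrite [(_%:A_) _ _]mxE [(_%:A_) _ _]mxE /= mulr_algl mulr_algr !scalerA !mxE mulrA mulrAC.
exists (fun p r => c^-1 * ((Y (enum_rank p) i)^* * Y (enum_rank r) j)); split.
- rewrite tE -sum_pair; apply: eq_bigr => a _; rewrite -sum_pair.
  by apply: eq_bigr => b _; rewrite /pair_of !enum_valK [pstep _ _ _]mxE.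
- move=> p r; rewrite normrM normfV (gtr0_norm c0) [c^-1 * _]mulrC ler_pdivrMr // mul1r.
  rewrite normrM norm_conjC -(ler_pXn2r (ltn0Sn 1)) ?nnegrE ?mulr_ge0 ?(ltW c0) //.
  by rewrite exprMn [c ^+ 2]expr2 ler_pM ?exprn_ge0.
- move=> p r; rewrite mulf_eq0 negb_or => /andP[_]; rewrite mulf_eq0 negb_or.
  rewrite conjC_eq0 => /andP[/supp H1 /supp H2].
  by move: H1 H2; rewrite /pair_of !enum_rankK.
Qed.

End Words.

(** * Weighted word norms *)

Section RealNorm.
Variables (R : realType).
Local Notation C := R[i].

(** The norm of a normed space over [R[i]] takes its values in [R[i]]; estimates are made in the
    totally ordered field R instead. *)
Definition nr (V : normedZmodType C) (x : V) : R := complex.Re `|x|.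

Section Zmod.
Variable V : normedZmodType C.
Implicit Types x y : V.
Lemma nrE x : `|x| = (nr x)%:C.
Proof. by rewrite /nr RRe_real // ger0_real. Qed.
Lemma nr_ge0 x : 0 <= nr x.
Proof. by rewrite -ler0c -nrE. Qed.
Lemma nrD x y : nr (x + y) <= nr x + nr y.
Proof. by rewrite -lecR real_complexD -!nrE ler_normD. Qed.
Lemma nrN x : nr (- x) = nr x.
Proof. by rewrite /nr normrN. Qed.
Lemma nrB x y : nr (x - y) = nr (y - x).
Proof. by rewrite /nr distrC. Qed.
Lemma nr0 : nr (0 : V) = 0.
Proof. by rewrite /nr normr0. Qed.
Lemma nr_eq0 x : nr x = 0 -> x = 0.
Proof. by move=> H; apply/eqP; rewrite -normr_eq0 nrE H. Qed.
End Zmod.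

Lemma nrM (x y : C) : nr (x * y) = nr x * nr y.
Proof. by apply: complexI; rewrite real_complexM -!nrE normrM. Qed.
Lemma nrZ (V : normedModType C) (k : C) (x : V) : nr (k *: x) = nr k * nr x.
Proof. by apply: complexI; rewrite real_complexM -!nrE normrZ. Qed.
Lemma nr1 : nr (1 : C) = 1.
Proof. by apply: complexI; rewrite -nrE normr1. Qed.
Lemma nr_real (x : R) : 0 <= x -> nr (x%:C : C) = x.
Proof. by move=> x0; apply: complexI; rewrite -nrE ger0_norm // ler0c. Qed.
Lemma nrV (x : C) : nr x^-1 = (nr x)^-1.
Proof. by apply: complexI; rewrite real_complexV -!nrE normfV. Qed.
Lemma nr_conj (x : C) : nr (x^*) = nr x.
Proof. by apply: complexI; rewrite -!nrE norm_conjC. Qed.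
End RealNorm.

Section WordNorm.
Variables (R : realType) (q : R).
Local Notation A := (CqSU2 q).
Local Notation C := R[i].
Local Notation u := (Cq_gen q).
Local Notation wev := (@weval R q).

Definition wpoly := seq (C * seq ('I_2 * 'I_2)).
Definition wsum (l : wpoly) : A := \sum_(x <- l) x.1 *: wev x.2.
Definition wnorm (r : R) (l : wpoly) : R := \sum_(x <- l) nr x.1 * r ^+ size x.2.

(** A witnessed upper bound for the weighted word norm of f; the infimum itself is never formed. *)
Definition wbound (r : R) (f : A) (B : R) := exists2 l, wsum l = f & wnorm r l <= B.

Definition wmul (l1 l2 : wpoly) : wpoly :=
  [seq (x.1 * y.1, x.2 ++ y.2) | x <- l1, y <- l2].

Lemma weval_cat w1 w2 : wev (w1 ++ w2) = wev w1 * wev w2.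
Proof. by rewrite /weval big_cat. Qed.

Lemma wsum_mul l1 l2 : wsum (wmul l1 l2) = wsum l1 * wsum l2.
Proof.
rewrite /wsum big_allpairs_dep mulr_suml; apply: eq_bigr => x _.
rewrite mulr_sumr; apply: eq_bigr => y _ /=.
by rewrite weval_cat -scalerAl -scalerAr scalerA.
Qed.

Lemma wnorm_mul r l1 l2 : wnorm r (wmul l1 l2) = wnorm r l1 * wnorm r l2.
Proof.
rewrite /wnorm big_allpairs_dep mulr_suml; apply: eq_bigr => x _.
rewrite mulr_sumr; apply: eq_bigr => y _ /=.
by rewrite nrM size_cat exprD mulrACA.
Qed.

Variable r : R.
Hypothesis r0 : 0 <= r.

Lemma wnorm_ge0 l : 0 <= wnorm r l.
Proof. by apply: sumr_ge0 => x _; rewrite mulr_ge0 ?nr_ge0 ?exprn_ge0. Qed.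

Lemma wbound_ge0 f B : wbound r f B -> 0 <= B.
Proof. by case=> l _; apply: le_trans (wnorm_ge0 l). Qed.
Lemma wbound_le f B B' : B <= B' -> wbound r f B -> wbound r f B'.
Proof. by move=> BB' [l lf lB]; exists l => //; exact: le_trans BB'. Qed.
Lemma wbound0 : wbound r 0 0.
Proof. by exists [::]; rewrite ?/wsum ?/wnorm big_nil. Qed.
Lemma wboundD f g a b : wbound r f a -> wbound r g b -> wbound r (f + g) (a + b).
Proof.
move=> [l lf la] [m mg mb]; exists (l ++ m).
  by rewrite /wsum big_cat /= -lf -mg.
by rewrite /wnorm big_cat lerD.
Qed.
Lemma wbound_sum I (s : seq I) (P : pred I) (F : I -> A) (B : I -> R) :
  (forall i, P i -> wbound r (F i) (B i)) ->
  wbound r (\sum_(i <- s | P i) F i) (\sum_(i <- s | P i) B i).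
Proof. by move=> H; elim/big_rec2: _ => [|i x y Pi IH]; [exact: wbound0|apply: wboundD => //; exact: H]. Qed.
Lemma wboundM f g a b : wbound r f a -> wbound r g b -> wbound r (f * g) (a * b).
Proof.
move=> [l lf la] [m mg mb]; exists (wmul l m); first by rewrite wsum_mul lf mg.
by rewrite wnorm_mul ler_pM ?wnorm_ge0.
Qed.
Lemma wbound_weval w : wbound r (wev w) (r ^+ size w).
Proof.
exists [:: (1, w)]; first by rewrite /wsum big_seq1 scale1r.
by rewrite /wnorm big_seq1 nr1 mul1r.
Qed.
Lemma wbound_gen i j : wbound r (u i j) r.
Proof. by have := wbound_weval [:: (i, j)]; rewrite /weval big_seq1. Qed.
Lemma wbound_cst k : wbound r k%:A (nr k).
Proof.
exists [:: (k, [::])]; first by rewrite /wsum big_seq1 /= /weval big_nil.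
by rewrite /wnorm big_seq1 /= mulr1.
Qed.
Lemma wboundZ k f a : wbound r f a -> wbound r (k *: f) (nr k * a).
Proof. by move=> H; rewrite -mulr_algl; apply: wboundM => //; exact: wbound_cst. Qed.

Lemma wbound_ex f : exists B, wbound r f B.
Proof.
elim/Cq_ind: f => [k|i j|x y [a Ha] [b Hb]|x y [a Ha] [b Hb]].
- by exists (nr k); exact: wbound_cst.
- by exists r; exact: wbound_gen.
- by exists (a + b); exact: wboundD.
- by exists (a * b); exact: wboundM.
Qed.

(* A homomorphism into matrices maps a word of length n to a product of n     *)
(* matrices, whose l1 row norms are submultiplicative.                        *)
Lemma wbound_hom n (Phi : A -> 'M[A]_n) :
  (forall i j, linear (fun f => Phi f i j)) -> Phi 1 = 1%:M ->
  (forall f g, Phi (f * g) = Phi f *m Phi g) ->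
  exists2 r', 0 <= r' & forall f B, wbound r' f B -> forall i j, wbound r (Phi f i j) B.
Proof.
move=> Phil Phi1 PhiM.
have [b Hb] : exists b : ('I_2 * 'I_2) -> 'I_n -> 'I_n -> R,
    forall p i j, wbound r (Phi (u p.1 p.2) i j) (b p i j).
  have [b Hb] := choice (fun x : ('I_2 * 'I_2) * 'I_n * 'I_n =>
     wbound_ex (Phi (u x.1.1.1 x.1.1.2) x.1.2 x.2)).
  by exists (fun p i j => b (p, i, j)) => p i j; exact: (Hb (p, i, j)).
have b0 p i j : 0 <= b p i j by exact: wbound_ge0 (Hb p i j).
(* Summing over all generators and all entries dominates every row sum of every generator. *)
pose r' := \sum_p \sum_i \sum_j b p i j.
have r'0 : 0 <= r' by do 3!(apply: sumr_ge0 => ? _).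
have br' p i : \sum_j b p i j <= r'.
  rewrite /r' [leRHS](bigD1 p) //= [X in _ <= X + _](bigD1 i) //= -addrA lerDl addr_ge0 //.
    by do 2!(apply: sumr_ge0 => ? _).
  by do 3!(apply: sumr_ge0 => ? _).
have word w : exists c : 'I_n -> 'I_n -> R,
    (forall i j, wbound r (Phi (wev w) i j) (c i j)) /\
    (forall i, \sum_j c i j <= r' ^+ size w).
  elim: w => [|p w [c [Hc cs]]].
    exists (fun i j => (i == j)%:R); split=> [i j|i].
      rewrite /weval big_nil Phi1 mxE; case: (i == j).
        by have := wbound_cst 1; rewrite scale1r nr1.
      exact: wbound0.
    rewrite (bigD1 i) //= eqxx big1 ?addr0 // => j /negPf ji.
    by rewrite eq_sym ji.
  exists (fun i j => \sum_k b p i k * c k j); split=> [i j|i].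
    rewrite /weval big_cons PhiM mxE; apply: wbound_sum => k _.
    by apply: wboundM.
  rewrite exchange_big /= exprS.
  apply: le_trans (_ : \sum_k b p i k * r' ^+ size w <= _).
    apply: ler_sum => k _; rewrite -mulr_sumr; apply: ler_wpM2l => //.
  by rewrite -mulr_suml; apply: ler_wpM2r => //; rewrite exprn_ge0.
exists r' => // f B [l lf lB] i j; apply: wbound_le lB _.
have -> : Phi f i j = \sum_(x <- l) x.1 *: Phi (wev x.2) i j.
  have PhiD x y : Phi (x + y) i j = Phi x i j + Phi y i j.
    by have := Phil i j 1 x y; rewrite !scale1r.
  have Phi0 : Phi 0 i j = 0 by apply: (addrI (Phi 0 i j)); rewrite -PhiD !addr0.
  rewrite -lf /wsum (big_morph (fun x => Phi x i j) PhiD Phi0).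
  apply: eq_bigr => x _; have := Phil i j x.1 (wev x.2) 0.
  by rewrite !addr0 Phi0 addr0.
apply: wbound_sum => x _; apply: wboundZ; have [c [Hc cs]] := word x.2.
apply: wbound_le (Hc i j); apply: le_trans (cs i).
rewrite (bigD1 j) //= lerDl; apply: sumr_ge0 => k _; exact: wbound_ge0 (Hc i k).
Qed.
End WordNorm.

Section IrrepBound.
Variables (R : realType) (q : R) (q_gt0 : 0 < q).
Local Notation A := (CqSU2 q).
Local Notation C := R[i].
Local Notation u := (Cq_gen q).
Variables (star : A -> A) (Delta : {lrmorphism A -> tensor A}).
Hypothesis SU2 : is_SU2_structure star Delta.
Variable (h : {linear A -> C^o}).
Hypothesis h_Haar : is_Haar_state star Delta h.
Variable (t : forall k : nat, 'M[A]_k.+1).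
Hypothesis t_irreps : is_SU2_irreps star Delta t.
Hypothesis h_conj : forall f g, h (star f * g) = (h (star g * f))^* :> C.

Let antidiag_le n i : \sum_(p : 'I_2 * 'I_n) ((p.1 + p.2 == i)%N)%:R <= 2 :> R.
Proof.
rewrite -(pair_bigA _ (fun (x : 'I_2) (y : 'I_n) => ((x + y == i)%N)%:R)) /=.
apply: le_trans (_ : \sum_(x < 2) 1 <= _); last by rewrite sumr_const card_ord.
apply: ler_sum => x _; have [y0 yE|H] := pickP (fun y : 'I_n => (x + y == i)%N).
  rewrite (bigD1 y0) //= yE big1 ?addr0 // => y /negPf yy0.
  by rewrite -(eqP yE) eqn_add2l [(y == y0 :> nat)]yy0.
by rewrite big1 // => y _; rewrite H.
Qed.

(** In [t_expansion] the weights leave at most two pairs p and two pairs s, since each index in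
    ['I_2] determines its partner. Each of these four terms costs a factor r for the generator. *)
Lemma wbound_t r n i j : 0 <= r -> wbound r (t n i j) ((4 * r) ^+ n).
Proof.
move=> r0; elim: n i j => [|n IH] i j.
  rewrite !ord1 (t0E SU2 t_irreps).
  by have := @wbound_cst R q r 1; rewrite scale1r nr1.
have [c [-> c1 cs]] := t_expansion q_gt0 SU2 h_Haar t_irreps h_conj i j.
pose B := r * (4 * r) ^+ n.
have B0 : 0 <= B by rewrite mulr_ge0 // exprn_ge0 // mulr_ge0.
apply: (@wbound_le _ _ _ _
  (\sum_(p : 'I_2 * 'I_n.+1) \sum_(s : 'I_2 * 'I_n.+1) (((p.1 + p.2 == i)%N)%:R * ((s.1 + s.2 == j)%N)%:R * B))).
  under eq_bigr do rewrite -mulr_suml -mulr_sumr.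
  rewrite -mulr_suml -mulr_suml exprS -[leRHS]mulrA -/B; apply: ler_wpM2r => //.
  rewrite (_ : 4 = 2 * 2); last by rewrite -natrM.
  by rewrite ler_pM ?sumr_ge0.
apply: wbound_sum => p _; apply: wbound_sum => s _.
have [->|/cs[-> ->]] := eqVneq (c p s) 0.
  rewrite scale0r; apply: wbound_le (wbound0 _ _).
  by apply: mulr_ge0 => //; apply: mulr_ge0; exact: ler0n.
rewrite !eqxx !mul1r; apply: wbound_le (_ : nr (c p s) * B <= _) _.
  by rewrite ler_piMl // -lecR -nrE; exact: c1.
by apply: wboundZ => //; apply: wboundM => //; exact: wbound_gen.
Qed.
End IrrepBound.

(** * The GNS space and the Dirac operator *)

Section Topology.
Variables (R : realType).
Local Notation C := R[i].

Lemma real_complex_gt0 (e : R) : (0 < e%:C :> C) = (0 < e).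
Proof. by rewrite -ltcR. Qed.

Lemma nbhs_nr (V : normedModType C) (x : V) (P : set V) :
  nbhs x P <-> exists2 e : R, 0 < e & forall y, nr (y - x) < e -> P y.
Proof.
have ltE (e : R) y : (nr (y - x) < e) = (`|x - y| < e%:C).
  by rewrite nrB nrE ltcR.
split=> [/nbhs_normP[e /= e0 H]|[e e0 H]].
  have eE : (complex.Re e)%:C = e by rewrite RRe_real // gtr0_real.
  exists (complex.Re e); first by rewrite -real_complex_gt0 eE.
  by move=> y; rewrite ltE eE => yx; apply: H.
apply/nbhs_normP; exists e%:C => /=; first by rewrite real_complex_gt0.
by move=> y /= yx; apply: H; rewrite ltE.
Qed.

Lemma closure_nr (V : normedModType C) (S : set V) x :
  closure S x <-> forall e : R, 0 < e -> exists2 y, S y & nr (y - x) < e.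
Proof.
split=> [cl e e0|H B /nbhs_nr[e e0 eB]].
  have /cl[y [Sy ye]] : nbhs x [set y | nr (y - x) < e] by apply/nbhs_nr; exists e.
  by exists y.
by have [y Sy /eB By] := H e e0; exists y.
Qed.

Lemma closure_nr2 (V : normedModType C) (S : set (V * V)) x y :
  closure S (x, y) <->
  forall e : R, 0 < e -> exists z w, [/\ S (z, w), nr (z - x) < e & nr (w - y) < e].
Proof.
split=> [cl e e0|H B].
  have /cl[[z w] [Szw [/= H1 H2]]] :
      nbhs (x, y) [set p | nr (p.1 - x) < e /\ nr (p.2 - y) < e].
    exists ([set z | nr (z - x) < e], [set w | nr (w - y) < e]).
      by split; apply/nbhs_nr; exists e.
    by move=> [z w] [].
  by exists z, w.
case=> -[P1 P2] [/= /nbhs_nr[e1 e10 H1] /nbhs_nr[e2 e20 H2]] PB.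
have e0 : 0 < Num.min e1 e2 by rewrite lt_min e10.
have [z [w [Szw]]] := H _ e0; rewrite !lt_min => /andP[z1 _] /andP[_ w2].
by exists (z, w); split => //; apply: PB; split; [exact: H1|exact: H2].
Qed.

Definition nr_cvg (V : normedZmodType C) (s : nat -> V) (x : V) :=
  forall e : R, 0 < e -> exists N : nat, forall n, (N <= n)%N -> nr (s n - x) < e.

Definition nr_cauchy (V : normedZmodType C) (s : nat -> V) :=
  forall e : R, 0 < e -> exists N : nat, forall m n, (N <= m)%N -> (N <= n)%N ->
    nr (s m - s n) < e.

Lemma nr_complete (V : completeNormedModType C) (s : nat -> V) :
  nr_cauchy s -> exists x, nr_cvg s x.
Proof.
move=> sc; have : cauchy (s @ \oo).
  apply/cauchy_ballP => e e0.
  have eE : (complex.Re e)%:C = e by rewrite RRe_real // gtr0_real.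
  have /sc[N HN] : 0 < complex.Re e by rewrite -real_complex_gt0 eE.
  exists ([set x | exists2 m, (N <= m)%N & x = s m], [set x | exists2 m, (N <= m)%N & x = s m]).
    by split; exists N => // m /= Nm; exists m.
  move=> [x y] [/= [m Nm ->] [n Nn ->]].
  by rewrite -ball_normE /= nrE -eE ltcR; exact: HN.
move=> /cauchy_cvg/cvg_ex[x sx]; exists x => e e0.
have /sx[N _ HN] : nbhs x [set y | nr (y - x) < e] by apply/nbhs_nr; exists e.
by exists N => n Nn; apply: HN.
Qed.
End Topology.

(** * The inner product and Fourier truncation *)

Section GNS.
Variables (R : realType) (q : R) (q_gt0 : 0 < q).
Local Notation A := (CqSU2 q).
Local Notation C := R[i].
Local Notation u := (Cq_gen q).
Variables (star : A -> A) (Delta : {lrmorphism A -> tensor A}).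
Hypothesis SU2 : is_SU2_structure star Delta.
Let Hstar : is_star star. Proof. by case: SU2. Qed.
Variable (h : {linear A -> C^o}).
Hypothesis h_Haar : is_Haar_state star Delta h.
Variable (t : forall k : nat, 'M[A]_k.+1).
Hypothesis t_irreps : is_SU2_irreps star Delta t.
Variables (L2 : completeNormedModType C) (ip : L2 -> L2 -> C) (Lam : {linear A -> L2}).
Hypothesis L2_GNS : is_GNS_space star h ip Lam.
Local Notation filtS := (@filt R q star h t).

Lemma ipZDr x k y z : ip x (k *: y + z) = k * ip x y + ip x z.
Proof. by case: L2_GNS => H _ _ _ _; exact: H. Qed.
Lemma ipC x y : ip y x = (ip x y)^*.
Proof. by case: L2_GNS => _ H _ _ _; exact: H. Qed.
Lemma ip_norm x : ip x x = `|x| ^+ 2.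
Proof. by case: L2_GNS => _ _ H _ _; exact: H. Qed.
Lemma ip_Lam f g : ip (Lam f) (Lam g) = h (star f * g).
Proof. by case: L2_GNS => _ _ _ H _; exact: H. Qed.
Lemma ipDr x y z : ip x (y + z) = ip x y + ip x z.
Proof. by rewrite -[y]scale1r ipZDr mul1r scale1r. Qed.
Lemma ip0r x : ip x 0 = 0.
Proof. by apply: (addrI (ip x 0)); rewrite -ipDr !addr0. Qed.
Lemma ipZr x k y : ip x (k *: y) = k * ip x y.
Proof. by rewrite -[k *: y]addr0 ipZDr ip0r addr0. Qed.
Lemma ipBr x y z : ip x (y - z) = ip x y - ip x z.
Proof. by rewrite ipDr -scaleN1r ipZr mulN1r. Qed.
Lemma ip_sumr x I (r : seq I) (P : pred I) F :
  ip x (\sum_(i <- r | P i) F i) = \sum_(i <- r | P i) ip x (F i).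
Proof. exact: (big_morph _ (ipDr x) (ip0r x)). Qed.

Lemma h_conj f g : h (star f * g) = (h (star g * f))^* :> C.
Proof. by rewrite -!ip_Lam ipC. Qed.

Lemma ip_nr x : ip x x = (nr x ^+ 2)%:C.
Proof. by rewrite ip_norm nrE -real_complexX. Qed.

Lemma ipDl x y z : ip (x + y) z = ip x z + ip y z.
Proof. by rewrite ipC ipDr rmorphD /= -!ipC. Qed.

Lemma pythagoras x y : ip x y = 0 -> nr (x + y) ^+ 2 = nr x ^+ 2 + nr y ^+ 2.
Proof.
move=> xy; apply: complexI; rewrite real_complexD -!ip_nr ipDr !ipDl.
by rewrite (ipC x y) xy conjC0 addr0 add0r.
Qed.

Lemma cauchy_schwarz x y : nr (ip x y) <= nr x * nr y.
Proof.
have [y0|y0] := eqVneq (nr y) 0; first by rewrite (nr_eq0 y0) ip0r !nr0 mulr0.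
have yp : 0 < nr y by rewrite lt_def y0 nr_ge0.
pose c := ip y x / ip y y.
have xE : x = (x - c *: y) + c *: y by rewrite subrK.
have o : ip (x - c *: y) (c *: y) = 0.
  rewrite ipZr ipC ipBr ipZr /c mulfVK ?subrr ?conjC0 ?mulr0 //.
  by rewrite ip_nr real_complex_eq0 expf_neq0.
have cE : nr (ip x y) = nr (c *: y) * nr y.
  rewrite nrZ /c nrM nrV ip_nr (nr_real (sqr_ge0 _)) ipC nr_conj.
  by rewrite -mulrA -mulrA -expr2 mulVf ?mulr1 ?expf_neq0.
rewrite cE; apply: ler_wpM2r; first exact: nr_ge0.
rewrite -(ler_pXn2r (ltn0Sn 1)) ?nnegrE ?nr_ge0 //.
by rewrite [in leRHS]xE (pythagoras o) lerDr sqr_ge0.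
Qed.

Lemma ip_closed v x y c : (forall e, 0 < e -> exists z w,
    [/\ ip v w = c * ip v z, nr (z - x) < e & nr (w - y) < e]) ->
  ip v y = c * ip v x.
Proof.
move=> H; apply/eqP; rewrite -subr_eq0; apply/eqP/nr_eq0.
have K0 : 0 < (nr c + 1) * (nr v + 1).
  by rewrite mulr_gt0 // ltr_wpDl ?nr_ge0.
apply/le_anti; rewrite nr_ge0 andbT; apply/ler_addgt0Pr => e e0; rewrite add0r.
(* The total error is at most (1 + |c|) |v| e', hence at most e / 2; the added ones avoid a division
   by zero. *)
have e'0 : 0 < e / (2 * ((nr c + 1) * (nr v + 1))).
  by rewrite divr_gt0 // mulr_gt0.
have [z [w [E zx wy]]] := H _ e'0; set e' := e / _ in e'0 zx wy.
have -> : ip v y - c * ip v x = - ip v (w - y) + c * ip v (z - x).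
  by rewrite !ipBr E; ring.
have eE : e = 2 * ((nr c + 1) * (nr v + 1)) * e'.
  by rewrite /e' mulrC divfK // gt_eqF // mulr_gt0.
apply: le_trans (nrD _ _) _; rewrite nrN nrM.
have H1 : nr (ip v (w - y)) <= nr v * e'.
  by apply: le_trans (cauchy_schwarz _ _) _; rewrite ler_wpM2l ?nr_ge0 // ltW.
have H2 : nr (ip v (z - x)) <= nr v * e'.
  by apply: le_trans (cauchy_schwarz _ _) _; rewrite ler_wpM2l ?nr_ge0 // ltW.
have H3 : nr c * nr (ip v (z - x)) <= nr c * (nr v * e') by rewrite ler_wpM2l ?nr_ge0.
rewrite eE; have := nr_ge0 c; have := nr_ge0 v.
move: (nr c) (nr v) (nr (ip v (w - y))) (nr c * nr _) H1 H3 => a b A1 A2 H1 H3 a0 b0.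
have ae : 0 <= a * e' by rewrite mulr_ge0 // ltW.
have be : 0 <= b * e' by rewrite mulr_ge0 // ltW.
have abe : 0 <= a * (b * e') by rewrite mulr_ge0 // ltW.
lra.
Qed.

Lemma ip_t k (i j i' j' : 'I_k.+1) :
  ip (Lam (t k i j)) (Lam (t k i' j')) = (haar_norm q k i)%:C *+ (i == i') *+ (j == j').
Proof. by rewrite ip_Lam (haar_orth q_gt0 SU2 h_Haar t_irreps). Qed.

Lemma ip_t_neq k l (i j : 'I_k.+1) (i' j' : 'I_l.+1) : k != l ->
  ip (Lam (t k i j)) (Lam (t l i' j')) = 0.
Proof. by move=> kl; rewrite ip_Lam (haar_orth_neq h_Haar t_irreps). Qed.

Lemma haar_norm_le1 k (i : 'I_k.+1) : haar_norm q k i <= 1.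
Proof.
rewrite ler_pdivrMr ?mul1r; last first.
  rewrite big_ord_recl ltr_wpDr ?exprn_gt0 //.
  by apply: sumr_ge0 => p _; rewrite exprn_ge0 // ltW.
by rewrite (bigD1 i) //= lerDl; apply: sumr_ge0 => p _; rewrite exprn_ge0 // ltW.
Qed.

Lemma nr_t k (i j : 'I_k.+1) : nr (Lam (t k i j)) ^+ 2 = haar_norm q k i.
Proof. by apply: complexI; rewrite -ip_nr ip_t !eqxx !mulr1n. Qed.

Lemma nr_t_le1 k (i j : 'I_k.+1) : nr (Lam (t k i j)) <= 1.
Proof. by rewrite -(expr_le1 (n:=2)) ?nr_ge0 // nr_t haar_norm_le1. Qed.

(** Column j of u has orthonormal entries: ||f||^2 is the sum over k of the ||u_kj f||^2, and
    positivity of h allows all but one to be dropped. *)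
Lemma nr_gen_mul i j f : nr (Lam (u i j * f)) <= nr (Lam f).
Proof.
rewrite -(ler_pXn2r (ltn0Sn 1)) ?nnegrE ?nr_ge0 // -lecR -!ip_nr !ip_Lam.
have [_ U2] : is_unitary_mx star u by case: SU2.
have := U2 => /matrixP/(_ j j); rewrite mxE [RHS]mxE eqxx mulr1n => E.
have -> : star f * f = \sum_k star (u k j * f) * (u k j * f).
  rewrite -[X in _ * X]mul1r -E mulr_suml mulr_sumr; apply: eq_bigr => k _.
  by rewrite [adjmx _ _ _ _]sadj_entry (starM Hstar) !mulrA.
rewrite linear_sum /= (bigD1 i) //= lerDl; apply: sumr_ge0 => k _.
by case: h_Haar => _ H _ _; exact: H.
Qed.

Lemma nr_weval w : nr (Lam (weval q w)) <= 1.
Proof.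
elim: w => [|p w IH]; last by rewrite /weval big_cons; apply: le_trans (nr_gen_mul _ _ _) IH.
rewrite /weval big_nil -(expr_le1 (n:=2)) ?nr_ge0 // -lecR -ip_nr ip_Lam.
by rewrite mulr1 (star1 Hstar); case: h_Haar => -> _ _ _.
Qed.

Definition hcoef k (i j : 'I_k.+1) (x : L2) : C := ip (Lam (t k i j)) x / (haar_norm q k i)%:C.

(** The projection [tproj] on all of L^2. It takes values in A, and so produces the canonical
    approximants of a vector. *)
Definition htrunc N (x : L2) : A :=
  \sum_(k < N.+1) \sum_i \sum_j hcoef i j x *: t k i j.

Lemma htrunc_linear N : linear (htrunc N).
Proof.
move=> c x y; rewrite /htrunc scaler_sumr -big_split; apply: eq_bigr => k _ /=.
rewrite scaler_sumr -big_split; apply: eq_bigr => i _ /=.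
rewrite scaler_sumr -big_split; apply: eq_bigr => j _ /=.
by rewrite /hcoef ipZDr mulrDl scalerDl scalerA mulrA.
Qed.
Lemma htrunc0 N : htrunc N 0 = 0.
Proof. by have := htrunc_linear N (-1) 0 0; rewrite !scaleN1r oppr0 addr0 addNr. Qed.

Lemma htrunc_Lam N f : htrunc N (Lam f) = @tproj R q star h t N f.
Proof.
by rewrite /htrunc /tproj; do 3!(apply: eq_bigr => ? _); rewrite /hcoef ip_Lam.
Qed.

Lemma filt_htrunc N x : filtS N (htrunc N x).
Proof.
apply: filt_sum => k _; apply: filt_sum => i _; apply: filt_sum => j _.
by apply: filtZ; apply: (filt_t q_gt0 SU2 h_Haar t_irreps); rewrite -ltnS.
Qed.

Lemma ip_htrunc N x k (i j : 'I_k.+1) : (k <= N)%N ->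
  ip (Lam (t k i j)) (Lam (htrunc N x)) = ip (Lam (t k i j)) x.
Proof.
rewrite -ltnS => kN; rewrite /htrunc linear_sum ip_sumr (bigD1 (Ordinal kN)) //=.
rewrite [X in _ + X]big1 ?addr0; last first.
  move=> l lk; rewrite linear_sum ip_sumr big1 // => a _.
  rewrite linear_sum ip_sumr big1 // => b _.
  by rewrite linearZ ipZr ip_t_neq ?mulr0 // eq_sym.
rewrite linear_sum ip_sumr (bigD1 i) //= [X in _ + X]big1 ?addr0; last first.
  move=> a ai; rewrite linear_sum ip_sumr big1 // => b _.
  by rewrite linearZ ipZr ip_t eq_sym (negPf ai) mulr0n mul0rn mulr0.
rewrite linear_sum ip_sumr (bigD1 j) //= [X in _ + X]big1 ?addr0; last first.
  by move=> b bj; rewrite linearZ ipZr ip_t eq_sym [b == j]eq_sym eq_sym (negPf bj) mulr0n mulr0.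
rewrite linearZ ipZr ip_t !eqxx !mulr1n /hcoef mulfVK //.
by rewrite real_complex_eq0 gt_eqF // haar_norm_gt0.
Qed.

End GNS.

Section LinSpan.
Variables (R : realType) (V : lmodType R[i]) (S : set V).
Lemma lin_span_gen v : S v -> lin_span S v.
Proof.
move=> Sv; exists 1, (fun=> 1), (fun=> v); split=> //.
by rewrite big_ord1 scale1r.
Qed.
Lemma lin_spanZ k v : lin_span S v -> lin_span S (k *: v).
Proof.
move=> [n [c [s [Hs ->]]]]; exists n, (fun i => k * c i), s; split=> //.
by rewrite scaler_sumr; apply: eq_bigr => i _; rewrite scalerA.
Qed.
Lemma lin_span0 : lin_span S 0.
Proof. by exists 0, (fun=> 0), (fun=> 0); split=> [[]//|]; rewrite big_ord0. Qed.
Lemma lin_spanD v w : lin_span S v -> lin_span S w -> lin_span S (v + w).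
Proof.
move=> [m [c [s [Hs ->]]]] [n [c' [s' [Hs' ->]]]].
exists (m + n), (fun i => match fintype.split i with inl a => c a | inr b => c' b end),
  (fun i => match fintype.split i with inl a => s a | inr b => s' b end).
split; first by move=> i; case: (fintype.split i).
rewrite big_split_ord; congr (_ + _); apply: eq_bigr => i _.
  by rewrite (unsplitK (inl i)).
by rewrite (unsplitK (inr i)).
Qed.
Lemma lin_span_sum I (r : seq I) (P : pred I) (F : I -> V) :
  (forall i, P i -> lin_span S (F i)) -> lin_span S (\sum_(i <- r | P i) F i).
Proof. by move=> H; elim/big_rec: _ => [|i x Pi IH]; [exact: lin_span0|apply: lin_spanD => //; exact: H]. Qed.
End LinSpan.

(** * Closed diagonal operators and the powers of |D| *)

Section Spectral.
Variables (R : realType) (q : R) (q_gt0 : 0 < q).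
Local Notation A := (CqSU2 q).
Local Notation C := R[i].
Local Notation u := (Cq_gen q).
Variables (star : A -> A) (Delta : {lrmorphism A -> tensor A}).
Hypothesis SU2 : is_SU2_structure star Delta.
Variable (h : {linear A -> C^o}).
Hypothesis h_Haar : is_Haar_state star Delta h.
Variable (t : forall k : nat, 'M[A]_k.+1).
Hypothesis t_irreps : is_SU2_irreps star Delta t.
Variables (L2 : completeNormedModType C) (ip : L2 -> L2 -> C) (Lam : {linear A -> L2}).
Hypothesis L2_GNS : is_GNS_space star h ip Lam.
Local Notation filtS := (@filt R q star h t).
Local Notation truncS := (@htrunc R q t L2 ip Lam).

Lemma filt_ex f : exists N, filtS N f.
Proof.
have [B [l <- _]] := wbound_ex (ler01 : 0 <= 1 :> R) f.
elim: l => [|x l [N IH]]; first by exists 0%N; rewrite /wsum big_nil /filt linear0.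
exists (maxn (size x.2) N); rewrite /wsum big_cons; apply: filtD; last first.
  by apply: (filt_le q_gt0 SU2 h_Haar t_irreps) IH; rewrite leq_maxr.
apply: filtZ; apply: (filt_le q_gt0 SU2 h_Haar t_irreps (leq_maxl _ _)).
exact: (filt_weval q_gt0 SU2 h_Haar t_irreps).
Qed.

(** The truncation is the nearest point of the span of the t^k with k <= n, and by density this span
    eventually contains a point close to x. *)
Lemma htrunc_cvg x : nr_cvg (fun n => Lam (truncS n x)) x.
Proof.
have /closure_nr H : closure (range Lam) x by case: L2_GNS => _ _ _ _ ->.
move=> e /H[_ [f _ <-] fx].
have [N fN] := filt_ex f; exists N => n Nn; apply: le_lt_trans fx.
rewrite ![nr (Lam _ - x)]nrB; set g := truncS n x.
have gf : filtS n (g - f).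
  rewrite -scaleN1r; apply: filtD; last by apply: filtZ; exact: (filt_le q_gt0 SU2 h_Haar t_irreps Nn).
  exact: (filt_htrunc q_gt0 SU2 h_Haar t_irreps).
have zo k (i j : 'I_k.+1) : (k <= n)%N -> ip (Lam (t k i j)) (x - Lam g) = 0.
  by move=> kn; rewrite (ipBr L2_GNS) (ip_htrunc q_gt0 SU2 h_Haar t_irreps L2_GNS) ?subrr.
have o : ip (x - Lam g) (Lam (g - f)) = 0.
  move: (x - Lam g) zo => z zo; rewrite -gf /tproj.
  rewrite linear_sum (ip_sumr L2_GNS) big1 // => k _.
  rewrite linear_sum (ip_sumr L2_GNS) big1 // => i _.
  rewrite linear_sum (ip_sumr L2_GNS) big1 // => j _.
  by rewrite linearZ (ipZr L2_GNS) (ipC L2_GNS) zo ?conjC0 ?mulr0 // -ltnS.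
rewrite -(ler_pXn2r (ltn0Sn 1)) ?nnegrE ?nr_ge0 //.
have -> : x - Lam f = (x - Lam g) + Lam (g - f) by rewrite linearB /= subrKA.
by rewrite (pythagoras L2_GNS o) lerDl sqr_ge0.
Qed.

Lemma ip_t_eq0 x : (forall k (i j : 'I_k.+1), ip (Lam (t k i j)) x = 0) -> x = 0.
Proof.
move=> H; apply: nr_eq0; apply/le_anti; rewrite nr_ge0 andbT.
apply/ler_addgt0Pr => e e0; rewrite add0r; have [N HN] := htrunc_cvg x e0.
have := HN N (leqnn N); rewrite (_ : truncS N x = 0).
  by rewrite linear0 sub0r nrN => /ltW.
rewrite /htrunc big1 // => k _; rewrite big1 // => i _; rewrite big1 // => j _.
by rewrite /hcoef H mul0r scale0r.
Qed.

Section DiagonalRelation.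
Variable c : forall k, 'I_k.+1 -> 'I_k.+1 -> C.

(* The graph of the closed operator with eigenvectors t^l_{mn} and eigenvalues c. *)
Definition diag_rel (x y : L2) : Prop :=
  forall k (i j : 'I_k.+1), ip (Lam (t k i j)) y = c i j * ip (Lam (t k i j)) x.

Lemma diag_rel_uniq x y y' : diag_rel x y -> diag_rel x y' -> y = y'.
Proof.
move=> H H'; apply/eqP; rewrite -subr_eq0; apply/eqP; apply: ip_t_eq0 => k i j.
by rewrite (ipBr L2_GNS) H H' subrr.
Qed.

Lemma diag_relZD k x y x' y' : diag_rel x y -> diag_rel x' y' ->
  diag_rel (k *: x + x') (k *: y + y').
Proof.
by move=> H H' l i j; rewrite !(ipZDr L2_GNS) H H' mulrDr mulrCA.
Qed.

Lemma diag_rel0 : diag_rel 0 0.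
Proof. by move=> k i j; rewrite (ip0r L2_GNS) mulr0. Qed.

Lemma diag_rel_t k (i j : 'I_k.+1) : diag_rel (Lam (t k i j)) (c i j *: Lam (t k i j)).
Proof.
move=> l a b; rewrite (ipZr L2_GNS); have [lk|lk] := eqVneq l k; last first.
  by rewrite (ip_t_neq h_Haar t_irreps L2_GNS) // !mulr0.
subst l; rewrite (ip_t q_gt0 SU2 h_Haar t_irreps L2_GNS).
have [->|] := eqVneq a i; last by rewrite mulr0n mul0rn !mulr0.
by have [->|] := eqVneq b j; last by rewrite mulr0n !mulr0.
Qed.

Lemma diag_rel_closed x y : (forall e, 0 < e -> exists z w,
    [/\ diag_rel z w, nr (z - x) < e & nr (w - y) < e]) -> diag_rel x y.
Proof.
move=> H k i j; apply: (ip_closed L2_GNS) => e e0.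
by have [z [w [zw zx wy]]] := H e e0; exists z, w; split.
Qed.

Lemma diag_rel_closure (S : set (L2 * L2)) x y :
  (forall z w, S (z, w) -> diag_rel z w) -> closure (lin_span S) (x, y) -> diag_rel x y.
Proof.
move=> HS /closure_nr2 cl; apply: diag_rel_closed => e e0.
have [z [w [[n [k [s [Ss E]]] zx wy]]]] := cl e e0.
exists z, w; split=> //; rewrite -[z]/(z, w).1 -[w]/(z, w).2 E.
elim/big_rec: _ => [|i [a b] _ IH]; first exact: diag_rel0.
apply: diag_relZD IH; apply: HS; rewrite -surjective_pairing; exact: Ss.
Qed.

Lemma diag_rel_htrunc N x y : diag_rel x y ->
  Lam (truncS N y) = \sum_(k < N.+1) \sum_i \sum_j (hcoef t ip Lam i j x * c i j) *: Lam (t k i j).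
Proof.
move=> H; rewrite /htrunc linear_sum; apply: eq_bigr => k _.
rewrite linear_sum; apply: eq_bigr => i _; rewrite linear_sum; apply: eq_bigr => j _.
by rewrite linearZ /hcoef H; congr (_ *: _); rewrite -mulrA mulrC.
Qed.

Lemma diag_rel_htrunc2 N x y : diag_rel x y -> diag_rel (Lam (truncS N x)) (Lam (truncS N y)).
Proof.
move=> H k i j; have [kN|kN] := leqP k N.
  by rewrite !(ip_htrunc q_gt0 SU2 h_Haar t_irreps L2_GNS) // H.
have z v : ip (Lam (t k i j)) (Lam (truncS N v)) = 0.
  rewrite /htrunc linear_sum (ip_sumr L2_GNS) big1 // => l _.
  rewrite linear_sum (ip_sumr L2_GNS) big1 // => a _.
  rewrite linear_sum (ip_sumr L2_GNS) big1 // => b _.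
  rewrite linearZ (ipZr L2_GNS) (ip_t_neq h_Haar t_irreps L2_GNS) ?mulr0 //.
  by rewrite gtn_eqF // (leq_trans _ kN) // ltnS -ltnS.
by rewrite !z mulr0.
Qed.
End DiagonalRelation.

Variable sgn : forall k : nat, 'I_k.+1 -> 'I_k.+1 -> bool.
Hypothesis qint_gt0 : forall k, 0 < qint q k.+1.
Local Notation D := (Dirac Lam t sgn).

Definition dirac_eig k (i j : 'I_k.+1) : C := ((-1) ^+ sgn i j * qint q k.+1)%:C.
Definition pow_eig (al : R) k (i j : 'I_k.+1) : C := (qint q k.+1 `^ al)%:C.

Lemma Dirac_diag x y : D (x, y) -> diag_rel dirac_eig x y.
Proof.
apply: diag_rel_closure => z w [k [i [j [-> ->]]]]; exact: diag_rel_t.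
Qed.

Lemma Dirac_t k (i j : 'I_k.+1) : D (Lam (t k i j), dirac_eig i j *: Lam (t k i j)).
Proof. by apply: subset_closure; apply: lin_span_gen; exists k, i, j. Qed.

Lemma dirac_eig_norm k (i j : 'I_k.+1) : complex.Re `|dirac_eig i j| = qint q k.+1.
Proof.
apply: complexI; rewrite RRe_real ?normr_real // /dirac_eig real_complexM normrM.
rewrite [X in _ * X]ger0_norm ?ler0c ?ltW //.
case: (sgn i j); last by rewrite expr0 normr1 mul1r.
by rewrite expr1 (rmorphN (real_complex R)) normrN normr1 mul1r.
Qed.

(** An eigenvector of D for mu has nonzero coordinates only where the eigenvalue of t^k_ij equals
    mu, and there |mu| = [k+1]_q whatever the sign; the coordinate relation is closed. Conversely,
    the truncations of x and y are finite combinations of eigenvectors and converge in both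
    components. *)
Lemma abs_powerE al x y : abs_power D al (x, y) <-> diag_rel (pow_eig al) x y.
Proof.
split.
  apply: diag_rel_closure => z w [mu /= [Dz ->]] k i j; rewrite (ipZr L2_GNS).
  have := Dirac_diag Dz i j; rewrite (ipZr L2_GNS).
  have [->|z0 /(mulIf z0) ->] := eqVneq (ip (Lam (t k i j)) z) 0; first by rewrite !mulr0.
  by congr ((_ `^ _)%:C * _); exact: dirac_eig_norm.
move=> H; apply/closure_nr2 => e e0.
have [N1 HN1] := htrunc_cvg x e0; have [N2 HN2] := htrunc_cvg y e0.
pose N := maxn N1 N2.
exists (Lam (truncS N x)), (Lam (truncS N y)); split; last 2 first.
- by apply: HN1; rewrite leq_maxl.
- by apply: HN2; rewrite leq_maxr.
rewrite (diag_rel_htrunc _ H) /htrunc.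
have -> : (Lam (\sum_(k < N.+1) \sum_i \sum_j hcoef t ip Lam i j x *: t k i j),
    \sum_(k < N.+1) \sum_i \sum_j (hcoef t ip Lam i j x * pow_eig al i j) *: Lam (t k i j)) =
  \sum_(k < N.+1) \sum_i \sum_j hcoef t ip Lam i j x *:
     (Lam (t k i j), pow_eig al i j *: Lam (t k i j)) :> L2 * L2.
  apply/eqP; rewrite -pair_eqE; apply/andP; split; apply/eqP => /=.
    rewrite (raddf_sum fst) linear_sum; apply: eq_bigr => k _ /=.
    rewrite (raddf_sum fst) linear_sum; apply: eq_bigr => i _ /=.
    rewrite (raddf_sum fst) linear_sum; apply: eq_bigr => j _ /=.
    by rewrite linearZ.
  rewrite (raddf_sum snd); apply: eq_bigr => k _ /=.
  rewrite (raddf_sum snd); apply: eq_bigr => i _ /=.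
  rewrite (raddf_sum snd); apply: eq_bigr => j _ /=.
  by rewrite scalerA.
do 3!(apply: lin_span_sum => ? _); apply: lin_spanZ; apply: lin_span_gen.
eexists; split; first exact: Dirac_t.
by congr ((_ `^ _)%:C *: _); apply/esym; exact: dirac_eig_norm.
Qed.

End Spectral.

(** * Exponential estimates for q-integers and Haar norms *)

Section QInt.
Variables (R : realType).

Lemma qint1 (x : R) : 1 < x -> qint x 1 = 1.
Proof.
move=> x1; rewrite /qint !expr1 divff // subr_eq0 gt_eqF //.
by rewrite (lt_trans _ x1) // invf_lt1 // (lt_trans _ x1).
Qed.

Lemma qintS (x : R) n : 1 < x -> qint x n.+2 = x * qint x n.+1 + x ^- n.+1.
Proof.
move=> x1; have x0 : x != 0 by rewrite gt_eqF // (lt_trans _ x1).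
have d0 : x - x^-1 != 0.
  by rewrite subr_eq0 gt_eqF // (lt_trans _ x1) // invf_lt1 // (lt_trans _ x1).
apply: (mulIf d0); rewrite mulrDl /qint -!mulrA mulVf // !mulr1.
have xn : x ^+ n != 0 by rewrite expf_neq0.
by rewrite !exprS; field; rewrite x0 xn.
Qed.

Lemma qint_ge (x : R) n : 1 < x -> x ^+ n <= qint x n.+1.
Proof.
move=> x1; have x0 : 0 < x by exact: lt_trans x1.
elim: n => [|n IH]; first by rewrite qint1.
rewrite qintS // [leLHS]exprS; apply: ler_wpDr.
  by rewrite invr_ge0 exprn_ge0 // ltW.
by rewrite ler_pM2l.
Qed.

Lemma qint_le (x : R) n : 1 < x -> qint x n.+1 <= (x + 1) ^+ n.
Proof.
move=> x1; have x0 : 0 < x by exact: lt_trans x1.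
elim: n => [|n IH]; first by rewrite qint1.
rewrite qintS // [leRHS]exprS mulrDl mul1r lerD //; first by rewrite ler_pM2l.
apply: (@le_trans _ _ 1); last by rewrite exprn_ege1 // lerDr ltW.
by rewrite invf_le1 ?exprn_gt0 // exprn_ege1 // ltW.
Qed.

Variables (q : R) (q_gt0 : 0 < q) (q_neq1 : q != 1).

(** The q-integers are invariant under q -> 1/q, so the estimates for bases above 1 cover all q. *)
Definition qmax : R := Num.max q q^-1.

Lemma qmax_gt1 : 1 < qmax.
Proof.
rewrite lt_max; case: (ltgtP q 1) q_neq1 => //= q1 _.
by rewrite invf_gt1.
Qed.

Lemma qint_qmax n : qint qmax n = qint q n.
Proof.
rewrite /qmax; case: (leP q^-1 q) => // _; rewrite /qint !exprVn !invrK.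
by rewrite -opprB -[q^-1 - q]opprB invrN mulrNN.
Qed.

Lemma qint_gt0 n : 0 < qint q n.+1.
Proof.
rewrite -qint_qmax; apply: lt_le_trans (qint_ge _ qmax_gt1).
by rewrite exprn_gt0 // (lt_trans _ qmax_gt1).
Qed.

(** The inverse is the sum of the k+1 ratios q^(2p-2i), each at most qmax^(2k), and k+1 <= 2^k. *)
Lemma haar_norm_inv_le k (i : 'I_k.+1) : (haar_norm q k i)^-1 <= (2 * qmax ^+ 2) ^+ k.
Proof.
have Q0 : 0 < qmax by exact: lt_trans qmax_gt1.
have H (p : 'I_k.+1) : q ^+ (2 * p) / q ^+ (2 * i) <= qmax ^+ (2 * k).
  rewrite ler_pdivrMr ?exprn_gt0 //.
  have ik : (2 * i <= 2 * k)%N by rewrite leq_mul2l /= -ltnS.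
  have pk : (2 * p <= 2 * k)%N by rewrite leq_mul2l /= -ltnS.
  rewrite /qmax; case: (leP q^-1 q) => q1.
    have q1' : 1 <= q.
      rewrite leNgt; apply/negP => q1'.
      by move: q1; rewrite leNgt (lt_trans q1') // invf_gt1.
    by rewrite -[leLHS]mulr1 ler_pM ?exprn_ge0 ?exprn_ege1 ?ler_weXn2l // ltW.
  have q1' : q <= 1.
    rewrite leNgt; apply/negP => q1'.
    by move: q1; rewrite ltNge ltW // (lt_trans _ q1') // invf_lt1.
  rewrite -(subnKC ik) exprD mulrAC exprVn mulVf ?mul1r ?expf_neq0 ?gt_eqF //.
  apply: (@le_trans _ _ 1); first by rewrite exprn_ile1 // ltW.
  by rewrite exprVn invf_ge1 ?exprn_gt0 // exprn_ile1 // ltW.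
rewrite /haar_norm invf_div mulr_suml.
apply: le_trans (_ : \sum_(p < k.+1) qmax ^+ (2 * k) <= _); first exact: ler_sum.
rewrite sumr_const card_ord -[leLHS]mulr_natl exprMn -exprM.
apply: ler_wpM2r.
  by rewrite exprn_ge0 // ltW.
by rewrite -natrX ler_nat ltn_expl.
Qed.
End QInt.

(** * Smooth vectors and comparison with the word norms *)

Section SmoothDomain.
Variables (R : realType) (q : R) (q_gt0 : 0 < q) (q_neq1 : q != 1).
Local Notation A := (CqSU2 q).
Local Notation C := R[i].
Local Notation u := (Cq_gen q).
Variables (star : A -> A) (Delta : {lrmorphism A -> tensor A}).
Hypothesis SU2 : is_SU2_structure star Delta.
Variable (h : {linear A -> C^o}).
Hypothesis h_Haar : is_Haar_state star Delta h.
Variable (t : forall k : nat, 'M[A]_k.+1).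
Hypothesis t_irreps : is_SU2_irreps star Delta t.
Variables (L2 : completeNormedModType C) (ip : L2 -> L2 -> C) (Lam : {linear A -> L2}).
Hypothesis L2_GNS : is_GNS_space star h ip Lam.
Variable sgn : forall k : nat, 'I_k.+1 -> 'I_k.+1 -> bool.
Local Notation filtS := (@filt R q star h t).
Local Notation truncS := (@htrunc R q t L2 ip Lam).
Local Notation D := (Dirac Lam t sgn).
Local Notation rel al := (@diag_rel R q t L2 ip Lam (@pow_eig R q al)).
Local Notation E := (smooth_domain D).
Local Notation p := (smooth_norm D).

Let powE al x y : abs_power D al (x, y) <-> rel al x y.
Proof.
exact: (abs_powerE q_gt0 SU2 h_Haar t_irreps L2_GNS sgn (qint_gt0 q_gt0 q_neq1)).
Qed.

Let rel_uniq al x y y' : rel al x y -> rel al x y' -> y = y'.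
Proof. exact: (diag_rel_uniq q_gt0 SU2 h_Haar t_irreps L2_GNS). Qed.

Lemma smoothP x : E x <-> forall al, 0 <= al -> exists y, rel al x y.
Proof. by split=> H al al0; have [y /powE Hy] := H al al0; exists y. Qed.

Lemma smooth_normE al x y : rel al x y -> p al x = nr y.
Proof.
move=> Hy; rewrite /smooth_norm; congr (complex.Re `|_|).
case: xgetP => [z _ /powE Hz|/(_ y)]; first exact: rel_uniq Hz Hy.
by case; apply/powE.
Qed.

Lemma smooth0 : E 0.
Proof. by apply/smoothP => al _; exists 0; exact: (diag_rel0 t L2_GNS). Qed.

Lemma smoothZD k x y : E x -> E y -> E (k *: x + y).
Proof.
move=> /smoothP Ex /smoothP Ey; apply/smoothP => al al0.
have [x' xx'] := Ex al al0; have [y' yy'] := Ey al al0.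
by exists (k *: x' + y'); exact: (diag_relZD L2_GNS).
Qed.

Lemma smooth_normD al x y : 0 <= al -> E x -> E y -> p al (x + y) <= p al x + p al y.
Proof.
move=> al0 /smoothP/(_ al al0)[x' xx'] /smoothP/(_ al al0)[y' yy'].
have := diag_relZD L2_GNS 1 xx' yy'; rewrite !scale1r => /smooth_normE ->.
by rewrite (smooth_normE xx') (smooth_normE yy') nrD.
Qed.

Lemma smooth_normZ al k x : 0 <= al -> E x -> p al (k *: x) = nr k * p al x.
Proof.
move=> al0 /smoothP/(_ al al0)[x' xx'].
have := diag_relZD L2_GNS k xx' (diag_rel0 t L2_GNS (@pow_eig R q al)).
by rewrite !addr0 => /smooth_normE ->; rewrite (smooth_normE xx') nrZ.
Qed.

Lemma smooth_norm_ge0 al x : 0 <= p al x.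
Proof. exact: nr_ge0. Qed.

Lemma rel0 x : rel 0 x x.
Proof. by move=> k i j; rewrite /pow_eig powRr0 mul1r. Qed.

Lemma smooth_norm0 x : p 0 x = nr x.
Proof. exact: smooth_normE (rel0 x). Qed.

Lemma rel_Lam al f : exists y, rel al (Lam f) y.
Proof.
have [N <-] := filt_ex q_gt0 SU2 h_Haar t_irreps f.
rewrite /tproj linear_sum; elim/big_rec: _ => [|k x _ [y xy]].
  by exists 0; exact: (diag_rel0 t L2_GNS).
suff [z Hz] : exists z, rel al (Lam (\sum_i \sum_j tcoef star h t i j f *: t k i j)) z.
  by exists (z + y); have := diag_relZD L2_GNS 1 Hz xy; rewrite !scale1r.
rewrite linear_sum; elim/big_rec: _ => [|i {}x _ [{}y {}xy]].
  by exists 0; exact: (diag_rel0 t L2_GNS).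
suff [z Hz] : exists z, rel al (Lam (\sum_j tcoef star h t i j f *: t k i j)) z.
  by exists (z + y); have := diag_relZD L2_GNS 1 Hz xy; rewrite !scale1r.
rewrite linear_sum; elim/big_rec: _ => [|j {}x _ [{}y {}xy]].
  by exists 0; exact: (diag_rel0 t L2_GNS).
rewrite linearZ /=; exists (tcoef star h t i j f *: (@pow_eig R q al k i j *: Lam (t k i j)) + y).
apply: (diag_relZD L2_GNS) => //.
exact: (diag_rel_t q_gt0 SU2 h_Haar t_irreps L2_GNS).
Qed.

Lemma smooth_Lam f : E (Lam f).
Proof. by apply/smoothP => al _; exact: rel_Lam. Qed.

Lemma smooth_trunc_cvg x al : E x -> 0 <= al -> forall e, 0 < e ->
  exists N, forall n, (N <= n)%N -> p al (Lam (truncS n x) - x) < e.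
Proof.
move=> /smoothP Ex al0 e e0; have [y xy] := Ex al al0.
have [N HN] := htrunc_cvg q_gt0 SU2 h_Haar t_irreps L2_GNS y e0.
exists N => n /HN; congr (_ < _); apply/esym/smooth_normE.
have := diag_rel_htrunc2 q_gt0 SU2 h_Haar t_irreps L2_GNS n xy.
move=> /(fun H => diag_relZD L2_GNS (-1) xy H).
by rewrite !scaleN1r addrC [- y + _]addrC.
Qed.

(** For every alpha the vectors |D|^alpha s_n converge in L^2; since |D|^alpha is closed, their
    limit is its value at the L^2 limit of s_n, which is the case alpha = 0. *)
Lemma smooth_complete (s : nat -> L2) : (forall n, E (s n)) ->
  (forall al, 0 <= al -> forall e, 0 < e -> exists N, forall m n, (N <= m)%N -> (N <= n)%N ->
     p al (s m - s n) < e) ->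
  exists2 x, E x & forall al, 0 <= al -> forall e, 0 < e ->
    exists N, forall n, (N <= n)%N -> p al (s n - x) < e.
Proof.
move=> Es sc.
have H al : 0 <= al -> exists2 Y : nat -> L2, (forall n, rel al (s n) (Y n)) & nr_cauchy Y.
  move=> al0; have [Y HY] := choice (fun n => (smoothP (s n)).1 (Es n) al al0).
  exists Y => // e e0; have [N HN] := sc al al0 e e0; exists N => m n Nm Nn.
  apply: le_lt_trans (HN m n Nm Nn); rewrite le_eqVlt; apply/orP; left; apply/eqP/esym.
  apply: smooth_normE; have := diag_relZD L2_GNS (-1) (HY n) (HY m).
  by rewrite !scaleN1r addrC [- Y n + _]addrC.
have [x xs] : exists x, nr_cvg s x.
  apply: nr_complete => e e0; have [N HN] := sc 0 (lexx 0) e e0.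
  by exists N => m n Nm Nn; rewrite -smooth_norm0; exact: HN.
have xE al : 0 <= al -> exists2 y, rel al x y & forall e, 0 < e ->
    exists N, forall n, (N <= n)%N -> p al (s n - x) < e.
  move=> al0; have [Y HY Yc] := H al al0; have [y Yy] := nr_complete Yc.
  have xy : rel al x y.
    apply: (diag_rel_closed L2_GNS) => e e0.
    have [N1 HN1] := xs e e0; have [N2 HN2] := Yy e e0.
    exists (s (maxn N1 N2)), (Y (maxn N1 N2)); split; first exact: HY.
      by apply: HN1; rewrite leq_maxl.
    by apply: HN2; rewrite leq_maxr.
  exists y => // e e0; have [N HN] := Yy e e0; exists N => n /HN; congr (_ < _).
  apply/esym/smooth_normE; have := diag_relZD L2_GNS (-1) xy (HY n).
  by rewrite !scaleN1r addrC [- y + _]addrC.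
exists x; first by apply/smoothP => al /xE[y xy _]; exists y.
by move=> al /xE[].
Qed.

Lemma smooth_norm_sum al I (r : seq I) (P : pred I) F : 0 <= al ->
  (forall i, P i -> E (F i)) ->
  p al (\sum_(i <- r | P i) F i) <= \sum_(i <- r | P i) p al (F i).
Proof.
move=> al0 H; suff [] : E (\sum_(i <- r | P i) F i) /\
  p al (\sum_(i <- r | P i) F i) <= \sum_(i <- r | P i) p al (F i) by [].
elim/big_rec2: _ => [|i y x Pi [Ex xy]].
  by rewrite (smooth_normE (diag_rel0 t L2_GNS (@pow_eig R q al))) nr0; split=> //; exact: smooth0.
split; first by rewrite -[F i]scale1r; apply: smoothZD => //; exact: H.
by apply: le_trans (smooth_normD al0 _ Ex) _; [exact: H|rewrite lerD2l].
Qed.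

Lemma smooth_norm_t al k (i j : 'I_k.+1) : p al (Lam (t k i j)) = (qint q k.+1 `^ al) * nr (Lam (t k i j)).
Proof.
rewrite (smooth_normE (diag_rel_t q_gt0 SU2 h_Haar t_irreps L2_GNS (@pow_eig R q al) i j)).
by rewrite nrZ nr_real // powR_ge0.
Qed.

Lemma Lam_inj f : Lam f = 0 -> f = 0.
Proof.
move=> H; have [N <-] := filt_ex q_gt0 SU2 h_Haar t_irreps f.
by rewrite -(htrunc_Lam t L2_GNS) H (htrunc0 t L2_GNS).
Qed.


Lemma nr_tcoef_le k (i j : 'I_k.+1) x : nr (tcoef star h t i j x) * nr (Lam (t k i j)) <= nr (Lam x).
Proof.
have F0 := haar_norm_gt0 q_gt0 k i.
rewrite /tcoef nrM nrV (nr_real (ltW F0)) -(ip_Lam L2_GNS) mulrAC ler_pdivrMr //.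
rewrite -(nr_t q_gt0 SU2 h_Haar t_irreps L2_GNS i j) expr2 mulrA; apply: ler_wpM2r; first exact: nr_ge0.
by rewrite mulrC; apply: le_trans (cauchy_schwarz L2_GNS _ _) _; rewrite mulrC.
Qed.

Lemma sqr_natS_le k : (k.+1%:R ^+ 2 : R) <= 4 ^+ k.
Proof.
have -> : (4 : R) ^+ k = (2 ^+ k) ^+ 2 by rewrite -exprM mulnC exprM -[2 ^+ 2]natrX.
by rewrite ler_pXn2r ?nnegrE // -natrX ler_nat ltn_expl.
Qed.

Lemma smooth_norm_weval al : 0 <= al -> exists2 r : R, 0 <= r &
  forall w, p al (Lam (weval q w)) <= r ^+ size w.
Proof.
move=> al0; have Q1 := qmax_gt1 q_gt0 q_neq1.
have Q0 : 0 < qmax q by exact: lt_trans Q1.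
pose s := (qmax q + 1) `^ al.
have s1 : 1 <= s.
  have : 1 `^ al <= s by rewrite ge0_ler_powR ?nnegrE ?addr_ge0 ?lerDr // ltW.
  by rewrite powR1.
have s0 : 0 <= s by exact: le_trans s1.
have qs k : qint q k.+1 `^ al <= s ^+ k.
  have Qk : 0 <= (qmax q + 1) ^+ k by rewrite exprn_ge0 // addr_ge0 // ltW.
  apply: (@le_trans _ _ (((qmax q + 1) ^+ k) `^ al)).
    rewrite ge0_ler_powR ?nnegrE //; first by rewrite ltW // qint_gt0.
    by rewrite -qint_qmax; exact: qint_le.
  have q0 : 0 <= qmax q + 1 by rewrite addr_ge0 // ltW.
  by rewrite -(powR_mulrn k s0) -(powR_mulrn k q0) powRAC.
(* Each of the (k+1)^2 <= 4^k components of degree k contributes at most [k+1]^al <= s^k, because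
   its L^2 norm is bounded by that of the word, hence by 1. There are n+1 <= 2^n degrees, and 8 = 2
   * 4. *)
exists (8 * s); first by rewrite mulr_ge0.
move=> w; have /(_ w) <- := filt_weval q_gt0 SU2 h_Haar t_irreps.
set n := size w; rewrite /tproj linear_sum.
apply: le_trans (smooth_norm_sum _ al0 _) _.
  by move=> k _; exact: smooth_Lam.
apply: le_trans (_ : \sum_(k < n.+1) (4 * s) ^+ n <= _).
  apply: ler_sum => k _; have kn : (k <= n)%N by rewrite -ltnS.
  apply: le_trans (_ : \sum_(i < k.+1) \sum_(j < k.+1) s ^+ k <= _).
    rewrite linear_sum; apply: le_trans (smooth_norm_sum _ al0 _) _.
      by move=> i _; exact: smooth_Lam.
    apply: ler_sum => i _; rewrite linear_sum; apply: le_trans (smooth_norm_sum _ al0 _) _.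
      by move=> j _; exact: smooth_Lam.
    apply: ler_sum => j _; rewrite linearZ smooth_normZ //; last exact: smooth_Lam.
    rewrite smooth_norm_t mulrCA -[leRHS]mulr1.
    apply: ler_pM => //; first exact: powR_ge0.
      by rewrite mulr_ge0 ?nr_ge0.
    by apply: le_trans (nr_tcoef_le _ _ _) _; exact: (nr_weval SU2 h_Haar L2_GNS).
  rewrite !sumr_const card_ord -mulrnA -[leLHS]mulr_natl exprMn.
  apply: ler_pM; rewrite ?exprn_ge0 ?ler_weXn2l //.
  by rewrite natrM -expr2 (le_trans (sqr_natS_le _)) // ler_weXn2l // ler1n.
rewrite sumr_const card_ord -[leLHS]mulr_natl (_ : 8 * s = 2 * (4 * s)).
  rewrite [leRHS]exprMn ler_wpM2r ?exprn_ge0 ?mulr_ge0 //.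
  by rewrite -natrX ler_nat ltn_expl.
by rewrite mulrA -natrM.
Qed.

Lemma smooth_norm_wbound al : 0 <= al -> exists2 r : R, 0 <= r &
  forall f B, wbound r f B -> p al (Lam f) <= B.
Proof.
move=> al0; have [r r0 Hr] := smooth_norm_weval al0; exists r => // f B [l <- lB].
apply: le_trans lB; rewrite /wsum linear_sum.
apply: le_trans (smooth_norm_sum _ al0 _) _; first by move=> x _; exact: smooth_Lam.
apply: ler_sum => x _; rewrite linearZ smooth_normZ //; last exact: smooth_Lam.
by apply: ler_wpM2l => //; exact: nr_ge0.
Qed.

(** By the Bernoulli inequality. *)
Lemma expr_unbounded (x K : R) : 1 < x -> exists b : nat, K <= x ^+ b.
Proof.
move=> x1; have d0 : 0 < x - 1 by rewrite subr_gt0.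
have H b : 1 + b%:R * (x - 1) <= x ^+ b.
  elim: b => [|b IH]; first by rewrite mul0r addr0.
  rewrite exprS; have := ler_wpM2l (ltW (lt_trans ltr01 x1)) IH; apply: le_trans.
  rewrite -natr1; have b0 : 0 <= b%:R * (x - 1) ^+ 2 by rewrite mulr_ge0 // sqr_ge0.
  by rewrite expr2 in b0; nra.
have [b Hb] : exists b : nat, `|K / (x - 1)| <= b%:R.
  by exists (Num.bound `|K / (x - 1)|); apply/ltW/archi_boundP.
exists b; apply: le_trans (H b).
have : K / (x - 1) <= b%:R by exact: le_trans (ler_norm _) Hb.
by rewrite ler_pdivrMr // => Kb; apply: le_trans Kb _; rewrite lerDr.
Qed.

Lemma wbound_smooth_norm r : 0 <= r -> exists2 be : R, 0 <= be &
  forall f, wbound r f (2 * p be (Lam f)).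
Proof.
move=> r0; have Q1 := qmax_gt1 q_gt0 q_neq1.
have Q0 : 0 < qmax q by exact: lt_trans Q1.
pose T := 2 * qmax q ^+ 2.
have T0 : 0 <= T by rewrite mulr_ge0 // exprn_ge0 // ltW.
(* With y = |D|^b f, the degree k part of f has (k+1)^2 <= 4^k entries, coefficients of size at most
   ||y|| (T / qmax^b)^k, and word norms (4 r)^k. This b makes its contribution at most ||y|| 2^-k;
   the geometric series gives the factor 2 in the statement. *)
have [b Hb] := expr_unbounded (2 * (4 * T * (4 * r))) Q1.
exists b%:R => // f; have [y fy] := rel_Lam b%:R f; rewrite (smooth_normE fy).
have [N fN] := filt_ex q_gt0 SU2 h_Haar t_irreps f.
have coef k (i j : 'I_k.+1) : nr (tcoef star h t i j f) <= nr y * ((T / qmax q ^+ b) ^+ k).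
  have F0 := haar_norm_gt0 q_gt0 k i.
  have qk : 0 < qint q k.+1 by exact: qint_gt0.
  (* The coefficient is read off from y and divided by the eigenvalue [k+1]^b, which is the source
     of the decay in k. *)
  have E1 : h (star (t k i j) * f) = ip (Lam (t k i j)) y / (qint q k.+1 ^+ b)%:C :> C.
    rewrite -(ip_Lam L2_GNS) fy /pow_eig powR_mulrn ?(ltW qk) // mulrC mulrA mulVf ?mul1r //.
    by rewrite real_complex_eq0 expf_neq0 // gt_eqF.
  rewrite /tcoef E1 !nrM !nrV (nr_real (ltW F0)) nr_real ?exprn_ge0 ?(ltW qk) //.
  rewrite -mulrA; apply: ler_pM; rewrite ?nr_ge0 ?mulr_ge0 ?invr_ge0 ?exprn_ge0 ?(ltW F0) ?(ltW qk) //.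
    apply: le_trans (cauchy_schwarz L2_GNS _ _) _; rewrite ler_piMl ?nr_ge0 //.
    exact: (nr_t_le1 q_gt0 SU2 h_Haar t_irreps L2_GNS).
  rewrite [leRHS]exprMn mulrC; apply: ler_pM; rewrite ?invr_ge0 ?exprn_ge0 ?(ltW F0) ?(ltW qk) //.
    exact: haar_norm_inv_le.
  rewrite exprVn -exprM mulnC exprM lef_pV2 ?posrE ?exprn_gt0 //.
  apply: lerXn2r; rewrite ?nnegrE ?exprn_ge0 ?(ltW Q0) ?(ltW qk) //.
  by rewrite -qint_qmax qint_ge.
rewrite -fN; apply: (@wbound_le _ _ _ _
  (\sum_(k < N.+1) \sum_(i < k.+1) \sum_(j < k.+1)
     (nr y * ((T / qmax q ^+ b) ^+ k) * (4 * r) ^+ k))); last first.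
  apply: wbound_sum => k _; apply: wbound_sum => i _; apply: wbound_sum => j _.
  apply: wbound_le (_ : nr (tcoef star h t i j f) * (4 * r) ^+ k <= _) _.
    by apply: ler_wpM2r => //; rewrite exprn_ge0 // mulr_ge0.
  apply: wboundZ => //; exact: (wbound_t q_gt0 SU2 h_Haar t_irreps (h_conj L2_GNS)).
apply: le_trans (_ : \sum_(k < N.+1) nr y * (2^-1) ^+ k <= _).
  apply: ler_sum => k _; rewrite !sumr_const card_ord -mulrnA -[leLHS]mulr_natl -mulrA mulrCA.
  apply: ler_wpM2l; first exact: nr_ge0.
  apply: le_trans (_ : (4 * (T / qmax q ^+ b * (4 * r))) ^+ k <= _).
    rewrite [leRHS]exprMn [X in _ <= _ * X]exprMn; apply: ler_wpM2r.
      by rewrite mulr_ge0 // exprn_ge0 // mulr_ge0 // invr_ge0 exprn_ge0 // ltW.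
    by rewrite natrM -expr2 sqr_natS_le.
  have Qb : 0 < qmax q ^+ b by rewrite exprn_gt0.
  apply: lerXn2r; rewrite ?nnegrE ?invr_ge0 //; last 1 first.
    rewrite (_ : 4 * _ = 4 * T * (4 * r) / qmax q ^+ b); last by ring.
    by rewrite ler_pdivrMr //; move: Hb; lra.
  have TQ : 0 <= T / qmax q ^+ b by rewrite divr_ge0 // ltW.
  by rewrite mulr_ge0 // mulr_ge0 // mulr_ge0.
rewrite -mulr_sumr mulrC; apply: ler_wpM2r; first exact: nr_ge0.
suff -> : \sum_(k < N.+1) (2^-1) ^+ k = 2 - (2^-1) ^+ N :> R.
  by rewrite gerBl exprn_ge0 // invr_ge0.
elim: (N) => [|n IH]; first by rewrite big_ord1 !expr0; lra.
by rewrite big_ord_recr IH /= exprS; field.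
Qed.

End SmoothDomain.

(** * Algebra structures on a subspace *)

Record algebra_on (K : fieldType) (H : lmodType K) (E : set H) := AlgebraOn {
  ao_mul : H -> H -> H;
  ao_one : H;
  ao_mem0 : E 0;
  ao_memZD : forall k x y, E x -> E y -> E (k *: x + y);
  ao_mem1 : E ao_one;
  ao_memM : forall x y, E x -> E y -> E (ao_mul x y);
  ao_one_neq0 : ao_one <> 0;
  ao_mulA : forall x y z, E x -> E y -> E z ->
    ao_mul x (ao_mul y z) = ao_mul (ao_mul x y) z;
  ao_mul1l : forall x, E x -> ao_mul ao_one x = x;
  ao_mul1r : forall x, E x -> ao_mul x ao_one = x;
  ao_mulZDl : forall k x y z, E x -> E y -> E z ->
    ao_mul (k *: x + y) z = k *: ao_mul x z + ao_mul y z;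
  ao_mulZDr : forall k x y z, E x -> E y -> E z ->
    ao_mul x (k *: y + z) = k *: ao_mul x y + ao_mul x z
}.

(** The extended product is a total operation on H that is meaningful only on E. The laws are
    therefore stated relative to E, and the index S selects the product that the subtype
    receives. *)
Definition ao_type (K : fieldType) (H : lmodType K) (E : set H)
  (S : algebra_on E) := {x : H | x \in E}.

Section AlgebraOnType.
Variables (K : fieldType) (H : lmodType K) (E : set H) (S : algebra_on E).
Local Notation T := (ao_type S).

HB.instance Definition _ := Choice.on T.

Let ao_val (x : T) : H := val x.
Let TE (x : T) : E (ao_val x). Proof. by apply: set_mem; exact: valP. Qed.
Let mk x (Ex : E x) : T := exist _ x (mem_set Ex).
Let ED x y : E x -> E y -> E (x + y).
Proof. by move=> Ex Ey; rewrite -[x]scale1r; exact: (ao_memZD S). Qed.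
Let EZ k x : E x -> E (k *: x).
Proof. by move=> Ex; rewrite -[_ *: _]addr0; apply: (ao_memZD S) => //; exact: (ao_mem0 S). Qed.

Let add (x y : T) : T := mk (ED (TE x) (TE y)).
Let scl k (x : T) : T := mk (EZ k (TE x)).
Let zero : T := mk (ao_mem0 S).
Let un : T := mk (ao_mem1 S).
Let mulT (x y : T) : T := mk (ao_memM S (TE x) (TE y)).

Let addA : associative add. Proof. by move=> x y z; apply: val_inj; exact: addrA. Qed.
Let addC : commutative add. Proof. by move=> x y; apply: val_inj; exact: addrC. Qed.
Let add0 : left_id zero add. Proof. by move=> x; apply: val_inj; exact: add0r. Qed.
Let addN : left_inverse zero (scl (-1)) add.
Proof.
move=> x; apply: val_inj; have H0 : -1 *: ao_val x + ao_val x = 0 by rewrite scaleN1r addNr.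
exact: H0.
Qed.
HB.instance Definition _ := GRing.isZmodule.Build T addA addC add0 addN.

Let tA : associative mulT.
Proof. by move=> x y z; apply: val_inj; apply: (ao_mulA S); exact: TE. Qed.
Let t1l : left_id un mulT.
Proof. by move=> x; apply: val_inj; exact: (ao_mul1l S). Qed.
Let t1r : right_id un mulT.
Proof. by move=> x; apply: val_inj; exact: (ao_mul1r S). Qed.
Let tDl : left_distributive mulT add.
Proof.
move=> x y z; apply: val_inj.
have := ao_mulZDl S 1 (TE x) (TE y) (TE z); rewrite !scale1r; exact.
Qed.
Let tDr : right_distributive mulT add.
Proof.
move=> x y z; apply: val_inj.
have := ao_mulZDr S 1 (TE x) (TE y) (TE z); rewrite !scale1r; exact.
Qed.
Let un0 : un != 0.
Proof. by apply/eqP => /(congr1 ao_val); exact: (ao_one_neq0 (a := S)). Qed.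
HB.instance Definition _ := GRing.Zmodule_isNzRing.Build T tA t1l t1r tDl tDr un0.

Let sA k l x : scl k (scl l x) = scl (k * l) x.
Proof. by apply: val_inj; exact: scalerA. Qed.
Let s1 : left_id 1 scl. Proof. by move=> x; apply: val_inj; exact: scale1r. Qed.
Let sDr : right_distributive scl add.
Proof. by move=> k x y; apply: val_inj; exact: scalerDr. Qed.
Let sDl x : {morph scl^~ x : k l / k + l >-> add k l}.
Proof. by move=> k l; apply: val_inj; exact: scalerDl. Qed.
HB.instance Definition _ := GRing.Zmodule_isLmodule.Build K T sA s1 sDr sDl.

Let mul0x y : E y -> ao_mul S 0 y = 0.
Proof.
move=> Ey; have /= E00 := ao_mulZDl S 1 (ao_mem0 S) (ao_mem0 S) Ey.
by apply: (addrI (ao_mul S 0 y)); rewrite addr0 -[X in X + _]scale1r -E00 scale1r add0r.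
Qed.
Let mulx0 y : E y -> ao_mul S y 0 = 0.
Proof.
move=> Ey; have /= E00 := ao_mulZDr S 1 Ey (ao_mem0 S) (ao_mem0 S).
by apply: (addrI (ao_mul S y 0)); rewrite addr0 -[X in X + _]scale1r -E00 scale1r add0r.
Qed.

Let sAl (k : K) (x y : T) : scl k (mulT x y) = mulT (scl k x) y.
Proof.
apply: val_inj; have := ao_mulZDl S k (TE x) (ao_mem0 S) (TE y).
by rewrite mul0x ?addr0; [move=> H0; exact/esym/H0|exact: TE].
Qed.
HB.instance Definition _ := GRing.Lmodule_isLalgebra.Build K T sAl.
Let sAr (k : K) (x y : T) : scl k (mulT x y) = mulT x (scl k y).
Proof.
apply: val_inj; have := ao_mulZDr S k (TE x) (TE y) (ao_mem0 S).
by rewrite mulx0 ?addr0; [move=> H0; exact/esym/H0|exact: TE].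
Qed.
HB.instance Definition _ := GRing.Lalgebra_isAlgebra.Build K T sAr.

Definition ao_incl (x : T) : H := val x.
Let ao_incl_linear : linear ao_incl. Proof. by []. Qed.
HB.instance Definition _ := GRing.isLinear.Build K T H *:%R ao_incl ao_incl_linear.

Lemma ao_incl_inj : injective ao_incl. Proof. exact: val_inj. Qed.
Lemma ao_incl_mem x : E (ao_incl x). Proof. exact: TE. Qed.
Lemma ao_incl_onto x : E x -> exists b, ao_incl b = x.
Proof. by move=> Ex; exists (mk Ex). Qed.
Lemma range_ao_incl : range ao_incl = E.
Proof.
apply/seteqP; split=> [_ [x _ <-]|x Ex]; first exact: TE.
by exists (mk Ex).
Qed.
Lemma ao_inclM x y : ao_incl (x * y) = ao_mul S (ao_incl x) (ao_incl y).
Proof. by []. Qed.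
End AlgebraOnType.

(** * Extension of tame bilinear maps *)

Section Extension.
Variables (R : realType) (A H : lmodType R[i]) (Lam : {linear A -> H}).
Local Notation C := R[i].
Variables (E : set H) (p : R -> H -> R).
Hypotheses (E0 : E 0) (EZD : forall k x y, E x -> E y -> E (k *: x + y)).
Hypothesis ELam : forall f, E (Lam f).
Hypothesis p_ge0 : forall al x, 0 <= p al x.
Hypothesis pD : forall al x y, 0 <= al -> E x -> E y -> p al (x + y) <= p al x + p al y.
Hypothesis pZ : forall al k x, 0 <= al -> E x -> p al (k *: x) = nr k * p al x.
Hypothesis p_sep : forall x, E x -> p 0 x = 0 -> x = 0.

Definition fr_cvg (s : nat -> H) (x : H) := forall al, 0 <= al -> forall e, 0 < e ->
  exists N, forall n, (N <= n)%N -> p al (s n - x) < e.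

Hypothesis approx : forall x, E x -> exists s : nat -> A, fr_cvg (fun n => Lam (s n)) x.
Hypothesis complete : forall s : nat -> H, (forall n, E (s n)) ->
  (forall al, 0 <= al -> forall e, 0 < e -> exists N, forall m n, (N <= m)%N -> (N <= n)%N ->
     p al (s m - s n) < e) ->
  exists2 x, E x & fr_cvg s x.

Lemma EB x y : E x -> E y -> E (x - y).
Proof. by move=> Ex Ey; rewrite addrC -scaleN1r; exact: EZD. Qed.
Lemma EZ k x : E x -> E (k *: x).
Proof. by move=> Ex; rewrite -[_ *: _]addr0; exact: EZD. Qed.
Lemma ED x y : E x -> E y -> E (x + y).
Proof. by move=> Ex Ey; rewrite -[x]scale1r; exact: EZD. Qed.

Lemma pB al x y : 0 <= al -> E x -> E y -> p al (x - y) = p al (y - x).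
Proof.
move=> al0 Ex Ey; have -> : x - y = (-1) *: (y - x) by rewrite scaleN1r opprB.
rewrite pZ //; last exact: EB.
by rewrite nrN nr1 mul1r.
Qed.

Lemma p_tri al x y z : 0 <= al -> E x -> E y -> E z ->
  p al (x - z) <= p al (x - y) + p al (y - z).
Proof.
move=> al0 Ex Ey Ez; have -> : x - z = (x - y) + (y - z) by rewrite subrKA.
by apply: pD => //; exact: EB.
Qed.

Lemma p_le al x y : 0 <= al -> E x -> E y -> p al x <= p al (x - y) + p al y.
Proof. by move=> al0 Ex Ey; rewrite -{1}[x](subrK y); apply: pD => //; exact: EB. Qed.

Lemma fr_cvg_uniq s x y : (forall n, E (s n)) -> E x -> E y -> fr_cvg s x -> fr_cvg s y -> x = y.
Proof.
move=> Es Ex Ey sx sy; apply/eqP; rewrite -subr_eq0; apply/eqP/p_sep; first exact: EB.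
apply/le_anti; rewrite p_ge0 andbT; apply/ler_addgt0Pr => e e0; rewrite add0r.
have e2 : 0 < e / 2 by rewrite divr_gt0.
have [N HN] := sx 0 (lexx 0) _ e2; have [M HM] := sy 0 (lexx 0) _ e2.
pose n := maxn N M; apply: le_trans (p_tri (lexx 0) Ex (Es n) Ey) _.
have h1 := HN n (leq_maxl _ _); have h2 := HM n (leq_maxr _ _).
rewrite pB //; lra.
Qed.

Lemma fr_cvgZD k s x s' x' : (forall n, E (s n)) -> (forall n, E (s' n)) -> E x -> E x' ->
  fr_cvg s x -> fr_cvg s' x' -> fr_cvg (fun n => k *: s n + s' n) (k *: x + x').
Proof.
move=> Es Es' Ex Ex' sx sx' al al0 e e0.
have e1 : 0 < e / 2 / (nr k + 1) by rewrite !divr_gt0 // ltr_wpDl ?nr_ge0.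
have e2 : 0 < e / 2 by rewrite divr_gt0.
have [N HN] := sx al al0 _ e1; have [M HM] := sx' al al0 _ e2.
exists (maxn N M) => n; rewrite geq_max => /andP[/HN h1 /HM h2].
have -> : k *: s n + s' n - (k *: x + x') = k *: (s n - x) + (s' n - x').
  by rewrite scalerBr opprD addrACA.
apply: le_lt_trans (pD al0 (EZ _ (EB (Es n) Ex)) (EB (Es' n) Ex')) _.
rewrite pZ //; last exact: EB.
have k0 := nr_ge0 k.
have : nr k * p al (s n - x) <= (nr k + 1) * (e / 2 / (nr k + 1)).
  by apply: ler_pM; rewrite ?p_ge0 ?lerDl // ltW.
rewrite [X in _ <= X]mulrC divfK; last by rewrite gt_eqF // ltr_wpDl.
lra.
Qed.

Lemma fr_cvg_ext s s' x : (forall n, s n = s' n) -> fr_cvg s x -> fr_cvg s' x.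
Proof. by move=> /funext ->. Qed.

Lemma fr_cvg_cst x : E x -> fr_cvg (fun=> x) x.
Proof.
move=> Ex al al0 e e0; exists 0%N => n _; rewrite subrr -(scale0r x) pZ // nr0 mul0r //.
Qed.

(** Joint continuity of the bilinear map b for the seminorms; both arguments may share one exponent
    be. *)
Definition tame2 (b : A -> A -> A) := forall al, 0 <= al -> exists be K, [/\ 0 <= be, 0 <= K &
  forall f g, p al (Lam (b f g)) <= K * (p be (Lam f) * p be (Lam g))].

Section Bilinear.
Variable b : A -> A -> A.
Hypothesis bl : forall k f f' g, b (k *: f + f') g = k *: b f g + b f' g.
Hypothesis br : forall k f g g', b f (k *: g + g') = k *: b f g + b f g'.
Hypothesis bt : tame2 b.

(** Uniform continuity near (x, y), from b(f,g) - b(f',g') = b(f-f',g) + b(f',g-g'). It yields both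
    the Cauchy property of b(s_n, r_n) and the independence of its limit from the sequences. *)
Lemma tame2_lipschitz x y al : E x -> E y -> 0 <= al -> forall e, 0 < e ->
  exists be d, [/\ 0 <= be, 0 < d & forall f f' g g',
    p be (Lam f - x) < d -> p be (Lam f' - x) < d ->
    p be (Lam g - y) < d -> p be (Lam g' - y) < d ->
    p al (Lam (b f g) - Lam (b f' g')) < e].
Proof.
move=> Ex Ey al0 e e0; have [be [K [be0 K0 HK]]] := bt al0.
pose X := p be x + 1; pose Y := p be y + 1.
have X0 : 0 < X by rewrite ltr_wpDl ?p_ge0.
have Y0 : 0 < Y by rewrite ltr_wpDl ?p_ge0.
(* Being within e / M of x and y, the differences f - f' and g - g' have seminorm at most 2 e / M,
   so the two terms sum to at most (e / M) (M - 1) < e. Being within 1 of x and y keeps f' below X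
   and g below Y. *)
pose M := 2 * K * (X + Y) + 1.
have M0 : 0 < M by rewrite ltr_wpDl // !mulr_ge0 // addr_ge0 // ltW.
exists be, (Num.min 1 (e / M)); split=> //; first by rewrite lt_min ltr01 divr_gt0.
move=> f f' g g'; rewrite !lt_min => /andP[f1 fe] /andP[f'1 f'e] /andP[g1 ge] /andP[g'1 g'e].
have bE : Lam (b f g) - Lam (b f' g') = Lam (b (f - f') g) + Lam (b f' (g - g')).
  have -> : f - f' = (-1) *: f' + f by rewrite scaleN1r addrC.
  have -> : g - g' = (-1) *: g' + g by rewrite scaleN1r addrC.
  rewrite bl br !linearD !linearZ /= !scaleN1r.
  by rewrite [- _ + Lam (b f g)]addrC addrACA addNr addr0.
have HL z d1 d2 : E z -> p be (Lam d1 - z) < e / M -> p be (Lam d2 - z) < e / M ->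
    p be (Lam (d1 - d2)) <= 2 * (e / M).
  move=> Ez h1 h2; rewrite linearB /=; apply: le_trans (p_tri be0 (ELam _) Ez (ELam _)) _.
  rewrite [X in _ + X]pB //; lra.
have gY : p be (Lam g) <= Y.
  apply: le_trans (p_le be0 (ELam g) Ey) _; rewrite /Y; lra.
have f'X : p be (Lam f') <= X.
  apply: le_trans (p_le be0 (ELam f') Ex) _; rewrite /X; lra.
rewrite bE; apply: le_lt_trans (pD al0 (ELam _) (ELam _)) _.
have h1 : p al (Lam (b (f - f') g)) <= K * (2 * (e / M) * Y).
  apply: le_trans (HK _ _) _; apply: ler_wpM2l => //; apply: ler_pM => //; exact: HL Ex _ _.
have h2 : p al (Lam (b f' (g - g'))) <= K * (X * (2 * (e / M))).
  apply: le_trans (HK _ _) _; apply: ler_wpM2l => //; apply: ler_pM => //; exact: HL Ey _ _.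
apply: le_lt_trans (lerD h1 h2) _.
have -> : K * (2 * (e / M) * Y) + K * (X * (2 * (e / M))) = (e / M) * (M - 1).
  by rewrite /M addrK; ring.
rewrite mulrBr mulr1 divfK ?gt_eqF // ltrBlDr ltrDl divr_gt0 //.
Qed.

(* [xget] never returns its default value on E * E, see [ext2P]. *)
Definition ext2 (x y : H) : H := xget 0 [set z | E z /\ forall (s r : nat -> A),
   fr_cvg (fun n => Lam (s n)) x -> fr_cvg (fun n => Lam (r n)) y ->
   fr_cvg (fun n => Lam (b (s n) (r n))) z].

(** Some approximating sequences exist and completeness gives a limit for them; any other pair of
    sequences has the same limit. So the set in [ext2] is inhabited. *)
Lemma ext2P x y : E x -> E y -> E (ext2 x y) /\ forall (s r : nat -> A),
   fr_cvg (fun n => Lam (s n)) x -> fr_cvg (fun n => Lam (r n)) y ->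
   fr_cvg (fun n => Lam (b (s n) (r n))) (ext2 x y).
Proof.
move=> Ex Ey; rewrite /ext2; case: xgetP => [z _ //|none]; exfalso.
have [s sx] := approx Ex; have [r ry] := approx Ey.
have [z Ez sz] : exists2 z, E z & fr_cvg (fun n => Lam (b (s n) (r n))) z.
  apply: complete => [n|al al0 e e0]; first exact: ELam.
  have [be [d [be0 d0 Hd]]] := tame2_lipschitz Ex Ey al0 e0.
  have [N HN] := sx be be0 d d0; have [M HM] := ry be be0 d d0.
  exists (maxn N M) => m n; rewrite !geq_max => /andP[m1 m2] /andP[n1 n2].
  by apply: Hd; [exact: HN|exact: HN|exact: HM|exact: HM].
apply: (none z); split=> // s' r' s'x r'y al al0 e e0.
have e2 : 0 < e / 2 by rewrite divr_gt0.
have [be [d [be0 d0 Hd]]] := tame2_lipschitz Ex Ey al0 e2.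
have [N HN] := sx be be0 d d0; have [M HM] := ry be be0 d d0.
have [N' HN'] := s'x be be0 d d0; have [M' HM'] := r'y be be0 d d0.
have [L HL] := sz al al0 _ e2.
exists (maxn (maxn N M) (maxn (maxn N' M') L)) => n; rewrite !geq_max.
move=> /andP[/andP[n1 n2] /andP[/andP[n3 n4] n5]].
apply: le_lt_trans (p_tri al0 (ELam _) (ELam (b (s n) (r n))) Ez) _.
have h1 := HL n n5.
have h2 : p al (Lam (b (s' n) (r' n)) - Lam (b (s n) (r n))) < e / 2.
  by apply: Hd; [exact: HN'|exact: HN|exact: HM'|exact: HM].
lra.
Qed.

Lemma ext2_mem x y : E x -> E y -> E (ext2 x y).
Proof. by move=> Ex Ey; have [] := ext2P Ex Ey. Qed.

Lemma ext2_cvg x y s r : E x -> E y ->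
   fr_cvg (fun n => Lam (s n)) x -> fr_cvg (fun n => Lam (r n)) y ->
   fr_cvg (fun n => Lam (b (s n) (r n))) (ext2 x y).
Proof. by move=> Ex Ey; have [_] := ext2P Ex Ey; apply. Qed.

Lemma ext2_Lam f g : ext2 (Lam f) (Lam g) = Lam (b f g).
Proof.
apply: (@fr_cvg_uniq (fun=> Lam (b f g))) => //; last exact: fr_cvg_cst.
  exact: ext2_mem.
by apply: (@ext2_cvg _ _ (fun=> f) (fun=> g)) => //; exact: fr_cvg_cst.
Qed.

Lemma ext2l k x x' y : E x -> E x' -> E y -> ext2 (k *: x + x') y = k *: ext2 x y + ext2 x' y.
Proof.
move=> Ex Ex' Ey; have [s sx] := approx Ex; have [s' sx'] := approx Ex'.
have [r ry] := approx Ey.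
apply: (@fr_cvg_uniq (fun n => Lam (b (k *: s n + s' n) (r n)))) => //.
- by apply: ext2_mem => //; exact: EZD.
- by apply: EZD; exact: ext2_mem.
- apply: (@ext2_cvg _ _ (fun n => k *: s n + s' n)) => //; first exact: EZD.
  have := fr_cvgZD k (fun n => ELam (s n)) (fun n => ELam (s' n)) Ex Ex' sx sx'.
  by apply: fr_cvg_ext => n; rewrite linearD linearZ.
- have := fr_cvgZD k (fun n => ELam (b (s n) (r n))) (fun n => ELam (b (s' n) (r n)))
     (ext2_mem Ex Ey) (ext2_mem Ex' Ey) (ext2_cvg Ex Ey sx ry) (ext2_cvg Ex' Ey sx' ry).
  by apply: fr_cvg_ext => n; rewrite bl linearD linearZ.
Qed.

Lemma ext2r k x y y' : E x -> E y -> E y' -> ext2 x (k *: y + y') = k *: ext2 x y + ext2 x y'.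
Proof.
move=> Ex Ey Ey'; have [s sx] := approx Ex; have [r ry] := approx Ey.
have [r' ry'] := approx Ey'.
apply: (@fr_cvg_uniq (fun n => Lam (b (s n) (k *: r n + r' n)))) => //.
- by apply: ext2_mem => //; exact: EZD.
- by apply: EZD; exact: ext2_mem.
- apply: (@ext2_cvg _ _ s (fun n => k *: r n + r' n)) => //; first exact: EZD.
  have := fr_cvgZD k (fun n => ELam (r n)) (fun n => ELam (r' n)) Ey Ey' ry ry'.
  by apply: fr_cvg_ext => n; rewrite linearD linearZ.
- have := fr_cvgZD k (fun n => ELam (b (s n) (r n))) (fun n => ELam (b (s n) (r' n)))
     (ext2_mem Ex Ey) (ext2_mem Ex Ey') (ext2_cvg Ex Ey sx ry) (ext2_cvg Ex Ey' sx ry').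
  by apply: fr_cvg_ext => n; rewrite br linearD linearZ.
Qed.

Lemma ext2_tame al : 0 <= al -> exists be K, [/\ 0 <= be, 0 <= K &
  forall x y, E x -> E y -> p al (ext2 x y) <= K * (p be x * p be y)].
Proof.
move=> al0; have [be [K [be0 K0 HK]]] := bt al0; exists be, K; split=> // x y Ex Ey.
have [s sx] := approx Ex; have [r ry] := approx Ey; have sr := ext2_cvg Ex Ey sx ry.
apply/ler_addgt0Pr => e e0.
set X := p be x; set Y := p be y.
have X0 : 0 <= X by exact: p_ge0.
have Y0 : 0 <= Y by exact: p_ge0.
have M0 : 0 < K * (X + Y + 1) + 1 by rewrite ltr_wpDl // mulr_ge0 // addr_ge0 // addr_ge0.
(* As d <= 1, the product (X + d) (Y + d) exceeds X Y by at most d (X + Y + 1), and K times that is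
   at most e / 2. The other half of e pays for the distance to the limit. *)
pose d := Num.min 1 (e / 2 / (K * (X + Y + 1) + 1)).
have d0 : 0 < d by rewrite lt_min ltr01 !divr_gt0.
have d1 : d <= 1 by rewrite ge_min lexx.
have dM : d * (K * (X + Y + 1) + 1) <= e / 2.
  by rewrite -ler_pdivlMr // ge_min lexx orbT.
have e2 : 0 < e / 2 by rewrite divr_gt0.
clearbody d; have [N HN] := sx be be0 d d0; have [M HM] := ry be be0 d d0; have [L HL] := sr al al0 _ e2.
pose n := maxn N (maxn M L).
have h1 := HN n (leq_maxl _ _).
have h2 : p be (Lam (r n) - y) < d by apply: HM; rewrite /n !leq_max leqnn orbT.
have h3 : p al (Lam (b (s n) (r n)) - ext2 x y) < e / 2 by apply: HL; rewrite /n !leq_max leqnn !orbT.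
apply: le_trans (p_le al0 (ext2_mem Ex Ey) (ELam (b (s n) (r n)))) _.
rewrite pB //; last exact: ext2_mem.
have k1 : p be (Lam (s n)) <= X + d.
  by apply: le_trans (p_le be0 (ELam _) Ex) _; rewrite /X; lra.
have k2 : p be (Lam (r n)) <= Y + d.
  by apply: le_trans (p_le be0 (ELam _) Ey) _; rewrite /Y; lra.
have k3 : p al (Lam (b (s n) (r n))) <= K * ((X + d) * (Y + d)).
  by apply: le_trans (HK _ _) _; apply: ler_wpM2l => //; apply: ler_pM.
have k4 : K * ((X + d) * (Y + d)) <= K * (X * Y) + e / 2.
  have -> : K * ((X + d) * (Y + d)) = K * (X * Y) + K * (d * (X + Y + d)) by ring.
  rewrite lerD2l; apply: le_trans dM.
  have : K * (d * (X + Y + d)) <= K * (d * (X + Y + 1)).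
    by apply: ler_wpM2l => //; apply: ler_wpM2l; [exact: ltW|rewrite lerD2l].
  move=> /le_trans; apply.
  have -> : d * (K * (X + Y + 1) + 1) = K * (d * (X + Y + 1)) + d by ring.
  by rewrite lerDl ltW.
lra.
Qed.
End Bilinear.
End Extension.

Lemma wbound_anti (R : realType) (q r r' : R) (f : CqSU2 q) B : 0 <= r -> r <= r' ->
  wbound r' f B -> wbound r f B.
Proof.
move=> r0 rr' [l lf lB]; exists l => //; apply: le_trans lB.
apply: ler_sum => x _; apply: ler_wpM2l; first exact: nr_ge0.
by apply: lerXn2r => //; rewrite nnegrE // (le_trans r0).
Qed.

(** * Continuity for families of seminorms *)

Section SeminormContinuity.
Variables (R : realType) (V : zmodType) (p : R -> V -> R).

Lemma seminorm_continuous_bounded (T : V -> V) :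
  (forall x y, T (x - y) = T x - T y) ->
  (forall al, 0 <= al -> exists be K, [/\ 0 <= be, 0 <= K & forall x, p al (T x) <= K * p be x]) ->
  (forall al x, 0 <= p al x) ->
  seminorm_continuous p T.
Proof.
move=> TB HT p0 x U [s [e [e0 HU]]].
suff [s' [e' [e'0 He']]] : exists (s' : seq R) (e' : R), 0 < e' /\ forall y,
    (forall al, al \in s' -> 0 <= al -> p al (y - x) < e') ->
    forall al, al \in s -> 0 <= al -> p al (T y - T x) < e.
  by exists s', e'; split=> // y Hy; apply: HU; exact: He'.
elim: s {HU} => [|al s [s' [e' [e'0 IH]]]]; first by exists [::], 1; split.
(* Negative exponents may occur in the list of a neighbourhood but impose no condition. *)
have [al0|al0] := leP 0 al; last first.
  exists s', e'; split=> // y Hy b; rewrite inE => /predU1P[->|bs].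
    by rewrite leNgt al0.
  exact: IH.
have [be [K [be0 K0 HK]]] := HT al al0.
have K1 : 0 < K + 1 by rewrite ltr_wpDl.
exists (be :: s'), (Num.min e' (e / (K + 1))); split.
  by rewrite lt_min e'0 divr_gt0.
move=> y Hy b; rewrite inE => /predU1P[-> _|bs].
  rewrite -TB; apply: le_lt_trans (HK _) _.
  have := Hy be (mem_head _ _) be0; rewrite lt_min => /andP[_].
  rewrite ltr_pdivlMr // mulrDr mulr1 mulrC; apply: le_lt_trans.
  by rewrite lerDl.
apply: IH => // c cs c0; have := Hy c; rewrite inE cs orbT => /(_ isT c0).
by rewrite lt_min => /andP[].
Qed.
End SeminormContinuity.

Lemma seminorm_mul_continuous (R : realType) (B : nzRingType) (p : R -> B -> R) :
  (forall al x, 0 <= p al x) ->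
  (forall al x y, 0 <= al -> p al (x + y) <= p al x + p al y) ->
  (forall al, 0 <= al -> exists be K, [/\ 0 <= be, 0 <= K & forall x y, p al (x * y) <= K * (p be x * p be y)]) ->
  forall x y : B, (fun z : B * B => z.1 * z.2) @
    filter_prod (seminorm_nbhs p x) (seminorm_nbhs p y) `=>` seminorm_nbhs p (x * y).
Proof.
move=> p0 pD HM x y U [s [e [e0 HU]]].
suff [s' [e' [e'0 He']]] : exists (s' : seq R) (e' : R), 0 < e' /\ forall z w,
    (forall al, al \in s' -> 0 <= al -> p al (z - x) < e') ->
    (forall al, al \in s' -> 0 <= al -> p al (w - y) < e') ->
    forall al, al \in s -> 0 <= al -> p al (z * w - x * y) < e.
  exists ([set z | forall al, al \in s' -> 0 <= al -> p al (z - x) < e'],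
          [set w | forall al, al \in s' -> 0 <= al -> p al (w - y) < e']).
    by split; exists s', e'; split.
  by move=> [z w] [/= Hz Hw]; apply: HU; exact: He'.
elim: s {HU} => [|al s [s' [e' [e'0 IH]]]]; first by exists [::], 1; split.
have [al0|al0] := leP 0 al; last first.
  exists s', e'; split=> // z w Hz Hw b; rewrite inE => /predU1P[->|bs].
    by rewrite leNgt al0.
  exact: IH.
have [be [K [be0 K0 HK]]] := HM al al0.
set X := p be x; set Y := p be y.
have X0 : 0 <= X by exact: p0.
have Y0 : 0 <= Y by exact: p0.
have K1 : 0 < K * (X + Y + 1) + 1 by rewrite ltr_wpDl // mulr_ge0 // !addr_ge0.
(* By z w - x y = (z - x) (w - y) + x (w - y) + (z - x) y, distances below c <= 1 give an error of
   at most K c (X + Y + 1). The last summand 1 of the denominator makes it positive and the final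
   inequality strict. *)
pose c := Num.min 1 (e / (K * (X + Y + 1) + 1)).
have c0 : 0 < c by rewrite lt_min ltr01 divr_gt0.
have c1 : c <= 1 by rewrite ge_min lexx.
have cM : c * (K * (X + Y + 1) + 1) <= e by rewrite -ler_pdivlMr // ge_min lexx orbT.
exists (be :: s'), (Num.min e' c); split; first by rewrite lt_min e'0.
move=> z w Hz Hw b; rewrite inE => /predU1P[-> _|bs]; last first.
  apply: IH => // a as' a0.
    by have := Hz a; rewrite inE as' orbT => /(_ isT a0); rewrite lt_min => /andP[].
  by have := Hw a; rewrite inE as' orbT => /(_ isT a0); rewrite lt_min => /andP[].
have := Hz be (mem_head _ _) be0; rewrite lt_min => /andP[_ zx].
have := Hw be (mem_head _ _) be0; rewrite lt_min => /andP[_ wy].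
clearbody c.
have -> : z * w - x * y = (z - x) * (w - y) + (x * (w - y) + (z - x) * y).
  by rewrite addrA -mulrDl subrK mulrBr mulrBl subrKA.
have h1 := HK (z - x) (w - y); have h2 := HK x (w - y); have h3 := HK (z - x) y.
have k1 : p be (z - x) * p be (w - y) <= c * 1.
  by apply: ler_pM => //; [exact: ltW|apply: le_trans (ltW wy) _].
have k2 : X * p be (w - y) <= X * c by apply: ler_wpM2l => //; exact: ltW.
have k3 : p be (z - x) * Y <= c * Y by apply: ler_wpM2r => //; exact: ltW.
have k : K * (p be (z - x) * p be (w - y)) + (K * (X * p be (w - y)) + K * (p be (z - x) * Y))
    <= K * (c * (X + Y + 1)).
  rewrite -!mulrDr; apply: ler_wpM2l => //.
  have -> : c * (X + Y + 1) = c * 1 + (X * c + c * Y) by ring.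
  by rewrite !lerD.
apply: le_lt_trans (pD _ _ _ al0) _.
apply: le_lt_trans (lerD h1 (pD _ _ _ al0)) _.
apply: le_lt_trans (lerD (lexx _) (lerD h2 h3)) _.
apply: le_lt_trans k _; apply: lt_le_trans cM.
have -> : c * (K * (X + Y + 1) + 1) = K * (c * (X + Y + 1)) + c by ring.
by rewrite ltrDl.
Qed.

(** * The calculus on smooth functions *)

Section Calculus.
Variables (K : fieldType) (A : algType K) (n : nat).
Variables (ract : 'rV[A]_n -> A -> 'rV[A]_n) (d : A -> 'rV[A]_n).
Hypothesis fodc : is_fodc ract d.

(** Row i holds the coefficients of e_i f; the right module axioms say that this is a unital
    homomorphism. *)
Definition cmx (f : A) : 'M[A]_n := \matrix_(i, j) ccoef ract i j f.

Lemma ract0 g : ract 0 g = 0.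
Proof. by rewrite -[X in ract X](scale0r 0) (fodc_bimod fodc) scale0r. Qed.

Lemma ract_mx w g : ract w g = w *m cmx g.
Proof.
have rD : {morph ract^~ g : x y / x + y} by move=> x y; exact: (fodc_ractDl fodc).
rewrite {1}[w]matrix_sum_delta big_ord1 (big_morph _ rD (ract0 g)).
rewrite mulmx_sum_row; apply: eq_bigr => i _; rewrite (fodc_bimod fodc); congr (_ *: _).
by apply/rowP => j; rewrite !mxE.
Qed.

Lemma row_cmx i g : row i (cmx g) = ract (delta_mx 0 i) g.
Proof. by apply/rowP => j; rewrite !mxE. Qed.

Lemma cmx1 : cmx 1 = 1%:M.
Proof.
by apply/row_matrixP => i; rewrite row_cmx (fodc_ract1 fodc) row1.
Qed.

Lemma cmxM f g : cmx (f * g) = cmx f *m cmx g.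
Proof.
apply/row_matrixP => i.
by rewrite row_cmx (fodc_ractM fodc) row_mul row_cmx [LHS]ract_mx.
Qed.

Lemma cmx_linear i j : linear (fun f => cmx f i j).
Proof.
move=> k f g; rewrite !mxE /ccoef (fodc_ractDr fodc) mxE -[k *: f]mulr_algl.
rewrite (fodc_ractM fodc) (fodc_scalar fodc) (fodc_bimod fodc) mxE.
by rewrite mulr_algl.
Qed.

Lemma dcoef_linear i : linear (dcoef d i).
Proof. by move=> k f g; rewrite /dcoef (fodc_linear fodc) !mxE mulr_algl. Qed.

Lemma d1 : d 1 = 0.
Proof.
have := fodc_leibniz fodc 1 1; rewrite mulr1 (fodc_ract1 fodc) scale1r => /eqP.
by rewrite -subr_eq subrr => /eqP <-.
Qed.

Definition calculus_mx (f : A) : 'M[A]_(1 + n) := block_mx f%:M (d f) 0 (cmx f).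

Lemma calculus_mx1 : calculus_mx 1 = 1%:M.
Proof. by rewrite /calculus_mx d1 cmx1 -scalar_mx_block. Qed.

(** The upper right block is f dg + (df) C(g), which is the Leibniz rule. *)
Lemma calculus_mxM f g : calculus_mx (f * g) = calculus_mx f *m calculus_mx g.
Proof.
rewrite /calculus_mx mulmx_block !mul0mx !mulmx0 !addr0 add0r -cmxM -scalar_mxM.
by rewrite (fodc_leibniz fodc) mul_scalar_mx ract_mx addrC.
Qed.

Lemma calculus_mx_linear i j : linear (fun f => calculus_mx f i j).
Proof.
move=> k f g; rewrite -(splitK i) -(splitK j).
case: (fintype.split i) => a; case: (fintype.split j) => b /=.
- by rewrite /calculus_mx !block_mxEul !mxE !ord1 !mulr1n.
- by rewrite /calculus_mx !block_mxEur !ord1; exact: dcoef_linear.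
- by rewrite /calculus_mx !block_mxEdl !mxE scaler0 addr0.
- by rewrite /calculus_mx !block_mxEdr; exact: cmx_linear.
Qed.
End Calculus.

(** * The algebra of smooth elements and the extended calculus *)

Section SmoothAlgebra.
Variables (R : realType) (q : R) (q_gt0 : 0 < q) (q_neq1 : q != 1).
Local Notation A := (CqSU2 q).
Local Notation C := R[i].
Variables (star : A -> A) (Delta : {lrmorphism A -> tensor A}).
Hypothesis SU2 : is_SU2_structure star Delta.
Variable (h : {linear A -> C^o}).
Hypothesis h_Haar : is_Haar_state star Delta h.
Variable (t : forall k : nat, 'M[A]_k.+1).
Hypothesis t_irreps : is_SU2_irreps star Delta t.
Variables (L2 : completeNormedModType C) (ip : L2 -> L2 -> C) (Lam : {linear A -> L2}).
Hypothesis L2_GNS : is_GNS_space star h ip Lam.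
Variable sgn : forall k : nat, 'I_k.+1 -> 'I_k.+1 -> bool.
Local Notation D := (Dirac Lam t sgn).
Local Notation E := (smooth_domain D).
Local Notation p := (smooth_norm D).

Let E0 : E 0.
Proof. exact: (smooth0 q_gt0 q_neq1 SU2 h_Haar t_irreps L2_GNS). Qed.
Let EZD k x y : E x -> E y -> E (k *: x + y).
Proof. exact: (smoothZD q_gt0 q_neq1 SU2 h_Haar t_irreps L2_GNS). Qed.
Let ELam f : E (Lam f).
Proof. exact: (smooth_Lam q_gt0 q_neq1 SU2 h_Haar t_irreps L2_GNS). Qed.
Let p_ge0 al x : 0 <= p al x. Proof. exact: smooth_norm_ge0. Qed.
Let pD al x y : 0 <= al -> E x -> E y -> p al (x + y) <= p al x + p al y.
Proof. exact: (smooth_normD q_gt0 q_neq1 SU2 h_Haar t_irreps L2_GNS). Qed.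
Let pZ al k x : 0 <= al -> E x -> p al (k *: x) = nr k * p al x.
Proof. exact: (smooth_normZ q_gt0 q_neq1 SU2 h_Haar t_irreps L2_GNS). Qed.
Let p_sep x : E x -> p 0 x = 0 -> x = 0.
Proof.
by move=> _; rewrite (smooth_norm0 q_gt0 q_neq1 SU2 h_Haar t_irreps L2_GNS); exact: nr_eq0.
Qed.
Local Notation frcvg := (fr_cvg p).
Let approx x : E x -> exists s : nat -> A, frcvg (fun n => Lam (s n)) x.
Proof.
move=> Ex; exists (fun n => @htrunc R q t L2 ip Lam n x) => al al0.
exact: (smooth_trunc_cvg q_gt0 q_neq1 SU2 h_Haar t_irreps L2_GNS).
Qed.
Let complete (s : nat -> L2) : (forall n, E (s n)) ->
  (forall al, 0 <= al -> forall e, 0 < e -> exists N, forall m n, (N <= m)%N -> (N <= n)%N ->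
     p al (s m - s n) < e) ->
  exists2 x, E x & frcvg s x.
Proof. exact: (smooth_complete q_gt0 q_neq1 SU2 h_Haar t_irreps L2_GNS). Qed.

(** Continuity for the family of word norms, with constant 1 since the weight may be enlarged. *)
Definition tame (T : A -> A) := linear T /\ forall r : R, 0 <= r -> exists2 r', 0 <= r' &
  forall f B, wbound r' f B -> wbound r (T f) B.

(** One bilinear map serves two purposes: for T = id its extension is the product of smooth
    elements, and with second argument 1 it is the extension of T. *)
Definition tmul (T : A -> A) (f g : A) : A := T f * g.

Lemma tmul_tame T : tame T -> tame2 Lam p (tmul T).
Proof.
move=> [_ HT] al al0.
have [r r0 Hr] := smooth_norm_wbound q_gt0 q_neq1 SU2 h_Haar t_irreps L2_GNS sgn al0.
have [r' r'0 Hr'] := HT r r0.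
have m0 : 0 <= Num.max r r' by rewrite le_max r0.
have [be be0 Hbe] := wbound_smooth_norm q_gt0 q_neq1 SU2 h_Haar t_irreps L2_GNS sgn m0.
(* Each of the two uses of [wbound_smooth_norm] contributes a factor 2. *)
exists be, 4; split=> // f g; apply: Hr.
have -> : 4 * (p be (Lam f) * p be (Lam g)) = (2 * p be (Lam f)) * (2 * p be (Lam g)) by ring.
apply: wboundM => //.
  by apply: Hr'; apply: wbound_anti (Hbe f) => //; rewrite le_max lexx orbT.
by apply: wbound_anti (Hbe g) => //; rewrite le_max lexx.
Qed.

Lemma tame_id : tame id.
Proof. by split=> // r r0; exists r. Qed.

Let tl T (HT : tame T) k f f' g : tmul T (k *: f + f') g = k *: tmul T f g + tmul T f' g.
Proof. by case: HT => H _; rewrite /tmul H mulrDl scalerAl. Qed.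
Let tr T k f g g' : tmul T f (k *: g + g') = k *: tmul T f g + tmul T f g'.
Proof. by rewrite /tmul mulrDr scalerAr. Qed.

Definition text (T : A -> A) : L2 -> L2 -> L2 := ext2 Lam E p (tmul T).

Section Tame.
Variables (T : A -> A) (HT : tame T).
Lemma text_mem x y : E x -> E y -> E (text T x y).
Proof. exact: (ext2_mem EZD ELam p_ge0 pD pZ approx complete (tl HT) (tr T) (tmul_tame HT)). Qed.
Lemma text_cvg x y s r : E x -> E y ->
   frcvg (fun n => Lam (s n)) x -> frcvg (fun n => Lam (r n)) y ->
   frcvg (fun n => Lam (T (s n) * r n)) (text T x y).
Proof. exact: (ext2_cvg EZD ELam p_ge0 pD pZ approx complete (tl HT) (tr T) (tmul_tame HT)). Qed.
Lemma text_Lam f g : text T (Lam f) (Lam g) = Lam (T f * g).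
Proof. exact: (ext2_Lam EZD ELam p_ge0 pD pZ p_sep approx complete (tl HT) (tr T) (tmul_tame HT)). Qed.
Lemma textl k x x' y : E x -> E x' -> E y -> text T (k *: x + x') y = k *: text T x y + text T x' y.
Proof. exact: (ext2l E0 EZD ELam p_ge0 pD pZ p_sep approx complete (tl HT) (tr T) (tmul_tame HT)). Qed.
Lemma textr k x y y' : E x -> E y -> E y' -> text T x (k *: y + y') = k *: text T x y + text T x y'.
Proof. exact: (ext2r E0 EZD ELam p_ge0 pD pZ p_sep approx complete (tl HT) (tr T) (tmul_tame HT)). Qed.
Lemma text_tame al : 0 <= al -> exists be K, [/\ 0 <= be, 0 <= K &
  forall x y, E x -> E y -> p al (text T x y) <= K * (p be x * p be y)].
Proof. exact: (ext2_tame EZD ELam p_ge0 pD pZ approx complete (tl HT) (tr T) (tmul_tame HT)). Qed.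
End Tame.

Let frcvg_uniq s x y : (forall n, E (s n)) -> E x -> E y -> frcvg s x -> frcvg s y -> x = y.
Proof. exact: (fr_cvg_uniq EZD p_ge0 pD pZ p_sep). Qed.
Let cst x : E x -> frcvg (fun=> x) x.
Proof. exact: (fr_cvg_cst pZ). Qed.


Local Notation M := (text id).
Let M1 : E (Lam 1). Proof. exact: ELam. Qed.
Let Mm x y : E x -> E y -> E (M x y). Proof. exact: (text_mem tame_id). Qed.

Let mulA x y z : E x -> E y -> E z -> M x (M y z) = M (M x y) z.
Proof.
move=> Ex Ey Ez; have [s sx] := approx Ex; have [r ry] := approx Ey.
have [v vz] := approx Ez.
have H1 := text_cvg tame_id Ex Ey sx ry; have H2 := text_cvg tame_id Ey Ez ry vz.
apply: (@frcvg_uniq (fun n => Lam (s n * (r n * v n)))).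
- by move=> n; exact: ELam.
- exact: Mm Ex (Mm Ey Ez).
- exact: Mm (Mm Ex Ey) Ez.
- exact: (text_cvg tame_id Ex (Mm Ey Ez) sx H2).
- have := text_cvg tame_id (Mm Ex Ey) Ez H1 vz.
  by apply: fr_cvg_ext => n; rewrite mulrA.
Qed.

Let mul1l x : E x -> M (Lam 1) x = x.
Proof.
move=> Ex; have [s sx] := approx Ex.
apply: (@frcvg_uniq (fun n => Lam (s n)) _ _ _ (Mm M1 Ex) Ex _ sx); first by move=> n; exact: ELam.
have := text_cvg tame_id M1 Ex (cst M1) sx.
by apply: fr_cvg_ext => n; rewrite mul1r.
Qed.

Let mul1r x : E x -> M x (Lam 1) = x.
Proof.
move=> Ex; have [s sx] := approx Ex.
apply: (@frcvg_uniq (fun n => Lam (s n)) _ _ _ (Mm Ex M1) Ex _ sx); first by move=> n; exact: ELam.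
have := text_cvg tame_id Ex M1 sx (cst M1).
by apply: fr_cvg_ext => n; rewrite mulr1.
Qed.

Let one_neq0 : Lam 1 <> 0.
Proof.
move/(Lam_inj q_gt0 SU2 h_Haar t_irreps L2_GNS)/eqP.
by rewrite oner_eq0.
Qed.

Definition smooth_algebra : algebra_on E :=
  AlgebraOn E0 EZD M1 Mm one_neq0 mulA mul1l mul1r
    (@textl id tame_id) (@textr id tame_id).

Local Notation B := (ao_type smooth_algebra).
Local Notation kappa := (@ao_incl C L2 E smooth_algebra).

Lemma kappa_mem x : E (kappa x).
Proof. exact: ao_incl_mem. Qed.

Lemma smooth_embedding : exists iota : {lrmorphism A -> B}, forall f, kappa (iota f) = Lam f.
Proof.
have [io ioE] : {io : A -> B & forall f, kappa (io f) = Lam f}.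
  by apply: (@choice A B (fun f b => kappa b = Lam f)) => f; exact: ao_incl_onto (ELam f).
have iol : linear io.
  by move=> k f g; apply: ao_incl_inj; rewrite linearP /= !ioE linearP.
have iom : monoid_morphism io.
  split; first by apply: ao_incl_inj; rewrite ioE.
  move=> f g; apply: ao_incl_inj; rewrite ao_inclM !ioE /=.
  by rewrite (text_Lam tame_id).
pose L := GRing.isLinear.Build C A B *:%R io iol.
pose MM := GRing.isMonoidMorphism.Build A B io iom.
pose iota : {lrmorphism A -> B} := HB.pack io L MM.
by exists iota.
Qed.

Variable iota : {lrmorphism A -> B}.
Hypothesis iotaE : forall f, kappa (iota f) = Lam f.

Definition acvg (s : nat -> A) (x : B) := frcvg (fun n => Lam (s n)) (kappa x).

Lemma acvg_ex x : exists s, acvg s x.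
Proof. exact: approx (kappa_mem x). Qed.
Lemma acvg_uniq s x y : acvg s x -> acvg s y -> x = y.
Proof.
by move=> sx sy; apply: ao_incl_inj; apply: frcvg_uniq sx sy => //; exact: kappa_mem.
Qed.
Lemma acvg_ext s s' x : s =1 s' -> acvg s x -> acvg s' x.
Proof. by move=> /funext ->. Qed.
Lemma acvgM s r x y : acvg s x -> acvg r y -> acvg (fun n => s n * r n) (x * y).
Proof. by move=> sx ry; apply: (text_cvg tame_id) => //; exact: kappa_mem. Qed.
Lemma acvgD s r x y : acvg s x -> acvg r y -> acvg (fun n => s n + r n) (x + y).
Proof.
move=> sx ry.
have := fr_cvgZD E0 EZD p_ge0 pD pZ 1 (fun n => ELam (s n)) (fun n => ELam (r n))
  (kappa_mem x) (kappa_mem y) sx ry.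
rewrite scale1r /acvg linearD /=.
by apply: fr_cvg_ext => n; rewrite scale1r linearD.
Qed.
Lemma acvg0 : acvg (fun=> 0) 0.
Proof. by rewrite /acvg !linear0; exact: cst. Qed.
Lemma acvg_sum (I : finType) (s : I -> nat -> A) (x : I -> B) :
  (forall i, acvg (s i) (x i)) -> acvg (fun n => \sum_i s i n) (\sum_i x i).
Proof.
move=> H; rewrite (_ : (fun n => _) = \big[(fun a b n => a n + b n)/(fun=> 0)]_i s i).
  by elim/big_rec2: _ => [|i a b _]; [exact: acvg0|exact: acvgD].
apply/funext => n; elim/big_rec2: _ => // i a b _ ->; reflexivity.
Qed.

Lemma tame_extension T : tame T -> exists Th : {linear B -> B},
  [/\ forall f, Th (iota f) = iota (T f),
      seminorm_continuous (Cinf_seminorm D kappa) Th &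
      forall s x, acvg s x -> acvg (fun n => T (s n)) (Th x)].
Proof.
move=> HT.
(* The extension of T at x is that of T(f) g at the pair (x, 1). *)
have [th thE] : {th : B -> B & forall x, kappa (th x) = text T (kappa x) (Lam 1)}.
  by apply: (@choice B B (fun x b => kappa b = text T (kappa x) (Lam 1))) => x; exact: ao_incl_onto (text_mem HT (kappa_mem x) M1).
have thl : linear th.
  move=> k x y; apply: ao_incl_inj; rewrite linearP /= !thE linearP /=.
  by rewrite (textl HT) //; exact: kappa_mem.
pose L := GRing.isLinear.Build C B B *:%R th thl.
pose Th : {linear B -> B} := HB.pack th L.
exists Th; split.
- move=> f; apply: ao_incl_inj; rewrite iotaE [LHS]thE iotaE (text_Lam HT).
  by rewrite mulr1.
- apply: seminorm_continuous_bounded => [x y|al al0|al x]; first exact: linearB.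
    have [be [K [be0 K0 HK]]] := text_tame HT al0.
    exists be, (K * p be (Lam 1)); split=> //; first by rewrite mulr_ge0.
    move=> x; rewrite /Cinf_seminorm [X in p al X]thE.
    by rewrite -mulrA [p be _ * _]mulrC; apply: HK => //; exact: kappa_mem.
  exact: p_ge0.
- move=> s x sx; rewrite /acvg [X in fr_cvg _ _ X]thE.
  have := text_cvg HT (kappa_mem x) M1 sx (cst M1).
  by apply: fr_cvg_ext => n; rewrite mulr1.
Qed.

Lemma smooth_algebraP : is_smooth_algebra Lam D kappa iota.
Proof.
split=> //.
- by split; [exact: ao_incl_inj|exact: range_ao_incl].
- move=> f g fg; have := iotaE f; rewrite fg iotaE => /eqP.
  rewrite eq_sym -subr_eq0 -linearB => /eqP.
  by move=> /(Lam_inj q_gt0 SU2 h_Haar t_irreps L2_GNS)/eqP; rewrite subr_eq0 => /eqP.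
- move=> x y; apply: seminorm_mul_continuous => [al z|al z w al0|al al0].
  + exact: p_ge0.
  + by rewrite /Cinf_seminorm linearD; apply: pD => //; exact: kappa_mem.
  + have [be [K [be0 K0 HK]]] := text_tame tame_id al0.
    by exists be, K; split=> // z w; apply: HK; exact: kappa_mem.
Qed.

Variables (n : nat) (ract : 'rV[A]_n -> A -> 'rV[A]_n) (d : A -> 'rV[A]_n).
Hypothesis fodc : is_fodc ract d.

(** All entries are treated together because the Leibniz rule couples d with the right action; only
    the whole matrix is multiplicative. *)
Lemma calculus_mx_tame i j : tame (fun f => calculus_mx ract d f i j).
Proof.
split; first exact: (calculus_mx_linear fodc).
move=> r r0.
have [r' r'0 Hr'] := wbound_hom r0 (calculus_mx_linear fodc) (calculus_mx1 fodc) (calculus_mxM fodc).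
by exists r' => // f W HW; exact: Hr'.
Qed.

Lemma dcoef_tame i : tame (dcoef d i).
Proof.
have := calculus_mx_tame (lshift n 0) (rshift 1 i).
congr tame; apply/funext => f.
by rewrite /calculus_mx block_mxEur.
Qed.

Lemma ccoef_tame i j : tame (ccoef ract i j).
Proof.
have := calculus_mx_tame (rshift 1 i) (rshift 1 j).
congr tame; apply/funext => f.
by rewrite /calculus_mx block_mxEdr mxE.
Qed.

Lemma calculus_extends : continuously_extends D kappa iota ract d.
Proof.
have [dB HdB] := choice (fun i => tame_extension (dcoef_tame i)).
have [CB0 HCB] := choice (fun ij : 'I_n * 'I_n => tame_extension (ccoef_tame ij.1 ij.2)).
pose CB i j := CB0 (i, j).
have {}HCB i j := HCB (i, j).
exists dB, CB; split.
- by move=> i; have [] := HdB i.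
- by move=> i j; have [] := HCB i j.
- by move=> i; have [] := HdB i.
- by move=> i j; have [] := HCB i j.
have C1 i j : CB i j 1 = (i == j)%:R.
  have [H _ _] := HCB i j; rewrite -[X in CB i j X](rmorph1 iota) [LHS]H /=.
  have /matrixP/(_ i j) := cmx1 fodc; rewrite !mxE => ->.
  by case: (i == j); [exact: (rmorph1 iota)|exact: (raddf0 iota)].
(* On A this is [cmxM]. Approximating f and g by sequences in A carries it to the limit; the Leibniz
   rule is obtained in the same way. *)
have CM i j f g : CB i j (f * g) = \sum_k CB i k f * CB k j g.
  have [s sf] := acvg_ex f; have [r rg] := acvg_ex g.
  have [_ _ H] := HCB i j; apply: acvg_uniq (H _ _ (acvgM sf rg)) _.
  have := acvg_sum (fun k => acvgM (let: And3 _ _ X := HCB i k in X _ _ sf)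
      (let: And3 _ _ X := HCB k j in X _ _ rg)).
  apply: acvg_ext => m /=; have /matrixP/(_ i j) := cmxM fodc (s m) (r m).
  by rewrite !mxE => ->; apply: eq_bigr => k _; rewrite !mxE.
have dM i f g : dB i (f * g) = \sum_k dB k f * CB k i g + f * dB i g.
  have [s sf] := acvg_ex f; have [r rg] := acvg_ex g.
  have [_ _ H] := HdB i; apply: acvg_uniq (H _ _ (acvgM sf rg)) _.
  have := acvgD (acvg_sum (fun k => acvgM (let: And3 _ _ X := HdB k in X _ _ sf)
      (let: And3 _ _ X := HCB k i in X _ _ rg))) (acvgM sf (H _ _ rg)).
  apply: acvg_ext => m /=; rewrite /dcoef (fodc_leibniz fodc) mxE (ract_mx fodc) mxE.
  by congr (_ + _); [apply: eq_bigr => k _|]; rewrite !mxE.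
have Ck i j (k : C) f : CB i j (k%:A * f) = k *: CB i j f by rewrite mulr_algl linearZ.
split.
- by move=> w1 w2 f; apply/rowP => j; rewrite !mxE -big_split; apply: eq_bigr => i _; rewrite !mxE mulrDl.
- by move=> w f g; apply/rowP => j; rewrite !mxE -big_split; apply: eq_bigr => i _; rewrite linearD mulrDr.
- move=> w; apply/rowP => j; rewrite mxE (bigD1 j) //= C1 eqxx mulr1 big1 ?addr0 //.
  by move=> i /negPf ij; rewrite C1 ij mulr0.
- move=> w f g; apply/rowP => j; rewrite !mxE.
  transitivity (\sum_i \sum_k w 0 i * CB i k f * CB k j g).
    by apply: eq_bigr => i _; rewrite CM mulr_sumr; apply: eq_bigr => k _; rewrite mulrA.
  rewrite exchange_big; apply: eq_bigr => k _; rewrite mxE mulr_suml.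
  by apply: eq_bigr.
- move=> f w g; apply/rowP => j; rewrite !mxE mulr_sumr; apply: eq_bigr => i _.
  by rewrite mxE mulrA.
- move=> k w; apply/rowP => j; rewrite !mxE (bigD1 j) //= big1 ?addr0.
    by rewrite linearZ /= C1 eqxx mulr_algr mulr_algl.
  by move=> i /negPf ij; rewrite linearZ /= C1 ij scaler0 mulr0.
- by move=> k f g; apply/rowP => j; rewrite !mxE linearP mulr_algl.
- move=> f g; apply/rowP => j; rewrite !mxE dM; congr (_ + _).
  by apply: eq_bigr => k _; rewrite mxE.
- move=> w.
  have dE f : \row_i dB i (iota f) = map_mx iota (d f).
    by apply/rowP => i; rewrite !mxE; have [-> _ _] := HdB i.
  pose reach (v : 'rV[B]_n) := exists m (f g : 'I_m -> B), v = \sum_i f i *: \row_j dB j (g i).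
  have reachD v v' : reach v -> reach v' -> reach (v + v').
    move=> [m [f [g ->]]] [m' [f' [g' ->]]].
    exists (m + m')%N, (fun i => match fintype.split i with inl a => f a | inr b => f' b end),
      (fun i => match fintype.split i with inl a => g a | inr b => g' b end).
    rewrite big_split_ord; congr (_ + _); apply: eq_bigr => i _.
      by rewrite (unsplitK (inl i)).
    by rewrite (unsplitK (inr i)).
  have reach0 : reach 0 by exists 0%N, (fun=> 0), (fun=> 0); rewrite big_ord0.
  (* No limit is involved in the spanning property: each basis form is already a finite sum of terms
     f dg over A, and the smooth coefficient multiplies it from the left. *)
  have reachA b v : reach (b *: map_mx iota v).
    have [m [f [g ->]]] := fodc_span fodc v.
    exists m, (fun i => b * iota (f i)), (fun i => iota (g i)).
    rewrite (raddf_sum (map_mx iota)) scaler_sumr; apply: eq_bigr => i _.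
    rewrite dE -scalerA; congr (_ *: _); apply/rowP => j; rewrite !mxE.
    exact: rmorphM.
  suff : reach w by [].
  have -> : w = \sum_i w 0 i *: map_mx iota (delta_mx 0 i).
    rewrite {1}[w]row_sum_delta; apply: eq_bigr => i _; congr (_ *: _).
    by apply/rowP => j; rewrite !mxE rmorph_nat.
  by elim/big_rec: _ => // i v _ Hv; exact: reachD.
Qed.

End SmoothAlgebra.

Theorem proposition7p11 (R : realType) (q : R) (q_gt0 : 0 < q) (q_neq1 : q != 1)
  (star : CqSU2 q -> CqSU2 q)
  (Delta : {lrmorphism CqSU2 q -> tensor (CqSU2 q)})
  (SU2 : is_SU2_structure star Delta)
  (h : {linear CqSU2 q -> R[i]^o}) (h_Haar : is_Haar_state star Delta h)
  (t : forall k : nat, 'M[CqSU2 q]_k.+1) (t_irreps : is_SU2_irreps star Delta t)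
  (L2 : completeNormedModType R[i]) (ip : L2 -> L2 -> R[i])
  (Lam : {linear CqSU2 q -> L2}) (L2_GNS : is_GNS_space star h ip Lam)
  (sgn : forall k : nat, 'I_k.+1 -> 'I_k.+1 -> bool)
  (ract : 'rV[CqSU2 q]_4 -> CqSU2 q -> 'rV[CqSU2 q]_4)
  (d : CqSU2 q -> 'rV[CqSU2 q]_4) (calc4D : is_4D_calculus ract d) :
  exists (Cinf : algType R[i]) (kappa : {linear Cinf -> L2})
         (iota : {lrmorphism CqSU2 q -> Cinf}),
    is_smooth_algebra Lam (Dirac Lam t sgn) kappa iota /\
    continuously_extends (Dirac Lam t sgn) kappa iota ract d.
Proof.
have [iota iotaE] := smooth_embedding q_gt0 q_neq1 SU2 h_Haar t_irreps L2_GNS sgn.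
exists (ao_type (smooth_algebra q_gt0 q_neq1 SU2 h_Haar t_irreps L2_GNS sgn)).
exists (@ao_incl _ _ _ _), iota; split.
  exact: smooth_algebraP iotaE.
exact: (calculus_extends iotaE (calc4D_fodc calc4D)).
Qed.
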